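(* There is a universal constant $\varepsilon_0>0$ and a randomized algorithm that, given query access to an $n$-point metric $w$ with positive integer entries under the promise that the complete graph $G_w$ has a minimum spanning tree all of whose edges have weight $1$, performs $\tilde O(n^{1.5})$ distance queries and with high probability outputs a value $X$ with $\mathsf{TSP}(w)\le X\le(2-\varepsilon_0)\,\mathsf{TSP}(w)$.
   Context: Query access means that the algorithm may query any entry $w(u,v)$ of the $n\times n$ distance matrix. $G_w$ is the complete graph on the $n$ points with edge weights $w$; $\mathsf{TSP}(w)$ is the minimum weight of a Hamiltonian cycle in $G_w$. $\tilde O$ hides polylogarithmic factors in $n$. *)

(* Defs.v *)
From mathcomp Require Import all_boot all_order all_algebra all_fingroup.
Set Implicit Arguments. Unset Strict Implicit. Unset Printing Implicit Defensive.
Import Order.TTheory GRing.Theory Num.Theory.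
Local Open Scope ring_scope.

Definition dist (n : nat) := 'I_n -> 'I_n -> nat.

Definition pos_int_metric (n : nat) (w : dist n) : Prop :=
  [/\ forall u, w u u = 0%N,
      forall u v, u != v -> (0 < w u v)%N,
      forall u v, w u v = w v u &
      forall u v x, (w u v <= w u x + w x v)%N].

(* Edges of the complete graph G_w: unordered pairs {u,v}, u <> v,
   represented as ordered pairs (u,v) with u < v. *)
Definition is_edge (n : nat) (e : 'I_n * 'I_n) : bool := (e.1 < e.2)%N.

Definition edge_rel (n : nat) (T : {set 'I_n * 'I_n}) : rel 'I_n :=
  fun u v => ((u, v) \in T) || ((v, u) \in T).

Definition spanning_tree (n : nat) (T : {set 'I_n * 'I_n}) : bool :=
  [&& [forall e in T, is_edge e],
      #|T| == n.-1 &
      [forall u, forall v, connect (edge_rel T) u v]].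

Definition tree_weight (n : nat) (w : dist n) (T : {set 'I_n * 'I_n}) : nat :=
  (\sum_(e in T) w e.1 e.2)%N.

Definition is_MST (n : nat) (w : dist n) (T : {set 'I_n * 'I_n}) : Prop :=
  spanning_tree T /\
  forall T', spanning_tree T' -> (tree_weight w T <= tree_weight w T')%N.

Definition mst_all_ones (n : nat) (w : dist n) : Prop :=
  exists T, is_MST w T /\ forall e, e \in T -> w e.1 e.2 = 1%N.

Definition tour_cost (n : nat) (w : dist n) (s : {perm 'I_n}) : nat :=
  (\sum_(i < n) w (s i) (s (ordS i)))%N.

Definition TSP (n : nat) (w : dist n) : nat :=
  tour_cost w [arg min_(s < (1%g : {perm 'I_n})) tour_cost w s].

(* Randomized adaptive query algorithms on n points: a (finite, possibly
   infinitely branching) tree whose internal nodes either query an entry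
   w(u,v) of the distance matrix and branch on the answer, or flip a fair
   coin and branch on it; leaves output a (rational) value. *)
Inductive qalg (n : nat) : Type :=
| Ret of rat
| Ask of 'I_n & 'I_n & (nat -> qalg n)
| Flip of (bool -> qalg n).

Fixpoint success_prob (n : nat) (w : dist n) (P : rat -> bool) (A : qalg n)
  : rat :=
  match A with
  | Ret x => if P x then 1 else 0
  | Ask u v k => success_prob w P (k (w u v))
  | Flip k => (success_prob w P (k true) + success_prob w P (k false)) / 2%:R
  end.

Fixpoint num_queries (n : nat) (w : dist n) (A : qalg n) : nat :=
  match A with
  | Ret _ => 0%N
  | Ask u v k => (num_queries w (k (w u v))).+1
  | Flip k => maxn (num_queries w (k true)) (num_queries w (k false))
  end.

(* Main.v *)
(* The unit pairs form a connected graph G, so n <= TSP <= 2(n-1) and it suffices to tell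
   TSP <= (1+d)n from TSP > (2-e)n for small constants d and e.

   Take a normal (depth-first) spanning tree of G. A pair (a, b) bypasses the tree edge
   above x if a is below x, b is not, and 2w(a,b) is at most the tree distance from a to
   the parent of x. Many bypassed edges would give a connected even multigraph of weight at most
   (2-e)n, so if TSP > (2-e)n then few edges are bypassed and one of two things happens.

   - Many vertices of the tree are inner. Then a constant fraction of the vertices x are
     heads of a bridge x v of G that is crossed only by pairs whose weight is
     proportional to their distance from x. About sqrt(n) random rows and the rows near x
     certify this. If TSP <= (1+d)n only few x pass that test: a tour crosses each such
     bridge a second time, and a tour pair of weight k > 1 is charged O(k) times only.
   - Few vertices are inner. The leaves of a normal tree are independent, hence random
     greedy independent set removes few vertices as neighbours of chosen ones: each removal
     of a leaf is paid by the expected loss of inner vertices. If TSP <= (1+d)n an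
     independent set has at most TSP/2 vertices, so nearly half of the vertices are removed.
     Whether a random vertex is removed is decided locally: the rows of the first sqrt(n)
     draws leave a graph with O(n^1.5) edges, and the cost of the recursive evaluation is
     then controlled by a supermartingale.

   Both tests read O~(sqrt n) rows; they are amplified by repetition and a majority vote. *)

(* A row costs n queries, so each test sees about sqrt n rows (up to logarithms) of a graph of
   unbounded degree. This shapes both tests: long distances from x are only estimated, through
   chains of random rows that meet every ball of radius s with more than s vertices, and the local
   greedy evaluation starts only after s draws have thinned the graph. The factor 2 in the
   definition of a bypass is what makes bypasses profitable. Disjoint vertical segments of total
   length L are covered by pairs of total weight at most L/2; a random subfamily of these pairs
   covers each of the edges an odd number of times with probability 1/2, hence saves L/2 on average
   and costs at most L/4. Probabilities are natural-number sums over all lists of draws; a draw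
   takes one of N = 2^k slots with n < N <= 2n, so fair coins suffice. The constants are fixed in
   the order [mB], [H], [mA], [c]: the leaf test must survive [mB] repetitions when at most n/H
   vertices are inner, and [mA] is proportional to [H] because the bridge test only succeeds with
   probability about 1/H. *)
Require Import Defs.
From mathcomp Require Import all_boot all_order all_algebra all_fingroup zify ring lra.
Set Implicit Arguments. Unset Strict Implicit. Unset Printing Implicit Defensive.
Import Order.TTheory GRing.Theory Num.Theory.
Local Open Scope nat_scope.

(** * Closed walks *)

Section Walks.
Variables (T : finType) (w : T -> T -> nat).
Hypotheses (w0 : forall u, w u u = 0) (wS : forall u v, w u v = w v u).
Hypothesis wT : forall u v x, w u v <= w u x + w x v.

Fixpoint pcost x p := if p is y :: p' then w x y + pcost y p' else 0.

Definition ccost c := if c is x :: p then pcost x (rcons p x) else 0.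

Lemma pcost_cat x p q : pcost x (p ++ q) = pcost x p + pcost (last x p) q.
Proof. by elim: p x => //= y p IH x; rewrite IH addnA. Qed.

Lemma pcost_rcons x p y : pcost x (rcons p y) = pcost x p + w (last x p) y.
Proof. by rewrite -cats1 pcost_cat /= addn0. Qed.

Lemma pcost_subseq x p q z :
  subseq p q -> pcost x (rcons p z) <= pcost x (rcons q z).
Proof.
elim: q x p => [|y q IH] x [|y' p] //=.
- move=> _; have := IH y [::] (sub0seq _); rewrite /= !addn0 => le1.
  by apply: leq_trans (wT x z y) _; rewrite leq_add2l.
- case: eqP => [<- |_] /IH le1; first by rewrite leq_add2l le1.
  have := le1 y; rewrite /= => le2; apply: leq_trans (leq_add (leqnn (w x y)) le2).
  by rewrite addnA leq_add2r wT.
Qed.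

Lemma ccost_rot i c : ccost (rot i c) = ccost c.
Proof.
have rot1E s : ccost (rot 1 s) = ccost s.
  case: s => [|x [|y p]] //; rewrite rot1_cons /=.
  by rewrite pcost_rcons last_rcons addnC.
elim: i c => [|i IH] c; first by rewrite rot0.
case: (ltnP i (size c)) => [lt_i|le_c]; first by rewrite -add1n rotD // rot1E IH.
by rewrite rot_oversize // (leq_trans le_c).
Qed.

Lemma ccost_splice y p q :
  ccost ((y :: p) ++ (y :: q)) = ccost (y :: p) + ccost (y :: q).
Proof.
by rewrite /= rcons_cat /= -cat_rcons pcost_cat last_rcons.
Qed.

(** Degree parity in a multigraph; comparing the two tests with [!=] makes a loop count as nothing,
    in line with its even contribution to a degree. *)
Definition epar (es : seq (T * T)) z :=
  odd (count (fun e => (e.1 == z) != (e.2 == z)) es).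

Definition ecost (es : seq (T * T)) := \sum_(e <- es) w e.1 e.2.

Lemma epar_cons e es z :
  epar (e :: es) z = (e.1 == z) (+) (e.2 == z) (+) epar es z.
Proof. by rewrite /epar /= oddD oddb; case: (e.1 == z); case: (e.2 == z). Qed.

Lemma epar_perm es es' z : perm_eq es es' -> epar es z = epar es' z.
Proof. by move=> /seq.permP eq_es; rewrite /epar eq_es. Qed.

(** Leaving [u] along any incident edge moves the odd pair to the new endpoint and [v], so induction
    on the number of edges applies. The last clause records where consumed edges went, which is the
    connectivity information that merging closed walks needs. *)
Lemma euler_trail es u v : u != v ->
    (forall z, epar es z = (z == u) (+) (z == v)) ->
  exists p es', [/\ last u p = v, ecost es = pcost u p + ecost es',
    forall z, epar es' z = false, size es' < size es &
    forall e, e \in es -> e \in es' \/ (e.1 \in u :: p /\ e.2 \in u :: p)].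
Proof.
have [m] := ubnP (size es); elim: m es u => // m IH es u sz uv es_par.
have odd_u : epar es u by rewrite es_par eqxx (negPf uv).
have : has (fun e => (e.1 == u) != (e.2 == u)) es.
  by rewrite has_count; move: odd_u; rewrite /epar; case: (count _ _).
case/hasP=> e e_es e_u; set es1 := rem e es; have perm_es := perm_to_rem e_es.
have {e_u} [y [y_e u_e cost_e yu]] : exists y, [/\ y \in [:: e.1; e.2],
    (forall z, (e.1 == z) (+) (e.2 == z) = (z == u) (+) (z == y)),
    w e.1 e.2 = w u y & e.1 \in [:: u; y] /\ e.2 \in [:: u; y]].
  case: (eqVneq e.1 u) e_u => [e1|e1] /=.
    case: (eqVneq e.2 u) => // e2 _; exists e.2; rewrite e1 !inE !eqxx !orbT; split=> //.
    by move=> z; rewrite (eq_sym z u) (eq_sym z e.2).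
  case: (eqVneq e.2 u) => // e2 _; exists e.1; rewrite e2 !inE !eqxx !orbT; split=> //.
    by move=> z; rewrite (eq_sym z u) (eq_sym z e.1) addbC.
have es1_par z : epar es1 z = (z == y) (+) (z == v).
  have := es_par z; rewrite (epar_perm _ perm_es) epar_cons u_e -/es1.
  by case: (z == u) (z == y) (z == v) (epar es1 z) => [] [] [] [].
have cost_es : ecost es = w u y + ecost es1.
  by rewrite /ecost (perm_big _ perm_es) big_cons cost_e.
have sz1 : size es = (size es1).+1 by rewrite (perm_size perm_es).
have es_mem f : f \in es -> f \in es1 \/ (f.1 \in [:: u; y] /\ f.2 \in [:: u; y]).
  by rewrite (perm_mem perm_es) inE => /predU1P [->|]; [right|left].
case: (eqVneq y v) => [yv|yv].
  exists [:: v], es1; rewrite -yv; split=> //=; rewrite ?addn0 ?sz1 //.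
  by move=> z; rewrite es1_par yv addbb.
have [|p [es' [last_p cost1 par' sz' mem']]] := IH es1 y _ yv es1_par.
  by rewrite -ltnS -sz1.
exists (y :: p), es'; split=> //=; first by rewrite cost_es cost1 addnA.
  by rewrite sz1 ltnW.
move=> f /es_mem [/mem' [|[f1 f2]]|[f1 f2]]; [by left|right|right].
  by rewrite ![_ \in u :: _]inE f1 f2 !orbT.
by rewrite !inE in f1 f2 *; case/orP: f1 => ->; case/orP: f2 => ->; rewrite ?orbT.
Qed.

(** Deleting one edge leaves its two ends as the only odd vertices; a trail between them closes up
    with that edge. *)
Lemma euler_cycles es : (forall z, epar es z = false) ->
  exists cs : seq (seq T), ecost es = \sum_(c <- cs) ccost c /\
    forall e, e \in es -> exists2 c, c \in cs & e.1 \in c /\ e.2 \in c.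
Proof.
have [m] := ubnP (size es); elim: m es => // m IH [|e es] /= sz es_par.
  by exists [::]; rewrite /ecost !big_nil.
have es_par1 z : epar es z = (z == e.1) (+) (z == e.2).
  have := es_par z; rewrite epar_cons (eq_sym z e.1) (eq_sym z e.2).
  by case: (e.1 == z) (e.2 == z) (epar es z) => [] [] [].
case: (eqVneq e.2 e.1) => [e21|ne21].
  have [|z|cs [cost_cs mem_cs]] := IH es; rewrite ?es_par1 ?e21 ?addbb //.
  exists ([:: e.1] :: cs); split.
    by rewrite /ecost big_cons e21 w0 big_cons /= w0 addn0 add0n.
  move=> f; rewrite inE => /predU1P [->|/mem_cs [c c_cs fc]].
    by exists [:: e.1]; rewrite ?e21 !inE !eqxx.
  by exists c; rewrite // inE c_cs orbT.
have [|p [es' [last_p cost1 par' sz' mem']]] := @euler_trail es _ _ ne21.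
  by move=> z; rewrite es_par1 addbC.
have [|//|cs [cost_cs mem_cs]] := IH es'.
  by move: sz sz'; lia.
have p_nil : p != [::] by apply: contraNneq ne21 => p0; rewrite -last_p p0.
case/lastP: p p_nil last_p cost1 mem' => // p x _; rewrite last_rcons => -> cost1 mem'.
exists ((e.1 :: e.2 :: p) :: cs); split.
  rewrite /ecost big_cons -/(ecost es) cost1 cost_cs big_cons /=.
  by rewrite addnA.
move=> f; rewrite inE => /predU1P [->|/mem' [/mem_cs [c c_cs fc]|]].
- by exists (e.1 :: e.2 :: p); rewrite !inE !eqxx ?orbT.
- by exists c; rewrite // inE c_cs orbT.
- case=> f1 f2; exists (e.1 :: e.2 :: p); first by rewrite inE eqxx.
  by move: f1 f2; rewrite !inE !mem_rcons !inE => /or3P [] -> /or3P [] ->; rewrite ?orbT.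
Qed.

(* Closed walks that meet are spliced; one that meets no other already covers
   the connected graph. *)
Lemma merge_cycles (es : seq (T * T)) (cs : seq (seq T)) c r :
    (forall e, e \in es -> exists2 c', c' \in c :: cs & e.1 \in c' /\ e.2 \in c') ->
    (forall z, connect (fun u v => ((u, v) \in es) || ((v, u) \in es)) r z) ->
    r \in c ->
  exists2 c', (forall z, z \in c') & ccost c' <= ccost c + \sum_(d <- cs) ccost d.
Proof.
move=> + es_conn; have [m] := ubnP (size cs); elim: m cs c => // m IH cs c sz es_mem rc.
case: (boolP (has (fun d => has (mem c) d) cs)) => [/hasP [d d_cs]|disj].
  case/hasP=> y yd yc; have perm_cs := perm_to_rem d_cs.
  have := (rot_index yc, rot_index yd).
  set p := drop _ _ ++ _; set q := drop (index y d).+1 d ++ _; case=> c_rot d_rot.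
  have [|f||c' c'_all c'_cost] := IH (rem d cs) ((y :: p) ++ (y :: q)).
  - by rewrite -ltnS (leq_trans _ sz) // ltnS (perm_size perm_cs).
  - move=> /es_mem [c1]; rewrite inE (perm_mem perm_cs) inE.
    case/or3P=> [/eqP->|/eqP->|c1_cs] [f1 f2].
    + exists ((y :: p) ++ (y :: q)); first by rewrite inE eqxx.
      by rewrite !mem_cat -c_rot !mem_rot f1 f2.
    + exists ((y :: p) ++ (y :: q)); first by rewrite inE eqxx.
      by rewrite !mem_cat -d_rot !mem_rot f1 f2 !orbT.
    + by exists c1; rewrite // inE c1_cs orbT.
  - by rewrite mem_cat -c_rot mem_rot rc.
  exists c' => //; rewrite (leq_trans c'_cost) // ccost_splice -c_rot -d_rot !ccost_rot.
  by rewrite (perm_big _ perm_cs) big_cons addnA.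
exists c; last by rewrite leq_addr.
move=> z; have /connectP [p] := es_conn z.
elim: p r {es_conn IH} rc => [|y p IHp] x xc /=; first by move=> _ ->.
case/andP=> xy; apply: IHp.
have [e [e_es ex ey]] : exists e, [/\ e \in es, x \in [:: e.1; e.2] & y \in [:: e.1; e.2]].
  by case/orP: xy => xy; [exists (x, y) | exists (y, x)]; rewrite !inE !eqxx ?orbT.
have [c' c'_cs [e1 e2]] := es_mem e e_es.
have in_c' t : t \in [:: e.1; e.2] -> t \in c' by rewrite !inE => /orP [] /eqP ->.
move: c'_cs; rewrite inE => /predU1P [<-|c'_cs]; first exact: in_c'.
case/negP: disj; apply/hasP; exists c' => //; apply/hasP; exists x => //.
exact: in_c'.
Qed.

Lemma euler_tour es r : (forall z, epar es z = false) ->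
    (forall z, connect (fun u v => ((u, v) \in es) || ((v, u) \in es)) r z) ->
  exists2 c, (forall z, z \in c) & ccost c <= ecost es.
Proof.
move=> /euler_cycles [cs [-> mem_cs]] es_conn.
have [|||c c_all c_cost] := @merge_cycles es cs [:: r] r.
- by move=> e /mem_cs [c c_cs]; exists c; rewrite // inE c_cs orbT.
- exact: es_conn.
- by rewrite inE.
by exists c => //; rewrite (leq_trans c_cost) //= w0.
Qed.

Lemma ccost_uniq c : exists2 c', uniq c' & c' =i c /\ ccost c' <= ccost c.
Proof.
case: c => [|x p]; first by exists [::].
exists (x :: filter (predC1 x) (undup p)).
  by rewrite /= filter_uniq ?undup_uniq // mem_filter /= eqxx.
split; last exact/pcost_subseq/(subseq_trans (filter_subseq _ _))/undup_subseq.
by move=> z; rewrite !inE mem_filter mem_undup /=; case: eqP.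
Qed.

End Walks.

Lemma TSP_min n (w : dist n) s : TSP w <= tour_cost w s.
Proof. by rewrite /TSP; case: arg_minnP => // s0 _; apply. Qed.

Lemma TSP_le_ccost n (w : dist n) c :
  (forall u v x, w u v <= w u x + w x v) -> (forall z, z \in c) ->
  TSP w <= ccost w c.
Proof.
move=> wT c_all; have [c' c'_uniq [c'_c c'_cost]] := ccost_uniq wT c.
apply: leq_trans c'_cost; have {c_all c'_c} c'_all z : z \in c' by rewrite c'_c.
have sz : size c' = n.
  have /card_uniqP <- := c'_uniq; rewrite -[RHS]card_ord; apply: eq_card => z.
  by rewrite c'_all.
case: n w wT c' c'_uniq c'_all sz {c} => [|n] w wT c' c'_uniq c'_all sz.
  apply: leq_trans (TSP_min w 1%g) _; rewrite /tour_cost big_ord0 //.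
pose f (i : 'I_n.+1) := nth ord0 c' i.
have f_inj : injective f.
  move=> i j /eqP; rewrite /f nth_uniq ?sz ?ltn_ord // => /eqP; exact: val_inj.
apply: leq_trans (TSP_min w (perm f_inj)) _; rewrite /tour_cost.
under eq_bigr => i _ do rewrite !permE /f.
case: c' sz @f f_inj {c'_uniq c'_all} => // x p [sz] f f_inj.
have -> : ccost w (x :: p) =
    \sum_(i < (size p).+1) w (nth ord0 (x :: p) i) (nth ord0 (rcons p x) i).
  have: forall (y z : 'I_n.+1) q, pcost w y (rcons q z) =
    \sum_(i < (size q).+1) w (nth ord0 (y :: q) i) (nth ord0 (rcons q z) i).
    move=> y z q; elim: q y => [|t q IH] y /=; first by rewrite big_ord1 addn0.
    by rewrite big_ord_recl IH.
  by move=> /(_ x x p).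
rewrite sz; apply: eq_leq; apply: eq_bigr => i _; congr (w _ _).
rewrite /= nth_rcons sz; have [lt_i|] := ltnP i n; first by rewrite modn_small.
move=> le_n; have -> : (i : nat) = n by apply/eqP; rewrite eqn_leq le_n -ltnS ltn_ord.
by rewrite modnn eqxx.
Qed.

(** * Normal spanning trees and bypassed edges *)

Section Balls.
Variables (T : finType) (e : rel T).

Definition nbh (S : {set T}) := S :|: [set z | [exists u in S, e u z]].
Definition ball x i := iter i nbh [set x].

Lemma ballSP x i z :
  reflect (z \in ball x i \/ exists2 u, u \in ball x i & e u z) (z \in ball x i.+1).
Proof.
rewrite /ball iterS -/(ball x i) !inE; apply: (iffP orP).
  by case=> [|/existsP [u /andP [? ?]]]; [left | right; exists u].
by case=> [|[u ? ?]]; [left | right; apply/existsP; exists u; apply/andP].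
Qed.

Lemma ball0 x z : (z \in ball x 0) = (z == x).
Proof. by rewrite inE. Qed.

Lemma ball_sub x i j : i <= j -> ball x i \subset ball x j.
Proof.
move=> /subnKC <-; elim: (j - i) => [|k IH]; first by rewrite addn0.
by rewrite addnS (subset_trans IH) //; apply/subsetP => z zk; apply/ballSP; left.
Qed.

Lemma ball_center x i : x \in ball x i.
Proof. by apply: (subsetP (ball_sub x (leq0n i))); rewrite ball0. Qed.

Lemma ball_step x i u z : u \in ball x i -> e u z -> z \in ball x i.+1.
Proof. by move=> ui uz; apply/ballSP; right; exists u. Qed.

Lemma ball_trans x y z i j : y \in ball x i -> z \in ball y j -> z \in ball x (i + j).
Proof.
move=> yi; elim: j z => [|j IH] z; first by rewrite ball0 addn0 => /eqP->.
by rewrite addnS => /ballSP [/IH zi|[u /IH ui uz]]; apply/ballSP; [left|right; exists u].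
Qed.

Lemma ball_sym x z i : symmetric e -> z \in ball x i -> x \in ball z i.
Proof.
move=> e_sym; elim: i z => [|i IH] z; first by rewrite !ball0 eq_sym.
case/ballSP=> [/IH|[u /IH xi uz]]; first exact: (subsetP (ball_sub _ (leqnSn i))).
rewrite -add1n; apply: ball_trans xi; apply: (ball_step (ball_center z 0)).
by rewrite e_sym.
Qed.

Lemma connect_ball x z : connect e x z -> exists i, z \in ball x i.
Proof.
case/connectP=> p; elim/last_ind: p z => [|p y IH] z /=.
  by move=> _ ->; exists 0; rewrite ball0.
rewrite rcons_path last_rcons => /andP [/IH /(_ erefl) [i pi] py] ->.
by exists i.+1; apply: ball_step py.
Qed.

Lemma ball_connect x z i : z \in ball x i -> connect e x z.
Proof.
elim: i z => [|i IH] z; first by rewrite ball0 => /eqP->.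
by case/ballSP=> [/IH//|[u /IH xu uz]]; apply: connect_trans xu (connect1 uz).
Qed.

(* A ball of radius i that has stopped growing is a whole component. *)
Lemma ball_small x i z : #|ball x i| <= i -> connect e x z -> z \in ball x i.
Proof.
have grow j : ball x j.+1 \subset ball x j \/ j < #|ball x j|.
  elim: j => [|j [IH|IH]]; first by right; apply/card_gt0P; exists x; rewrite ball0.
    left; apply/subsetP => y /ballSP [//|[u uj uy]].
    by apply: ball_step uy; apply: (subsetP IH).
  case: (boolP (ball x j.+1 \subset ball x j)) => [sub|nsub].
    left; apply/subsetP => y /ballSP [//|[u uj uy]].
    by apply: ball_step uy; apply: (subsetP sub).
  right; apply: leq_ltn_trans IH _; apply: proper_card.
  by rewrite properE ball_sub.
case: (grow i) => [sub _|/ltn_geF->//] /connect_ball [j].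
elim: j z => [|j IH] z; first by rewrite ball0 => /eqP->; apply: ball_center.
by case/ballSP=> [/IH//|[u /IH ui uz]]; apply: (subsetP sub); apply: ball_step uz.
Qed.

Lemma ball_card_gt x i z : connect e x z -> z \notin ball x i -> i < #|ball x i|.
Proof. by move=> xz; rewrite ltnNge; apply: contra => /ball_small ->. Qed.

End Balls.

Section RootedTree.
Variables (T : finType) (e : rel T) (r : T).
Hypothesis e_sym : symmetric e.

(** The root is its own parent, so iterating [par] beyond the root is harmless and matches truncated
    subtraction of depths. *)
Definition rtree (par : T -> T) (dep : T -> nat) :=
  [/\ par r = r, dep r = 0 &
    forall y, y != r -> e y (par y) /\ dep y = (dep (par y)).+1].

Section Ancestors.
Variables (par : T -> T) (dep : T -> nat).
Hypothesis tr : rtree par dep.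

(** Descendant first: [y] lies on the path from [a] up to the root, [a] itself included. *)
Definition anc a y := fconnect par a y.

Lemma dep_par a : dep (par a) = (dep a).-1.
Proof.
case: tr => par_r dep_r tr_y; case: (eqVneq a r) => [->|/tr_y [_ ->] //].
by rewrite par_r dep_r.
Qed.

Lemma dep_iter k a : dep (iter k par a) = dep a - k.
Proof. by elim: k => [|k IH]; rewrite ?subn0 //= dep_par IH subnS. Qed.

Lemma dep_eq0 a : dep a = 0 -> a = r.
Proof.
by move=> a0; apply/eqP; apply/negPn/negP => /(let: And3 _ _ f := tr in f a) [_]; rewrite a0.
Qed.

Lemma anc_refl a : anc a a. Proof. exact: connect0. Qed.

Lemma anc_trans b a c : anc a b -> anc b c -> anc a c.
Proof. exact: connect_trans. Qed.

Lemma anc_iter a y : anc a y -> y = iter (dep a - dep y) par a.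
Proof.
move/iter_findex; move: (findex _ _ _) => k <-; rewrite dep_iter.
have [le_k|lt_k] := leqP k (dep a); first by rewrite subKn.
have /eqP -> : dep a - k == 0 by rewrite subn_eq0 ltnW.
rewrite subn0 -(subnK (ltnW lt_k)) iterD.
have -> : iter (dep a) par a = r by apply: dep_eq0; rewrite dep_iter subnn.
by elim: (k - _) => //= i ->; case: tr.
Qed.

Lemma anc_dep a y : anc a y -> dep y <= dep a.
Proof. by move/iter_findex; move: (findex _ _ _) => k <-; rewrite dep_iter leq_subr. Qed.

Lemma anc_inj a y z : anc a y -> anc a z -> dep y = dep z -> y = z.
Proof. by move=> /anc_iter {2}-> /anc_iter {2}-> ->. Qed.

Lemma anc_anti a y : anc a y -> dep a <= dep y -> y = a.
Proof. by move=> ay; have := ay => /anc_dep le1 le2; apply: anc_inj ay (anc_refl a) _; lia. Qed.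

Lemma anc_root a : anc a r.
Proof.
have <- : iter (dep a) par a = r by apply: dep_eq0; rewrite dep_iter subnn.
exact: fconnect_iter.
Qed.

Lemma anc_rootE y : anc r y = (r == y).
Proof.
apply/idP/eqP => [/anc_dep|<-]; last exact: anc_refl.
by case: (tr) => _ -> _; rewrite leqn0 => /eqP /dep_eq0.
Qed.

Lemma anc_par a : anc a (par a). Proof. exact: fconnect1. Qed.

Lemma ancE a y : anc a y = (a == y) || anc (par a) y.
Proof.
apply/idP/orP => [ay|[/eqP->|]]; [|exact: anc_refl|exact/anc_trans/anc_par].
have := iter_findex ay; case: (findex _ _ _) => [|k] /=; first by left; apply/eqP.
by rewrite -iterS iterSr => <-; right; apply: fconnect_iter.
Qed.

Lemma anc_chain a y z : anc a y -> anc a z -> dep y <= dep z -> anc z y.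
Proof.
move=> ay az le_yz; have le_za := anc_dep az.
rewrite (anc_iter ay) (anc_iter az); have -> : dep a - dep y = (dep z - dep y) + (dep a - dep z).
  by lia.
by rewrite iterD; apply: fconnect_iter.
Qed.

Lemma anc_par_neq a y : anc a y -> a != y -> anc (par a) y.
Proof. by rewrite ancE => /predU1P [->|//]; rewrite eqxx. Qed.

(** The ancestors of one vertex are determined by their depths. *)
Lemma anc_chain_card a lo hi (Q : {set T}) :
  (forall y, y \in Q -> anc a y /\ lo <= dep y < hi) -> #|Q| <= hi - lo.
Proof.
move=> Q_anc; rewrite cardE -(size_map dep) -(size_iota lo (hi - lo)).
apply: uniq_leq_size => [|d /mapP [y]].
  rewrite map_inj_in_uniq ?enum_uniq // => y z; rewrite !mem_enum => yQ zQ.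
  by apply: anc_inj; [apply: (Q_anc y yQ).1|apply: (Q_anc z zQ).1].
by rewrite mem_enum mem_iota => /Q_anc [_ ?] ->; lia.
Qed.

Lemma anc_seg_card a x : anc a x ->
  #|[set y | anc a y && anc y x]| = (dep a - dep x).+1.
Proof.
move=> ax; have le_xa := anc_dep ax; apply/eqP; rewrite eqn_leq; apply/andP; split.
  have -> : (dep a - dep x).+1 = (dep a).+1 - dep x by lia.
  apply: (@anc_chain_card a) => y; rewrite inE => /andP [ay yx].
  by rewrite ay; split=> //; rewrite (anc_dep yx) ltnS anc_dep.
have it_inj : injective (fun i : 'I_(dep a - dep x).+1 => iter i par a).
  move=> i j /(congr1 dep); rewrite !dep_iter => eq_ij; apply: val_inj => /=.
  by move: (ltn_ord i) (ltn_ord j); lia.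
rewrite -[X in X <= _]card_ord -(card_codom it_inj) subset_leq_card //.
apply/subsetP => _ /codomP [i ->]; rewrite inE; apply/andP; split; first exact: fconnect_iter.
by apply: (@anc_chain a) ax _ _; rewrite /anc ?fconnect_iter // dep_iter; move: (ltn_ord i); lia.
Qed.

Lemma dep_lt a : dep a < #|T|.
Proof.
by have := anc_seg_card (anc_root a); case: tr => _ -> _; rewrite subn0 => <-; apply: max_card.
Qed.

Lemma tree_ball (e' : rel T) a x :
  (forall y, anc y x -> y != x -> e' (par y) y) ->
  anc a x -> a \in ball e' x (dep a - dep x).
Proof.
move=> e'_tree; move Dd : (dep a - dep x) => d; elim: d a Dd => [|d IH] a Dd ax.
  by rewrite ball0 (anc_anti ax) //; move: (anc_dep ax); lia.
have a_x : a != x by apply/eqP => a_x; rewrite a_x subnn in Dd.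
apply: (@ball_step _ _ _ _ (par a)); last exact: e'_tree.
by apply: IH; [rewrite dep_par; lia|exact: anc_par_neq].
Qed.

(* Telescoping along the path from a to the root. *)
Lemma anc_telescope a z :
  \big[addb/false]_(y | y != r) (anc a y && ((y == z) (+) (par y == z)))
  = (a == z) (+) (r == z).
Proof.
move Dd : (dep a) => d; elim: d a Dd => [|d IH] a Dd.
  rewrite (dep_eq0 Dd) addbb big1 // => y; rewrite anc_rootE eq_sym.
  by move=> /negPf ->.
have a_r : a != r by apply: contra_eqN Dd => /eqP->; case: tr => _ -> _.
rewrite (bigD1 a) //= anc_refl /=.
have -> : \big[addb/false]_(y | (y != r) && (y != a)) (anc a y && ((y == z) (+) (par y == z)))
   = \big[addb/false]_(y | y != r) (anc (par a) y && ((y == z) (+) (par y == z))).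
  rewrite [RHS](bigD1 a) //=; have -> : anc (par a) a = false.
    by apply/negP => /anc_dep; rewrite dep_par Dd ltnn.
  by apply: eq_bigr => y /andP [_ y_a]; rewrite ancE eq_sym (negPf y_a).
rewrite IH ?dep_par ?Dd //.
by case: (a == z) (par a == z) (r == z) => [] [] [].
Qed.

End Ancestors.

Lemma bfs_tree : (forall z, connect e r z) -> exists par dep, rtree par dep.
Proof.
move=> conn; pose ex z := connect_ball (conn z).
pose dep z := ex_minn (ex z).
have dep_in z : z \in ball e r (dep z) by rewrite /dep; case: ex_minnP.
have dep_min z i : z \in ball e r i -> dep z <= i.
  by rewrite /dep; case: ex_minnP => m _; apply.
have has_par y : y != r -> exists u, e y u && (dep y == (dep u).+1).
  move=> y_r; have := dep_in y; case Dd : (dep y) => [|d].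
    by rewrite ball0 (negPf y_r).
  case/ballSP=> [/dep_min|[u ud uy]]; first by rewrite Dd ltnn.
  exists u; rewrite e_sym uy eqSS eqn_leq (dep_min _ _ ud) andbT -ltnS -Dd.
  by apply: dep_min; apply: ball_step uy.
pose par y := if y == r then r else odflt r [pick u | e y u && (dep y == (dep u).+1)].
exists par, dep; split; first by rewrite /par eqxx.
  by apply/eqP; rewrite -leqn0 dep_min // ball0.
move=> y y_r; rewrite /par (negPf y_r); case: pickP => [u /andP [yu /eqP]|none] //.
by have [u] := has_par y y_r; rewrite none.
Qed.

Definition dfs_like par := forall a b, e a b -> anc par a b \/ anc par b a.

(* A spanning tree of maximal total depth is normal: otherwise an edge a b between
   incomparable vertices with dep b <= dep a allows to rehang the subtree of b below a. *)
Lemma normal_tree : (forall z, connect e r z) ->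
  exists par dep, rtree par dep /\ dfs_like par.
Proof.
move=> /bfs_tree [par [dep tr]].
(* Depths stay below [#|T|], so the total depth is bounded by the square and the gap can serve as
   the induction measure. *)
have [m] := ubnP (#|T| * #|T| - \sum_y dep y).
elim: m par dep tr => // m IH par dep tr lt_m.
case: (boolP [forall a, forall b, e a b ==> anc par a b || anc par b a]) => [|].
  move=> /forallP norm; exists par, dep; split=> // a b ab; apply/orP.
  by move: (norm a) => /forallP /(_ b) /implyP; apply.
move=> /forallPn [a /forallPn [b]]; rewrite negb_imply => /andP [ab incomp].
wlog le_ba : a b ab incomp / dep b <= dep a.
  move=> hw; case: (leqP (dep b) (dep a)) => [|/ltnW] le; first exact: hw ab incomp le.
  by apply: hw le; rewrite 1?e_sym // orbC.
move: incomp; rewrite negb_or => /andP [nab nba].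
have b_r : b != r by apply: contraNneq nab => ->; apply: anc_root tr a.
pose par' y := if y == b then a else par y.
(* The subtree of [b] sinks by a positive amount because [dep b <= dep a]; no other vertex moves. *)
pose dep' y := if anc par y b then dep y + ((dep a).+1 - dep b) else dep y.
have [par_r dep_r tr_y] := tr.
have tr' : rtree par' dep'.
  split; rewrite /par' /dep'.
  - by rewrite eq_sym (negPf b_r).
  - by rewrite (anc_rootE tr) eq_sym (negPf b_r).
  move=> y y_r; case: eqVneq => [->|y_b].
    by rewrite anc_refl (negPf nab) e_sym; split=> //; move: le_ba; lia.
  have [ey dy] := tr_y y y_r; split=> //.
  by rewrite ancE (negPf y_b) /= dy; case: ifP.
apply: (IH par' dep' tr').
have bound : \sum_y dep' y <= #|T| * #|T|.
  rewrite -sum_nat_const; apply: leq_sum => y _; apply: ltnW; exact: (dep_lt tr').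
suff : \sum_y dep y < \sum_y dep' y by move: lt_m bound; lia.
rewrite (bigD1 b) //= [X in _ < X](bigD1 b) //= -addSn leq_add //.
  by rewrite /dep' anc_refl; move: le_ba; lia.
by apply: leq_sum => y _; rewrite /dep'; case: ifP; rewrite ?leq_addr.
Qed.

End RootedTree.

(** * Tours from a spanning tree and a family of extra pairs *)

Section TreeTour.
Variables (n : nat) (w : dist n) (r : 'I_n).
Hypotheses (w0 : forall u, w u u = 0) (wS : forall u v, w u v = w v u).
Hypothesis wT : forall u v x, w u v <= w u x + w x v.
Let e : rel 'I_n := fun u v => w u v == 1.
Variables (par : 'I_n -> 'I_n) (dep : 'I_n -> nat).
Hypothesis tr : rtree e r par dep.
Variables fa fb : 'I_n -> 'I_n.

(** The tree path from [fa x] to [fb x] uses the edge above [y] exactly when one of its ends lies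
    below [y] and the other does not. *)
Definition covers x y := anc par (fa x) y (+) anc par (fb x) y.
Definition oddcov (F : {set 'I_n}) y := \big[addb/false]_(x in F) covers x y.

(* The tree edge above y is taken once if the pairs of F cover it an odd number of
   times, twice otherwise: with the pairs of F this is a connected even multigraph. *)
Lemma TSP_oddcov F :
  TSP w + #|[set y | (y != r) && oddcov F y]|
  <= n.-1.*2 + \sum_(x in F) w (fa x) (fb x).
Proof.
pose es1 := flatten [seq nseq (if oddcov F y then 1 else 2) (y, par y) | y <- enum (predC1 r)].
pose es2 := [seq (fa x, fb x) | x <- enum F].
have epar_cat s1 s2 z : epar (s1 ++ s2) z = epar s1 z (+) epar s2 z.
  by rewrite /epar count_cat oddD.
have epar1 z : epar es1 z =
    \big[addb/false]_(y | y != r) (oddcov F y && ((y == z) (+) (par y == z))).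
  transitivity (\big[addb/false]_(y <- enum (predC1 r))
      (oddcov F y && ((y == z) (+) (par y == z)))); last by rewrite big_enum.
  rewrite /es1; elim: (enum _) => [|y s IH]; rewrite ?big_nil //= epar_cat IH big_cons; congr (_ (+) _).
  rewrite /epar; case: oddcov => /=; rewrite ?addn0 ?oddb //; first by case: (y == z) (par y == z) => [] [].
  by rewrite oddD addbb.
have epar2 z : epar es2 z = \big[addb/false]_(x in F) ((fa x == z) (+) (fb x == z)).
  transitivity (\big[addb/false]_(x <- enum F) ((fa x == z) (+) (fb x == z)));
    last by rewrite big_enum.
  rewrite /es2; elim: (enum _) => [|x s IH]; rewrite ?big_nil //=.
  by rewrite epar_cons /= IH big_cons.
have even z : epar (es1 ++ es2) z = false.
  rewrite epar_cat epar1 epar2.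
  have -> : \big[addb/false]_(y | y != r) (oddcov F y && ((y == z) (+) (par y == z)))
     = \big[addb/false]_(x in F) ((fa x == z) (+) (fb x == z)); last by rewrite addbb.
  under eq_bigr => y _ do rewrite /oddcov big_distrl /=.
  rewrite exchange_big /=; apply: eq_bigr => x _.
  under eq_bigr => y _ do rewrite /covers andb_addl.
  rewrite big_split /= !(anc_telescope tr).
  by case: (_ == z) (_ == z) (r == z) => [] [] [].
have mem1 y : y != r -> (y, par y) \in es1 ++ es2.
  move=> y_r; rewrite mem_cat; apply/orP; left; apply/flattenP.
  exists (nseq (if oddcov F y then 1 else 2) (y, par y)); last by case: ifP; rewrite !inE eqxx.
  by apply/mapP; exists y; rewrite ?mem_enum.
have conn z : connect (fun u v => ((u, v) \in es1 ++ es2) || ((v, u) \in es1 ++ es2)) r z.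
  move Dd : (dep z) => d; elim: d z Dd => [|d IH] z Dd.
    by rewrite (dep_eq0 tr Dd).
  have z_r : z != r by apply: contra_eqN Dd => /eqP->; case: tr => _ -> _.
  apply: connect_trans (IH (par z) _) _; first by rewrite (dep_par tr) Dd.
  by apply: connect1; rewrite mem1 ?orbT.
have [c c_all c_cost] := euler_tour w0 wS even conn.
have := leq_trans (TSP_le_ccost wT c_all) c_cost.
rewrite /ecost big_cat /=; have -> : \sum_(f <- es2) w f.1 f.2 = \sum_(x in F) w (fa x) (fb x).
  by rewrite big_map /= big_enum.
have -> : \sum_(f <- es1) w f.1 f.2 = \sum_(y | y != r) (if oddcov F y then 1 else 2).
  rewrite big_flatten big_map /= big_enum /=; apply: eq_bigr => y y_r.
  rewrite big_nseq_cond /=; have [/eqP -> _] := let: And3 _ _ f := tr in f y y_r.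
  by case: ifP.
have : \sum_(y | y != r) (if oddcov F y then 1 else 2) + #|[set y | (y != r) && oddcov F y]| = n.-1.*2.
  rewrite -sum1_card big_set /= big_mkcondr /= -big_split /=.
  rewrite (eq_bigr (fun=> 2)) => [|y _]; last by case: ifP.
  rewrite sum_nat_const muln2 -[n in RHS]card_ord; congr _.*2.
  by have := cardC1 r.
by move=> <- le1; rewrite addnAC leq_add2r.
Qed.

Let toggle (x : 'I_n) (F : {set 'I_n}) := if x \in F then F :\ x else x |: F.

Lemma toggleK x : involutive (toggle x).
Proof.
move=> F; rewrite /toggle; case: (boolP (x \in F)) => xF.
  by rewrite !inE eqxx /= setD1K.
by rewrite setU11 setU1K.
Qed.

(** Toggling the membership of [x0] pairs the families on which [h] holds with those on which it
    fails. *)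
Lemma half_sum x0 (h : {set 'I_n} -> bool) :
  (forall F, h (toggle x0 F) = ~~ h F) ->
  (\sum_F h F).*2 = #|{set 'I_n}|.
Proof.
move=> h_tog; rewrite -addnn {2}(reindex_inj (inv_inj (toggleK x0))) /=.
rewrite -big_split /= -sum1_card; apply: eq_bigr => F _.
by rewrite h_tog; case: (h F).
Qed.

(* Average of TSP_oddcov over all subfamilies. *)
Lemma TSP_cover (S : {set 'I_n}) :
  (TSP w).*2 + #|[set y | (y != r) && [exists x in S, covers x y]]|
  <= n.-1.*2.*2 + \sum_(x in S) w (fa x) (fb x).
Proof.
pose M := #|{set 'I_n}|.
have M_gt0 : 0 < M by apply/card_gt0P; exists set0.
rewrite -(leq_pmul2l M_gt0) !mulnDr.
have : \sum_(F : {set 'I_n}) (TSP w + #|[set y | (y != r) && oddcov (F :&: S) y]|) <=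
    \sum_(F : {set 'I_n}) (n.-1.*2 + \sum_(x in F :&: S) w (fa x) (fb x)).
  by apply: leq_sum => F _; apply: TSP_oddcov.
rewrite !big_split /= !sum_nat_const -/M.
have sum_odd : M * #|[set y | (y != r) && [exists x in S, covers x y]]| <=
    (\sum_(F : {set 'I_n}) #|[set y | (y != r) && oddcov (F :&: S) y]|).*2.
  under eq_bigr => F _ do rewrite -sum1_card big_set /= big_mkcondr /=.
  rewrite exchange_big /= -sum1_card big_set /= big_mkcondr /= big_distrr /=.
  rewrite -muln2 big_distrl /=; apply: leq_sum => y y_r.
  case: ifP => [/existsP [x /andP [xS xy]]|_]; last by rewrite muln0.
  rewrite muln1 muln2 eq_leq //; symmetry.
  rewrite /M -(@half_sum x (fun F => oddcov (F :&: S) y)).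
    by congr _.*2; apply: eq_bigr => F _; case: ifP.
  move=> F; rewrite /toggle /oddcov; case: ifP => xF.
    rewrite [in RHS](bigD1 x) /= ?inE ?xF // xy /= negbK; apply: eq_bigl => z.
    by rewrite !inE; case: (z == x); rewrite ?andbF ?andbT.
  rewrite (bigD1 x) /= ?inE ?eqxx //= xy /=; congr (~~ _); apply: eq_bigl => z.
  by rewrite !inE; case: eqVneq => [->|]; rewrite ?xF ?andbF ?andbT.
have sum_w : (\sum_(F : {set 'I_n}) \sum_(x in F :&: S) w (fa x) (fb x)).*2 =
    M * \sum_(x in S) w (fa x) (fb x).
  rewrite (eq_bigr (fun F : {set 'I_n} => \sum_(x in S | x \in F) w (fa x) (fb x))) => [|F _];
    last by apply: eq_bigl => x; rewrite inE andbC.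
  rewrite -muln2.
  under eq_bigr => F _ do rewrite big_mkcondr /=.
  rewrite exchange_big /= big_distrl big_distrr /=; apply: eq_bigr => x _.
  rewrite -big_mkcond /= sum_nat_const mulnAC muln2; congr (_ * _).
  rewrite /M -(@half_sum x (fun F => x \in F)); first by rewrite -sum1_card big_mkcond.
  by move=> F; rewrite /toggle; case: ifP => xF; rewrite !inE eqxx //= xF.
move=> le1; rewrite -sum_w -2!doubleMr; apply: leq_trans (leq_add (leqnn _) sum_odd) _.
by rewrite -!doubleD leq_double.
Qed.

End TreeTour.

(** * Many bypassed edges force a cheap tour *)

Section CheapBypass.
Variables (n : nat) (w : dist n) (r : 'I_n).
Hypothesis wM : pos_int_metric w.
Let e : rel 'I_n := fun u v => w u v == 1.
Variables (par : 'I_n -> 'I_n) (dep : 'I_n -> nat).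
Hypothesis tr : rtree e r par dep.
Local Notation anc := (anc par).

Definition bypass x a b :=
  [&& anc a x, ~~ anc b x & (w a b).*2 <= (dep a - dep x).+1].
Definition bypassed := [set x | (x != r) && [exists a, exists b, bypass x a b]].

Lemma bypassedP x :
  reflect (x != r /\ exists a b, bypass x a b) (x \in bypassed).
Proof.
rewrite inE; apply: (iffP andP) => [[xr /existsP [a /existsP [b ?]]]|[xr [a [b ab]]]].
  by split=> //; exists a, b.
by split=> //; apply/existsP; exists a; apply/existsP; exists b.
Qed.

Let fab x := odflt (x, x) [pick p : 'I_n * 'I_n | bypass x p.1 p.2].
Let fa x := (fab x).1.
Let fb x := (fab x).2.
Let len x := (dep (fa x) - dep x).+1.
Let seg x := [set y | anc (fa x) y && anc y x].

Let fabP x : x \in bypassed -> bypass x (fa x) (fb x).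
Proof.
case/bypassedP => _ [a [b ab]]; rewrite /fa /fb /fab; case: pickP => [p //|].
by move=> /(_ (a, b)); rewrite ab.
Qed.

(* Vitali covering with vertical segments, longest first: a segment that meets a
   longer one has its top within twice the length of the latter. *)
Let vitali (Q : {set 'I_n}) : Q \subset bypassed ->
  exists S : {set 'I_n}, [/\ S \subset Q,
    (forall x y, x \in S -> y \in S -> x != y -> [disjoint seg x & seg y]) &
    #|Q| <= \sum_(x in S) (len x).*2].
Proof.
have [m] := ubnP #|Q|; elim: m Q => // m IH Q lt_m Q_sub.
case: (set_0Vmem Q) => [->|[x0 x0Q]].
  by exists set0; split; rewrite ?sub0set // ?cards0 // => x y; rewrite inE.
case: (arg_maxnP len x0Q) => x xQ0 x_max; have xQ : x \in Q by [].
have /fabP /and3P [fax _ _] := subsetP Q_sub x xQ.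
pose Q' := [set y in Q | [disjoint seg y & seg x]].
have xQ' : x \notin Q'.
  rewrite !inE; apply/negP => /andP [_ /pred0P /(_ x)] /=.
  by rewrite !inE fax anc_refl.
have Q'Q : Q' \subset Q by apply/subsetP => y; rewrite inE => /andP [].
have [||S [SQ' S_disj S_card]] := IH Q'.
- apply: leq_trans (_ : #|Q'| < #|Q|) _; last by rewrite -ltnS.
  apply: proper_card; apply/properP.
  by split=> //; exists x.
- exact: subset_trans Q_sub.
have xS : x \notin S by apply: contra xQ'; apply: (subsetP SQ').
exists (x |: S); split.
- by rewrite subUset sub1set xQ (subset_trans SQ').
- have S_x y : y \in S -> [disjoint seg y & seg x].
    by move=> /(subsetP SQ'); rewrite inE => /andP [].
  move=> y z; rewrite !inE => /predU1P [->|yS] /predU1P [->|zS] yz.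
  + by rewrite eqxx in yz.
  + by rewrite disjoint_sym S_x.
  + exact: S_x.
  + exact: S_disj.
rewrite big_setU1 //= -(cardsID Q' Q) (setIidPr Q'Q) addnC leq_add //.
(* The discarded tops are ancestors of [fa x] at depths from [dep x - len x] to [dep (fa x)]: at
   most [(len x).*2] levels, and the second summand below counts the levels lost when the
   subtraction truncates at the root. *)
have -> : (len x).*2 = (dep (fa x)).+1 + len x - dep x.
  by move: (anc_dep tr fax); rewrite /len; clear; lia.
have -> : (dep (fa x)).+1 + len x - dep x = (dep (fa x)).+1 - (dep x - len x) + (len x - dep x).
  by move: (anc_dep tr fax); rewrite /len; clear; lia.
apply: leq_trans (leq_addr _ _); apply: (anc_chain_card tr (a := fa x)) => y.
rewrite !inE => /andP [+ yQ]; rewrite yQ /= => /pred0Pn [z] /=; rewrite !inE.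
case/andP=> /andP [fay zy] /andP [faz zx].
have ay := anc_trans faz zy; split=> //; rewrite ltnS (anc_dep tr ay) andbT.
have := x_max y yQ; rewrite /len; move: (anc_dep tr fay) (anc_dep tr zx) (anc_dep tr zy).
by rewrite /geq /=; clear; lia.
Qed.

(** Let L be the total length of the disjoint segments. All their edges are covered and their pairs
    weigh at most L/2, so [TSP_cover] gives 2 TSP + L/2 <= 4(n-1); the Vitali bound gives
    [#|bypassed|] <= 2L. In particular TSP <= 2(n-1). *)
Lemma bypassed_card : #|bypassed| + (TSP w) * 8 <= n.-1 * 16.
Proof.
have [w0 _ wS wT] := wM.
have [S [S_sub S_disj S_card]] := vitali (subxx bypassed).
have S_fab x : x \in S -> bypass x (fa x) (fb x) by move=> /(subsetP S_sub) /fabP.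
have := TSP_cover w0 wS wT tr fa fb S.
have cov_S : \sum_(x in S) len x <= #|[set y | (y != r) && [exists x in S, covers par fa fb x y]]|.
  rewrite (eq_bigr (fun x => \sum_y (y \in seg x : nat))) => [|x /S_fab /and3P [ax _ _]]; last first.
    by rewrite -big_mkcond sum1_card (anc_seg_card tr ax).
  rewrite exchange_big -sum1_card [X in _ <= X]big_mkcond; apply: leq_sum => y _.
  case: (pickP (fun x => (x \in S) && (y \in seg x))) => [x /andP [xS yx]|none]; last first.
    by rewrite big1 // => x xS; have := none x; rewrite xS /= => ->.
  have /and3P [ax bx _] := S_fab x xS; have [x_r _] := bypassedP _ (subsetP S_sub x xS).
  rewrite (bigD1 x) //= yx big1 ?addn0 => [|z /andP [zS z_x]]; last first.
    apply/eqP; rewrite eqb0; apply/negP => yz.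
    by have /pred0P /(_ y) /= := S_disj z x zS xS z_x; rewrite yx yz.
  move: yx; rewrite !inE => /andP [ay yx].
  have -> : y != r by apply: contraNneq x_r => y_r; move: yx; rewrite y_r (anc_rootE tr) eq_sym.
  have -> //= : [exists x in S, covers par fa fb x y].
  apply/existsP; exists x; rewrite xS /covers ay /=; apply: contra bx => by_.
  exact: anc_trans yx.
have w_S : (\sum_(x in S) w (fa x) (fb x)).*2 <= \sum_(x in S) len x.
  rewrite -muln2 big_distrl /=; apply: leq_sum => x /S_fab /and3P [_ _].
  by rewrite muln2.
move: S_card; rewrite (eq_bigr (fun x => 2 * len x)) => [|x _]; last by rewrite mul2n.
rewrite -big_distrr /=; move: cov_S w_S.
set L := \sum_(x in S) len x; set W := \sum_(x in S) w _ _; set Cv := #|[set y | _]|.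
by set B := #|bypassed|; move: L W Cv B (TSP w); clear; lia.
Qed.
End CheapBypass.

Lemma card_has (T : finType) (U : eqType) (F : {set T}) (P : T -> U -> bool) q m :
  (forall t, t \in q -> #|[set x in F | P x t]| <= m) ->
  #|[set x in F | has (P x) q]| <= size q * m.
Proof.
elim: q => [|t q IH] q_le /=; first by rewrite (eq_card0 (A := _)) // => x; rewrite !inE andbF.
have -> : [set x in F | P x t || has (P x) q] =
    [set x in F | P x t] :|: [set x in F | has (P x) q].
  by apply/setP => x; rewrite !inE andb_orr.
apply: leq_trans (leq_card_setU _ _) _; rewrite mulSn leq_add //.
  by rewrite q_le // inE eqxx.
by apply: IH => u uq; rewrite q_le // inE uq orbT.
Qed.

(** * Bridge tests *)

Section CutEdge.
Variable n : nat.

Definition cut (m : dist n) x v : rel 'I_n :=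
  fun u z => [&& m u z == 1, (u, z) != (x, v) & (u, z) != (v, x)].

Definition cball (m : dist n) x v i := ball (cut m x v) x i.

(** Coarse distance from [x] visible in the rows of [R] alone. Two points at distance [s] have
    representatives in [R], each off by at most [s], that are at most [3 * s] apart. *)
Definition hop (m : dist n) (R : {set 'I_n}) s x j :=
  iter j (fun S : {set 'I_n} => S :|: [set r in R | [exists t in S, m t r <= 3 * s]])
       [set r in R | m x r <= s].

(* Moves that are sound evidence, from the rows of K only: if the edge x v is a bridge
   and a is on the side of x, then a move from a that leaves this side by a pair of
   weight k > 1 starts at distance at least 2k from x. *)
Definition allowed (m : dist n) (K R : {set 'I_n}) s x v : rel 'I_n := fun a b =>
  ((a \in K) || (b \in K)) &&
  [|| cut m x v a b,
      ((m a b).*2 <= 10 * s) && (a \notin cball m x v (m a b).*2)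
    | (a \in R) && (a \notin hop m R s x ((m a b).*2 %/ s).+1)].

Lemma hopS m R s x j : hop m R s x j \subset hop m R s x j.+1.
Proof. by rewrite /hop iterS subsetUl. Qed.

Lemma hop_sub m R s x i j : i <= j -> hop m R s x i \subset hop m R s x j.
Proof.
move=> /subnKC <-; elim: (j - i) => [|k IH]; first by rewrite addn0.
by rewrite addnS (subset_trans IH) ?hopS.
Qed.

Lemma hopP m R s x j r : r \in hop m R s x j ->
  exists p, [/\ path (fun t t' => m t t' <= 3 * s) x p, last x p = r & size p <= j.+1].
Proof.
elim: j r => [|j IH] r.
  rewrite /hop /= inE => /andP [rR xr]; exists [:: r]; split=> //=.
  by rewrite andbT (leq_trans xr) // leq_pmull.
rewrite /hop iterS -/(hop m R s x j) !inE => /orP [/IH [p [? ? ?]]|].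
  by exists p; split=> //; apply: leqW.
case/andP=> _ /existsP [t /andP [/IH [p [pp lp sp]] tr]].
by exists (rcons p r); rewrite rcons_path last_rcons size_rcons pp lp tr.
Qed.

Section Metric.
Variables (w : dist n) (r0 : 'I_n).
Hypothesis wM : pos_int_metric w.
Let adj : rel 'I_n := fun u v => w u v == 1.
Hypothesis adj_conn : forall u v, connect adj u v.

Let w0 u : w u u = 0. Proof. by case: wM. Qed.
Let wS u v : w u v = w v u. Proof. by case: wM. Qed.
Let wT u v x : w u v <= w u x + w x v. Proof. by case: wM. Qed.

Lemma cut_sym x v : symmetric (cut w x v).
Proof.
move=> u z; rewrite /cut wS !xpair_eqE; congr (_ && _).
by rewrite andbC ![(z == _) && _]andbC.
Qed.

Lemma cball_w x v y i z : z \in ball (cut w x v) y i -> w y z <= i.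
Proof.
elim: i z => [|i IH] z; first by rewrite ball0 => /eqP->; rewrite w0.
case/ballSP=> [/IH /leqW//|[u /IH le_u /and3P [/eqP uz _ _]]].
by apply: leq_trans (wT _ _ u) _; rewrite uz addn1.
Qed.

(** The pair [x v] is a bridge of the unit graph and [A] is its side away from the root. *)
Definition bridge_head (A : {set 'I_n}) x v :=
  [/\ x \in A, v \notin A, r0 \notin A &
      forall u z, u \in A -> z \notin A -> adj u z -> u = x /\ z = v].

Lemma head_cut A x v u z : bridge_head A x v -> u \in A -> z \in A -> adj u z -> cut w x v u z.
Proof.
case=> xA vA _ _ uA zA uz; rewrite /cut -/(adj u z) uz !xpair_eqE /=.
have -> : (z == v) = false by apply: contraNF vA => /eqP<-.
by have -> : (u == v) = false by [apply: contraNF vA => /eqP<-]; rewrite andbF.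
Qed.

Lemma head_cball A x v i : bridge_head A x v -> cball w x v i \subset A.
Proof.
case=> xA vA _ hA; elim: i => [|i IH]; first by rewrite sub1set.
apply/subsetP => z /ballSP [/(subsetP IH)//|[u /(subsetP IH) uA]].
case/and3P=> uz uz_xv _; apply: contraNT uz_xv => zA.
by have [-> ->] := hA u z uA zA uz.
Qed.

(** A walk from the root first enters the union of the two sides at one of the heads. That head lies
    in the other side as well, so the same step enters both sides and the heads coincide. *)
Lemma head_excl A x v A' x' v' :
  bridge_head A x v -> bridge_head A' x' v' -> x \in A' -> x' \in A -> x = x'.
Proof.
move=> [xA vA rA hA] [xA' vA' rA' hA'] x_A' x'_A.
have /connectP [p] := adj_conn r0 x.
have: r0 \notin A :|: A' by rewrite inE negb_or rA rA'.
elim: p r0 {rA rA'} => [|z p IH] u /=.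
  by move=> + _ eq_x; rewrite -eq_x inE xA.
move=> uAA' /andP [uz pp] lp.
case: (boolP (z \in A :|: A')) => [|zAA']; last exact: IH zAA' pp lp.
move: uAA'; rewrite !inE negb_or => /andP [uA uA'].
have zu : adj z u by rewrite /adj wS.
case/orP=> zA.
  have [zx _] := hA z u zA uA zu; rewrite zx in zu.
  by have [] := hA' x u x_A' uA' zu.
have [zx _] := hA' z u zA uA' zu; rewrite zx in zu.
by have [<-] := hA x' u x'_A uA zu.
Qed.

(** A path from outside [A] can only enter through the bridge into [x], so at least one step is
    spent before reaching [x]. *)
Lemma head_ball_lt A x v x' v' j z : bridge_head A x v -> x' \notin A -> z \in A ->
  z \in cball w x' v' j -> 0 < j /\ z \in cball w x v j.-1.
Proof.
move=> hd x'A; have [xA vA rA hA] := hd; elim: j z => [|j IH] z zA.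
  by rewrite ball0 => /eqP zx; rewrite -zx zA in x'A.
move=> /ballSP H; split=> //=; case: H => [/(IH _ zA) [j0 zj]|[u uj /and3P [uz _ _]]].
  exact: (subsetP (ball_sub _ _ (leq_pred j))) zj.
case: (boolP (u \in A)) => uA; last first.
  have [|-> _] := hA z u zA uA; first by rewrite /adj wS.
  exact: ball_center.
have [j0 uj'] := IH u uA uj; rewrite -(prednK j0).
by apply: ball_step uj' _; apply: head_cut hd uA zA uz.
Qed.

Section Family.
Variables (A : 'I_n -> {set 'I_n}) (v : 'I_n -> 'I_n).

(** The distances from the heads to [a] are pairwise distinct: by [head_excl] one of two heads lies
    outside the side of the other, and by [head_ball_lt] it is strictly farther from [a]. *)
Lemma head_count (Q : {set 'I_n}) a m :
  (forall x, x \in Q -> bridge_head (A x) x (v x) /\ a \in cball w x (v x) m) -> #|Q| <= m.+1.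
Proof.
move=> QP; pose d x := find (fun j => a \in cball w x (v x) j) (iota 0 m.+1).
have dP x : x \in Q -> d x < m.+1 /\ a \in cball w x (v x) (d x).
  case/QP=> _ am; have has_m : has (fun j => a \in cball w x (v x) j) (iota 0 m.+1).
    by apply/hasP; exists m => //; rewrite mem_iota add0n ltnS /=.
  split; first by rewrite -[X in _ < X](size_iota 0) -has_find.
  have := nth_find 0 has_m; rewrite nth_iota ?add0n //.
  by rewrite -[X in _ < X](size_iota 0) -has_find.
have d_min x j : a \in cball w x (v x) j -> j < m.+1 -> d x <= j.
  move=> aj lt_j; rewrite leqNgt; apply/negP => lt_jd.
  by have := before_find 0 lt_jd; rewrite nth_iota // add0n aj.
have d_lt x y : x \in Q -> y \in Q -> y \notin A x -> d x < d y.
  move=> xQ yQ yx; have [hd ax] := QP x xQ; have [lt_d ad] := dP y yQ.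
  have [d0 ad'] := head_ball_lt hd yx (subsetP (head_cball _ hd) _ ax) ad.
  by rewrite -(prednK d0) ltnS d_min // -ltnS (prednK d0) ltnW.
have d_inj : {in Q &, injective (fun x => inord (d x) : 'I_m.+1)}.
  move=> x y xQ yQ /(congr1 val) /=; rewrite !inordK ?(dP _ _).1 // => eq_d.
  have [[hx _] [hy _]] := (QP x xQ, QP y yQ).
  case: (boolP (y \in A x)) => [yx|/(d_lt x y xQ yQ)]; last by rewrite eq_d ltnn.
  case: (boolP (x \in A y)) => [xy|/(d_lt y x yQ xQ)]; last by rewrite eq_d ltnn.
  exact: head_excl hx hy xy yx.
by rewrite -(card_in_imset d_inj) -[X in _ <= X]card_ord max_card.
Qed.

End Family.

Variables (s : nat) (R : {set 'I_n}).
Hypotheses (s_gt0 : 0 < s) (r0R : r0 \in R).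

(** Smaller balls need not be hit: by [ball_small] they are whole components of the cut graph. All
    cuts are included because the tested edge is not known in advance. *)
Definition hits_balls := forall x v p, s < #|ball (cut w x v) p s| ->
  exists2 r, r \in R & r \in ball (cut w x v) p s.

Definition side x v := [set a | connect (cut w x v) x a].

(** * What a passed bridge test certifies *)

Section BadPair.
Variables (x v : 'I_n) (K : {set 'I_n}).
Hypothesis hitR : hits_balls.
Hypotheses (RK : R \subset K) (BK : cball w x v (10 * s) \subset K).
Let A := side x v.
Let ct := cut w x v.
Let al := allowed w K R s x v.
Hypothesis bad : ~~ connect al x r0.

Let ct_sym : symmetric ct. Proof. exact: cut_sym. Qed.

Let reach a := connect al x a.

Let reach_step a b : reach a -> al a b -> reach b.
Proof. by move=> xa ab; apply: connect_trans xa (connect1 ab). Qed.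

Let near_reach i a : i <= (10 * s).+1 -> a \in cball w x v i -> reach a.
Proof.
elim: i a => [|i IH] a le_i; first by rewrite ball0 => /eqP->; apply: connect0.
case/ballSP=> [/IH|[u ui ua]]; first by apply; apply: ltnW.
apply: reach_step (IH u (ltnW le_i) ui) _; rewrite /al /allowed ua /= andbT.
by rewrite (subsetP BK) // (subsetP (ball_sub _ _ (_ : i <= _)) _ ui).
Qed.

Let move_far a b : (a \in K) || (b \in K) -> reach a ->
  (w a b).*2 <= 10 * s -> a \notin cball w x v (w a b).*2 -> reach b.
Proof.
move=> abK xa le_ab far_a; apply: reach_step xa _.
by rewrite /al /allowed abK le_ab far_a /= orbT.
Qed.

Let A_ball a : a \in A -> exists i, a \in cball w x v i.
Proof. by rewrite inE => /connect_ball. Qed.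

Let ball_A i a : a \in cball w x v i -> a \in A.
Proof. by rewrite inE; apply: ball_connect. Qed.

Let ball_shift i j y z : z \in ball ct y i -> z \in cball w x v j -> y \in cball w x v (j + i).
Proof. by move=> zy zx; apply: ball_trans zx _; apply: ball_sym. Qed.

(** Induction along a path from [x]. Beyond radius [10 * s], consecutive proxies are at most
    [s.*2.+1] apart and more than [9 * s] away from [x], so the move between them is allowed; the
    first proxy is reached from the last near vertex. *)
Let proxy_A a : a \in A -> a \notin cball w x v (10 * s) ->
  exists r, [/\ r \in R, reach r & r \in ball ct a s].
Proof.
case/A_ball=> i; elim: i a => [|i IH] a ai far_a.
  by case/negP: far_a; move: ai; rewrite ball0 => /eqP ->; apply: ball_center.
case/ballSP: ai => [/IH|[u ui ua]]; first exact.
have [r rR ra] : exists2 r, r \in R & r \in ball ct a s.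
  apply: hitR; apply: (ball_card_gt (z := x)).
    by rewrite (sym_connect_sym ct_sym); apply: ball_connect (ball_step ui ua).
  apply: contra far_a => /(ball_sym ct_sym); apply: (subsetP (ball_sub _ _ _)).
  by rewrite leq_pmull.
exists r; split=> //; have rK := subsetP RK r rR.
have u_a1 : u \in ball ct a 1 by apply: (ball_step (ball_center _ _ 0)); rewrite ct_sym.
case: (boolP (u \in cball w x v (10 * s))) => [near_u|far_u].
  have w_ur : w u r <= s.+1.
    have := ball_trans (ball_sym ct_sym u_a1) ra; rewrite add1n; exact: cball_w.
  apply: (@move_far u); rewrite ?rK ?orbT //.
  - exact: near_reach near_u.
  - by move: w_ur s_gt0; clear; lia.
  apply: contra far_a => near_u'; have := ball_step near_u' ua.
  by apply: (subsetP (ball_sub _ _ _)); move: w_ur s_gt0; clear; lia.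
have [r' [r'R xr' r'u]] := IH u ui far_u.
have w_rr : w r' r <= s.*2.+1.
  have := ball_trans (ball_sym ct_sym r'u) (ball_trans (ball_sym ct_sym u_a1) ra).
  by rewrite add1n addnS addnn; apply: cball_w.
apply: (@move_far r'); rewrite ?rK ?orbT //; first by move: w_rr s_gt0; clear; lia.
apply: contra far_u => near_r'; have := ball_shift r'u near_r'.
by apply: (subsetP (ball_sub _ _ _)); move: w_rr s_gt0; clear; lia.
Qed.

Let r0A : r0 \notin A.
Proof.
apply/negP => r0A; case/negP: bad; rewrite -/(reach r0).
case: (boolP (r0 \in cball w x v (10 * s))) => [|far]; first exact: near_reach.
have [r [rR xr rr0]] := proxy_A r0A far.
have le_w : w r r0 <= s by apply: cball_w; apply: ball_sym rr0.
apply: (@move_far r); rewrite ?(subsetP RK) //; first by move: le_w s_gt0; clear; lia.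
apply: contra far => near_r; have := ball_shift rr0 near_r.
by apply: (subsetP (ball_sub _ _ _)); move: le_w s_gt0; clear; lia.
Qed.

Let notA_ct y z : y \notin A -> ct y z -> z \notin A.
Proof.
move=> yA yz; apply: contra yA; rewrite !inE => xz.
by apply: connect_trans xz (connect1 _); rewrite cut_sym.
Qed.

Let notA_v y : y \notin A -> connect ct y v.
Proof.
case/connectP: (adj_conn y v) => p; elim: p y => [|z p IH] y /=.
  by move=> _ -> _; apply: connect0.
case/andP=> yz pz lz yA; case: (boolP (ct y z)) => [ct_yz|].
  exact: connect_trans (connect1 ct_yz) (IH _ pz lz (notA_ct yA ct_yz)).
rewrite /ct /cut -/(adj y z) yz /= negb_and !negbK !xpair_eqE.
case/orP=> /andP [/eqP ey _]; last by rewrite ey connect0.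
by rewrite ey inE connect0 in yA.
Qed.

(** A small ball outside [A] is the whole component of [v], which contains [r0]; this is why the
    root is put into [R]. *)
Let proxy_notA y : y \notin A -> exists r, [/\ r \in R, r \notin A & r \in ball ct y s].
Proof.
move=> yA; have [r rR ry] : exists2 r, r \in R & r \in ball ct y s.
  case: (ltnP s #|ball ct y s|) => [/hitR//|small].
  exists r0 => //; apply: (ball_small small); apply: connect_trans (notA_v yA) _.
  by rewrite (sym_connect_sym ct_sym) notA_v.
exists r; split=> //; apply: contra yA; rewrite !inE => xr; apply: connect_trans xr _.
by rewrite (sym_connect_sym ct_sym); apply: ball_connect ry.
Qed.

(** Vertices outside [A] lie in no ball around [x], so once [A] is left every short move is allowed
    and the proxies lead on to [r0], against [bad]. *)
Let reach_A b : reach b -> b \in A.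
Proof.
move=> xb; apply: contraNT bad => bA; rewrite -/(reach r0).
have far_notA y i : y \notin A -> y \notin cball w x v i by apply: contra; apply: ball_A.
have [r1 [r1R r1A r1b]] := proxy_notA bA.
have xr1 : reach r1.
  have le_w := cball_w r1b; apply: (@move_far b); rewrite ?(subsetP RK _ r1R) ?orbT ?far_notA //.
  by move: le_w s_gt0; clear; lia.
have: connect ct b r0.
  by apply: connect_trans (notA_v bA) _; rewrite (sym_connect_sym ct_sym) notA_v.
case/connectP=> p; elim: p b bA {xb} r1 r1R r1A r1b xr1 => [|z p IH] b bA r1 r1R r1A r1b xr1 /=.
  move=> _ eq_r0; rewrite -eq_r0 in r1b.
  have le_w : w r1 r0 <= s by apply: cball_w; apply: ball_sym r1b.
  apply: (@move_far r1); rewrite ?(subsetP RK _ r1R) ?far_notA //.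
  by move: le_w s_gt0; clear; lia.
case/andP=> bz pz lz; have zA := notA_ct bA bz.
have [r2 [r2R r2A r2z]] := proxy_notA zA; apply: (IH z zA r2) => //.
have b_z1 : z \in ball ct b 1 by apply: (ball_step (ball_center _ _ 0)).
have w_rr : w r1 r2 <= s.*2.+1.
  have := ball_trans (ball_sym ct_sym r1b) (ball_trans b_z1 r2z).
  by rewrite add1n addnS addnn; apply: cball_w.
apply: (@move_far r1); rewrite ?(subsetP RK _ r1R) ?far_notA //.
by move: w_rr s_gt0; clear; lia.
Qed.

Lemma bad_head : bridge_head (side x v) x v.
Proof.
split=> //; first by rewrite inE connect0.
- apply: contra r0A => vA; rewrite inE; move: vA; rewrite inE => xv'.
  by apply: connect_trans xv' _; rewrite (sym_connect_sym ct_sym) notA_v.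
- move=> u z uA zA uz; have := uA; rewrite inE => xu.
  have : ~~ ct u z by apply: contra zA => uz'; rewrite inE; apply: connect_trans xu (connect1 uz').
  rewrite /ct /cut -/(adj u z) uz /= negb_and !negbK !xpair_eqE.
  case/orP=> /andP [/eqP eu /eqP ez] //.
  by rewrite ez inE connect0 in zA.
Qed.

(** Here the radius [10 * s] is used: a far [a] has a proxy [r] with [w r b <= 4 * s] if
    [w a b <= 3 * s], and [r] cannot lie within [8 * s] of [x], so the move from [r] to [b] would be
    allowed. *)
Lemma bad_crossing a b : a \in side x v -> b \notin side x v -> (a, b) != (x, v) ->
  a \in cball w x v (w a b).*2 \/ 3 * s < w a b.
Proof.
move=> aA bA ab; case: (boolP (a \in cball w x v (10 * s))) => [near_a|far_a].
  left; case: (leqP (w a b).*2 (10 * s)) => [le_w|/ltnW le_w].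
    apply: contraNT bA => far_a; apply: reach_A; apply: (@move_far a) => //.
      by rewrite (subsetP BK).
    exact: near_reach near_a.
  exact: (subsetP (ball_sub _ _ le_w)).
right; rewrite ltnNge; apply: contra bA => le_w; apply: reach_A.
have [r [rR xr ra]] := proxy_A aA far_a.
have w_ra : w r a <= s by apply: cball_w; apply: ball_sym ra.
have w_rb : w r b <= 4 * s by apply: leq_trans (wT r b a) _; move: w_ra le_w; clear; lia.
apply: (@move_far r); rewrite ?(subsetP RK _ rR) //; first by move: w_rb; clear; lia.
apply: contra far_a => near_r; have := ball_shift ra near_r.
by apply: (subsetP (ball_sub _ _ _)); move: w_rb; clear; lia.
Qed.

(** The move from a proxy of [a] to a proxy of [b] must be forbidden, and the failure of its [hop]
    clause is the conclusion. Both proxies cost at most [s], and [2 * (w a b + 2 * s) <= 4 * w a b]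
    since [w a b > 3 * s]. *)
Lemma bad_crossing_far a b : a \in side x v -> b \notin side x v ->
  3 * s < w a b -> a \notin cball w x v (w a b).*2 ->
  exists2 r, w r a <= s & r \in hop w R s x ((w a b * 4) %/ s).+1.
Proof.
move=> aA bA lt_w far_a.
have far_a' : a \notin cball w x v (10 * s).
  apply: contra far_a => near_a; case: (leqP (w a b).*2 (10 * s)) => [le_w|/ltnW le_w]; last first.
    exact: (subsetP (ball_sub _ _ le_w)).
  apply: contraNT bA => far_a; apply: reach_A; apply: (@move_far a) => //.
    by rewrite (subsetP BK).
  exact: near_reach near_a.
have [r [rR xr ra]] := proxy_A aA far_a'.
have [r' [r'R r'A r'b]] := proxy_notA bA.
have w_ra : w r a <= s by apply: cball_w; apply: ball_sym ra.
have w_br' : w b r' <= s by apply: cball_w r'b.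
have w_rr : (w r r').*2 <= w a b * 4.
  by have := wT r r' a; have := wT a r' b; move: w_ra w_br' lt_w; clear; lia.
exists r => //; apply: (subsetP (hop_sub w R s x (_ : ((w r r').*2 %/ s).+1 <= _))).
  by rewrite ltnS leq_div2r.
apply: contraNT r'A => not_hop; apply: reach_A; apply: reach_step xr _.
by rewrite /al /allowed (subsetP RK _ rR) rR not_hop /= !orbT.
Qed.

End BadPair.

(** * Charging certified bridges to the pairs of a tour *)

Section Charge.
Variables (Q : {set 'I_n}) (v : 'I_n -> 'I_n).
Let A x := side x (v x).
Hypothesis Q_head : forall x, x \in Q -> bridge_head (A x) x (v x).
Hypothesis Q_cross : forall x, x \in Q -> forall a b,
  a \in A x -> b \notin A x -> (a, b) != (x, v x) ->
  a \in cball w x (v x) (w a b).*2 \/ 3 * s < w a b.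
Hypothesis Q_far : forall x, x \in Q -> forall a b,
  a \in A x -> b \notin A x -> 3 * s < w a b -> a \notin cball w x (v x) (w a b).*2 ->
  exists2 r, w r a <= s & r \in hop w R s x ((w a b * 4) %/ s).+1.

Let nested x y : bridge_head (A x) x (v x) -> bridge_head (A y) y (v y) ->
  x \in A y -> y \notin A x -> A x \subset A y.
Proof.
move=> hx [yA vyA _ hA] xy yx; apply/subsetP => z; rewrite inE => /connect_ball [i].
elim: i z => [|i IH] z; first by rewrite ball0 => /eqP->.
case/ballSP=> [/IH//|[u ui uz]]; apply: contraNT yx => zA.
have /and3P [uz1 _ _] := uz.
have [<- _] := hA u z (IH u ui) zA uz1.
by apply: (subsetP (head_cball i hx)).
Qed.

Let outermost (F : {set 'I_n}) : F \subset Q -> F != set0 ->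
  exists2 y, y \in F & forall x, x \in F -> x != y -> y \notin A x.
Proof.
move=> FQ /set0Pn [x0 x0F]; case: (arg_maxnP (fun x => #|A x|) x0F) => y yF0 y_max.
have yF : y \in F by []; exists y => // x xF xy; apply/negP => yx.
have hx := Q_head (subsetP FQ x xF); have hy := Q_head (subsetP FQ y yF).
have nxy : x \notin A y by apply: contra_neqN xy => x_y; apply: head_excl hx hy x_y yx.
have sub := nested hy hx yx nxy.
have : #|A y| < #|A x|.
  by apply: proper_card; apply/properP; split=> //; exists x => //; case: hx.
by apply/negP; rewrite -leqNgt; apply: y_max.
Qed.

(** The step that enters the side is either the bridge or a crossing of weight at most [3 * s],
    which [Q_cross] forces to end close to [x]. *)
Let crossing_step x y p : x \in Q -> y \notin A x -> last y p \in A x ->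
  path (fun t t' => w t t' <= 3 * s) y p ->
  exists2 t, t \in p & t \in cball w x (v x) (6 * s).
Proof.
move=> xQ; elim: p y => [|z p IH] y yA /=; first by rewrite (negPf yA).
move=> lA /andP [w_yz pz]; case: (boolP (z \in A x)) => [zA|/IH]; last first.
  by case/(_ lA pz)=> t tp tb; exists t; rewrite // inE tp orbT.
exists z; first by rewrite inE eqxx.
case: (eqVneq (z, y) (x, v x)) => [[-> _]|zy]; first exact: ball_center.
rewrite wS in w_yz; case: (Q_cross xQ zA yA zy) => [|]; last by rewrite ltnNge w_yz.
by apply: (subsetP (ball_sub _ _ _)); move: w_yz; clear; lia.
Qed.

(** Put k = [w a b]. At most 2k + 1 heads are within 2k of [a]. For the others, one chain of hops
    from the outermost head [y] to [a] enters each of the other sides near its head; its at most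
    4k/s + 3 vertices are each near at most 6s + 1 heads, which makes 28k + 21s <= 35k because 3s <
    k. *)
Lemma charge (F : {set 'I_n}) a b : F \subset Q -> 1 < w a b ->
  (forall x, x \in F -> [/\ a \in A x, b \notin A x & (a, b) != (x, v x)]) ->
  #|F| <= 38 * w a b.
Proof.
move=> FQ w_gt1 F_ab; pose near := [set x in F | a \in cball w x (v x) (w a b).*2].
have near_card : #|near| <= (w a b).*2.+1.
  apply: (@head_count A v near a) => x; rewrite inE => /andP [xF ax].
  by split=> //; apply/Q_head/(subsetP FQ).
have near_F : near \subset F by apply/subsetP => x; rewrite inE => /andP [].
rewrite -(cardsID near F) (setIidPr near_F).
suff far_card : #|F :\: near| <= 1 + 35 * w a b.
  by move: far_card near_card w_gt1; clear; lia.
case: (eqVneq (F :\: near) set0) => [->|far_n0]; first by rewrite cards0.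
have far_sub : F :\: near \subset Q by apply: subset_trans FQ; apply: subsetDl.
have farP x : x \in F :\: near -> x \in F /\ a \notin cball w x (v x) (w a b).*2.
  by rewrite !inE => /andP [+ xF]; rewrite xF.
have [y yF y_top] := outermost far_sub far_n0.
have [yF' a_far] := farP y yF; have [aA bA ab] := F_ab y yF'.
have yQ := subsetP FQ y yF'.
have [/idPn//|w_gt] := Q_cross yQ aA bA ab.
have [r ra /hopP [p [pp lp sp]]] := Q_far yQ aA bA w_gt a_far.
pose q := rcons p a.
have qp : path (fun t t' => w t t' <= 3 * s) y q.
  by rewrite rcons_path pp lp (leq_trans ra) // leq_pmull.
have far_q : F :\: near \subset
    y |: [set x in F | has (fun t => t \in cball w x (v x) (6 * s)) q].
  apply/subsetP => x xF; rewrite !inE; case: (eqVneq x y) => //= xy.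
  have [xF' _] := farP x xF; have [axA _ _] := F_ab x xF'.
  have [|t tq tb] := @crossing_step x y q (subsetP FQ x xF') (y_top x xF xy) _ qp.
    by rewrite last_rcons.
  by rewrite xF'; apply/hasP; exists t.
apply: leq_trans (subset_leq_card far_q) _; apply: leq_trans (leq_card_setU _ _) _.
rewrite cards1 leq_add2l.
have := @card_has _ _ F (fun x t => t \in cball w x (v x) (6 * s)) q (6 * s).+1.
move=> /(_ _) le1; apply: leq_trans (le1 _) _.
  move=> t _; apply: (@head_count A v _ t) => x; rewrite inE => /andP [xF tx].
  by split=> //; apply/Q_head/(subsetP FQ).
rewrite size_rcons; have := leq_divM (w a b * 4) s.
move: sp; set h := _ %/ s => sp le_h.
apply: (@leq_trans (h.+3 * (7 * s))).
  by apply: leq_mul; [rewrite !ltnS in sp *|move: s_gt0; clear; lia].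
by move: le_h w_gt; rewrite mulnC; clear; nia.
Qed.

(** The tour leaves and enters each side, and not both times by the bridge, so some crossing has
    weight k > 1. The charge 38k is at most 76(k-1), and the two directions double it. *)
Lemma bad_card : 2 < n -> #|Q| + 152 * n <= 152 * TSP w.
Proof.
move=> n_gt2; pose sg := [arg min_(t < (1%g : {perm 'I_n})) tour_cost w t].
have TSPE : TSP w = \sum_(i < n) w (sg i) (sg (ordS i)) by [].
pose W i := w (sg i) (sg (ordS i)).
have ordS_neq (i : 'I_n) : ordS i != i.
  apply/eqP => /(congr1 val) /=; case: (ltnP i.+1 n) => [lt_i|le_i].
    by rewrite modn_small //; clear; lia.
  have -> : i.+1 = n by apply/eqP; rewrite eqn_leq le_i ltn_ord.
  by rewrite modnn; move: (ltn_ord i) le_i n_gt2; clear; lia.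
have W_gt0 i : 0 < W i.
  case: wM => _ w_pos _ _; apply: w_pos; apply: contra_neqN (ordS_neq i) => /eqP.
  by move/perm_inj/esym.
pose out i := [set x in Q | [&& sg i \in A x, sg (ordS i) \notin A x & (sg i, sg (ordS i)) != (x, v x)]].
pose inn i := [set x in Q | [&& sg (ordS i) \in A x, sg i \notin A x & (sg (ordS i), sg i) != (x, v x)]].
have val_iter m (i : 'I_n) : val (iter m (@ordS n) i) = (i + m) %% n.
  elim: m => [|m IH] /=; first by rewrite addn0 modn_small.
  by rewrite IH -addn1 modnDml addn1 addnS.
have exit (P : pred 'I_n) i j : P (sg i) -> ~~ P (sg j) -> exists k, P (sg k) && ~~ P (sg (ordS k)).
  move=> Pi Pj; case: (pickP (fun k => P (sg k) && ~~ P (sg (ordS k)))) => [k|none].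
    by exists k.
  case/negP: Pj; have -> : j = iter (n - i + j) (@ordS n) i.
    apply: val_inj; rewrite val_iter addnA subnKC; last by rewrite ltnW.
    by rewrite modnDl modn_small.
  elim: (_ + _) => //= m IH; have := none (iter m (@ordS n) i); rewrite IH /=.
  by move/negbFE.
have Q_sub x : x \in Q -> exists i, (x \in out i) || (x \in inn i).
  move=> xQ; have [xA vA rA hA] := Q_head xQ.
  have [||k1 /andP [k1A k1A']] := exit (fun y => y \in A x) (sg^-1 x)%g (sg^-1 r0)%g; rewrite /= ?permKV //.
  have [||k2 /andP [k2A k2A']] := exit (fun y => y \notin A x) (sg^-1 r0)%g (sg^-1 x)%g; rewrite /= ?permKV ?negbK //.
  rewrite negbK in k2A'.
  case: (eqVneq (sg k1, sg (ordS k1)) (x, v x)) => [[e1 e2]|ne]; last first.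
    by exists k1; rewrite inE xQ k1A k1A' ne.
  case: (eqVneq (sg (ordS k2), sg k2) (x, v x)) => [[e3 e4]|ne]; last first.
    by exists k2; rewrite orbC inE xQ k2A k2A' ne.
  (* Using the bridge both ways would close the tour after two steps, impossible for more than two
     points. *)
  have k12 : k1 = ordS k2 by apply: (@perm_inj _ sg); rewrite e1 e3.
  have k21 : ordS k1 = k2 by apply: (@perm_inj _ sg); rewrite e2 e4.
  have : val k2 = (k2 + 2) %% n by rewrite -val_iter !iterS -k12 k21.
  rewrite /=.
  case: (ltnP (k2 + 2) n) => [lt_n|le_n]; first by rewrite modn_small //; clear; lia.
  rewrite -(subnK le_n) modnDr modn_small; last by move: (ltn_ord k2) n_gt2; clear; lia.
  by move: (ltn_ord k2) le_n n_gt2; clear; lia.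
have W_out i x : x \in out i -> 1 < W i.
  rewrite inE => /and4P [xQ iA iA' ne]; have [_ _ _ hA] := Q_head xQ.
  rewrite ltn_neqAle W_gt0 andbT; apply: contra ne => W1.
  by have [|-> ->] := hA _ _ iA iA'; rewrite // /adj eq_sym.
have W_inn i x : x \in inn i -> 1 < W i.
  rewrite inE => /and4P [xQ iA iA' ne]; have [_ _ _ hA] := Q_head xQ.
  rewrite ltn_neqAle W_gt0 andbT; apply: contra ne => W1.
  by have [|-> ->] := hA _ _ iA iA'; rewrite // /adj wS eq_sym.
have out_card i : #|out i| <= 76 * (W i).-1.
  case: (set_0Vmem (out i)) => [->|[x xi]]; first by rewrite cards0.
  have W1 := W_out i x xi; apply: (@leq_trans (38 * W i)); last by move: W1; clear; lia.
  apply: charge => // [|y]; first by apply/subsetP => y; rewrite inE => /andP [].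
  by rewrite inE => /and4P [].
have inn_card i : #|inn i| <= 76 * (W i).-1.
  case: (set_0Vmem (inn i)) => [->|[x xi]]; first by rewrite cards0.
  have W1 := W_inn i x xi; apply: (@leq_trans (38 * W i)); last by move: W1; clear; lia.
  rewrite /W wS; apply: charge => // [||y].
  - by apply/subsetP => y; rewrite inE => /andP [].
  - by rewrite wS.
  - by rewrite inE => /and4P [].
have : #|Q| <= \sum_(i < n) 152 * (W i).-1.
  apply: (@leq_trans (\sum_(i < n) (#|out i| + #|inn i|))); last first.
    by apply: leq_sum => i _; move: (out_card i) (inn_card i); clear; lia.
  rewrite -sum1_card.
  under [X in _ <= X]eq_bigr => i _ do rewrite -!sum1_card [X in X + _]big_mkcond [X in _ + X]big_mkcond -big_split /=.
  rewrite exchange_big /= big_mkcond; apply: leq_sum => x _.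
  case: ifP => // /Q_sub [i xi]; rewrite (bigD1 i) //= (leq_trans _ (leq_addr _ _)) //.
  by case/orP: xi => ->; case: ifP.
rewrite TSPE -big_distrr /= => le1.
have -> : \sum_(i < n) w (sg i) (sg (ordS i)) = \sum_(i < n) (W i).-1 + n.
  rewrite -[n in _ + n]card_ord -sum1_card -big_split /=; apply: eq_bigr => i _.
  by rewrite addn1 prednK // W_gt0.
by rewrite mulnDr leq_add2r.
Qed.
End Charge.
End Metric.
End CutEdge.

Lemma hits_cover n (w : dist n) r0 s (R : {set 'I_n}) : pos_int_metric w ->
  (forall u v, connect (fun u v => w u v == 1) u v) -> r0 \in R ->
  hits_balls w s R -> forall y, exists2 r, r \in R & w y r <= s.
Proof.
move=> wM conn r0R hitR y; have [w0 _ _ _] := wM.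
(* Cutting the pair [y y] removes no unit edge, since [w y y = 0]. *)
have [r rR ry] : exists2 r, r \in R & r \in ball (cut w y y) y s.
  case: (ltnP s #|ball (cut w y y) y s|) => [/hitR//|small].
  exists r0 => //; apply: (ball_small small).
  apply: connect_sub (conn y r0) => u v uv; apply: connect1; rewrite /cut uv /= andbb.
  by apply: contraTN uv => /eqP [-> ->]; rewrite w0.
by exists r => //; apply: cball_w ry.
Qed.

(** * Unbypassed edges of a normal tree pass the bridge test *)

Section NormalSide.
Variables (n : nat) (w : dist n) (r0 : 'I_n).
Hypothesis wM : pos_int_metric w.
Let adj : rel 'I_n := fun u v => w u v == 1.
Hypothesis adj_conn : forall u v, connect adj u v.
Variables (par : 'I_n -> 'I_n) (dep : 'I_n -> nat).
Hypothesis tr : rtree adj r0 par dep.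
Hypothesis norm : dfs_like adj par.
Local Notation anc := (anc par).
Local Notation By := (bypassed w r0 par dep).

Let wS u v : w u v = w v u. Proof. by case: wM. Qed.
Let wT u v x : w u v <= w u x + w x v. Proof. by case: wM. Qed.

Definition nonleaf := [set v | [exists y, (y != r0) && (par y == v)]].

Lemma anc_child a x : anc a x -> a != x -> exists c, [/\ c != r0, par c = x & anc a c].
Proof.
move=> ax a_x; have le_xa := anc_dep tr ax.
have lt_xa : dep x < dep a.
  rewrite ltn_neqAle le_xa andbT; apply: contraNneq a_x => eq_d.
  by rewrite (anc_anti tr ax) // eq_d.
exists (iter (dep a - dep x).-1 par a); split; last exact: fconnect_iter.
  apply/eqP => /(congr1 dep); rewrite (dep_iter tr); case: tr => _ -> _.
  by move: lt_xa; clear; lia.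
by rewrite -iterS prednK ?subn_gt0 // -(anc_iter tr ax).
Qed.

Lemma leaf_indep y z : y \notin nonleaf -> z \notin nonleaf -> ~~ adj y z.
Proof.
move=> yL zL; apply/negP => yz; have [w0 _ _ _] := wM.
have y_z : y != z by apply: contraTneq yz => ->; rewrite /adj w0.
have nl u v : anc u v -> u != v -> v \in nonleaf.
  by move=> uv /(anc_child uv) [c [? /eqP ? _]]; rewrite inE; apply/existsP; exists c; apply/andP.
case: (norm yz) => [/nl/(_ y_z)|/nl]; first by rewrite (negPf zL).
by rewrite eq_sym (negPf yL) => /(_ y_z).
Qed.

Section Head.
Variable x : 'I_n.
Hypotheses (x_r0 : x != r0) (xBy : x \notin By) (pxBy : par x \notin By).

Let not_bypass a b : anc a x -> ~~ anc b x -> (dep a - dep x).+1 < (w a b).*2.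
Proof.
move=> ax bx; rewrite ltnNge; apply: contra xBy => le_w; apply/bypassedP.
by split=> //; exists a, b; rewrite /bypass ax bx.
Qed.

(** By normality a unit pair leaving the subtree goes from [u] to an ancestor [z]. It bypasses the
    edge above [x] unless [u = x], and then the edge above [par x] unless [z = par x]; hence the
    condition on both edges. *)
Lemma unbypassed_head : bridge_head w r0 [set a | anc a x] x (par x).
Proof.
have dx : dep (par x) = (dep x).-1 by apply: dep_par tr x.
have dx0 : 0 < dep x by rewrite lt0n; apply: contra_neqN x_r0 => /eqP /(dep_eq0 tr).
split; rewrite ?inE ?anc_refl //.
- by apply/negP => /(anc_dep tr); rewrite dx; move: dx0; clear; lia.
- by rewrite (anc_rootE tr) eq_sym.
move=> u z; rewrite !inE => ux zx uz.
have uz_anc : anc u z.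
  by case: (norm uz) => // zu; case/negP: zx; apply: anc_trans zu ux.
have lt_zx : dep z < dep x.
  by rewrite ltnNge; apply: contra zx; apply: (anc_chain tr ux uz_anc).
have xz : anc x z by apply: (anc_chain tr uz_anc ux); apply: ltnW.
have du : dep u = dep x.
  have := not_bypass ux zx; rewrite (eqP uz) => lt_u.
  by move: lt_u (anc_dep tr ux); clear; lia.
have eu : u = x by symmetry; apply: (anc_anti tr ux); rewrite du.
split=> //; rewrite eu in uz.
have x_z : x != z by apply: contraTneq lt_zx => ->; rewrite ltnn.
have pxz := anc_par_neq xz x_z; apply/eqP; apply: contraNT pxBy => z_px.
have lt_zp : dep z < dep (par x).
  rewrite ltn_neqAle (anc_dep tr pxz) andbT; apply: contraNneq z_px => eq_d.
  by rewrite (anc_anti tr pxz) // eq_d.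
apply/bypassedP; split.
  by apply: contraTneq lt_zp => ->; case: (tr) => _ -> _.
exists x, z; rewrite /bypass anc_par (eqP uz) /= ; apply/andP; split.
  by apply/negP => /(anc_dep tr); rewrite leqNgt lt_zp.
by rewrite dx; move: dx0; clear; lia.
Qed.

Let tree_step y : anc y x -> y != x -> cut w x (par x) (par y) y.
Proof.
move=> yx y_x; have y_r0 : y != r0.
  by apply: contraNneq y_x => y_r; move: yx; rewrite y_r (anc_rootE tr).
have [yp _] := let: And3 _ _ f := tr in f y y_r0.
apply: (head_cut unbypassed_head); rewrite ?inE ?anc_par_neq //.
by rewrite wS.
Qed.

Section Sound.
Variables (s : nat) (R K : {set 'I_n}).
Hypothesis s_gt0 : 0 < s.
Hypothesis coverR : forall y, exists2 r, r \in R & w y r <= s.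

Let w_iter k a : w a (iter k par a) <= k.
Proof.
elim: k => [|k IH] /=; first by have [-> _ _ _] := wM.
set b := iter k par a; apply: leq_trans (wT _ _ b) _; rewrite -addn1 leq_add //.
case: (eqVneq b r0) => [->|b_r0]; first by case: tr => -> _ _; have [-> _ _ _] := wM.
by have [/eqP -> _] := let: And3 _ _ f := tr in f b b_r0.
Qed.

(** Representatives of the points at every [s]-th level of the tree path from [x] to [a] form the
    chain; the extra hop reaches [a] itself. *)
Let hop_tree a : a \in R -> anc a x -> a \in hop w R s x ((dep a - dep x) %/ s).+1.
Proof.
move=> aR ax; set L := dep a - dep x.
have step i : i <= L %/ s -> exists2 r, r \in hop w R s x i & w (iter (L - i * s) par a) r <= s.
  elim: i => [|i IH] le_i.
    rewrite mul0n subn0 -(anc_iter tr ax); have [r rR xr] := coverR x.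
    by exists r => //; rewrite inE rR.
  have [r r_hop wr] := IH (ltnW le_i).
  have [r' r'R wr'] := coverR (iter (L - i.+1 * s) par a); exists r' => //.
  rewrite /hop iterS -/(hop w R s x i) !inE r'R /=; apply/orP; right; apply/existsP.
  exists r; rewrite r_hop /=.
  have le_L : i.+1 * s <= L by rewrite (leq_trans (leq_mul le_i (leqnn s))) // leq_divM.
  have := w_iter s (iter (L - i.+1 * s) par a); rewrite -iterD.
  have -> : s + (L - i.+1 * s) = L - i * s by move: le_L; rewrite mulSn; clear; lia.
  move=> w_st; apply: leq_trans (wT _ _ (iter (L - i.+1 * s) par a)) _.
  rewrite wS; apply: leq_trans (leq_add (wT _ _ (iter (L - i * s) par a)) (leqnn _)) _.
  by move: wr wr' w_st; clear; lia.
have [r r_hop wr] := step _ (leqnn _).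
rewrite /hop iterS -/(hop w R s x (L %/ s)) !inE aR /=; apply/orP; right; apply/existsP.
exists r; rewrite r_hop /= wS.
apply: leq_trans (wT _ _ (iter (L - L %/ s * s) par a)) _.
have := w_iter (L - L %/ s * s) a; have := ltn_pmod L s_gt0; have := divn_eq L s.
by move: wr; set q := _ * s; clear; lia.
Qed.

(** Allowed moves never leave the subtree of [x]: a leaving pair of weight k other than the bridge
    starts less than 2k levels below [x], so its start lies in the ball and, if in [R], in the hops,
    and all clauses of [allowed] fail. *)
Lemma unbypassed_bad : ~~ connect (allowed w K R s x (par x)) x r0.
Proof.
have [_ _ rA hA] := unbypassed_head; apply: contra rA => /connectP [p].
suff inv a : a \in [set a | anc a x] -> path (allowed w K R s x (par x)) a p ->
  r0 = last a p -> r0 \in [set a | anc a x] by apply: inv; rewrite inE anc_refl.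
elim: p a => [|b p IH] a ax /=; first by move=> _ ->.
case/andP=> ab pp lp; apply: (IH b _ pp lp); apply: contraTT ab => bx.
rewrite !inE in ax bx; rewrite /allowed negb_and; apply/orP; right.
rewrite !negb_or; have := not_bypass ax bx; have B_a := tree_ball tr tree_step ax.
move=> lt_w; apply/and3P; split.
- apply/negP => /and3P [ab ab_xp _]; case/negP: ab_xp.
  by have [|||-> ->] := hA a b; rewrite ?inE.
- rewrite negb_and negbK; apply/orP; right; apply: (subsetP (ball_sub _ _ _)) B_a.
  by move: lt_w; clear; lia.
- rewrite negb_and negbK -implybE; apply/implyP => aR.
  apply: (subsetP (hop_sub w R s x _)) (hop_tree aR ax).
  by rewrite ltnS leq_div2r //; move: lt_w; clear; lia.
Qed.

End Sound.
End Head.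

Definition heads := [set x | [&& x != r0, x \notin By & par x \notin By]].

Lemma headsP x : x \in heads -> [/\ x != r0, x \notin By & par x \notin By].
Proof. by rewrite [_ \in heads]in_set => /and3P. Qed.

(** Each inner vertex selects one child, which is a head unless the edge above it or above its
    parent is bypassed. *)
Lemma nonleaf_heads : #|nonleaf| <= #|heads| + 2 * #|By|.
Proof.
pose ch v := odflt r0 [pick y | (y != r0) && (par y == v)].
have chP v : v \in nonleaf -> ch v != r0 /\ par (ch v) = v.
  rewrite inE /ch => /existsP [y yv]; case: pickP => [z /andP [? /eqP]|/(_ y)] //.
  by rewrite yv.
have ch_inj : {in nonleaf &, injective ch}.
  by move=> u v /chP [_ {2}<-] /chP [_ {2}<-] ->.
have sub : nonleaf \subset (nonleaf :&: By) :|: (nonleaf :\: By) by rewrite setID.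
apply: leq_trans (subset_leq_card sub) _; apply: leq_trans (leq_card_setU _ _) _.
have le1 : #|nonleaf :&: By| <= #|By| by rewrite subset_leq_card // subsetIr.
have le2 : #|nonleaf :\: By| <= #|heads| + #|By|.
  rewrite -(card_in_imset (f := ch)); last by move=> u v /setDP [uN _] /setDP [vN _]; apply: ch_inj.
  apply: leq_trans (leq_card_setU _ _); apply: subset_leq_card; apply/subsetP => z /imsetP [v].
  case/setDP=> /chP [v_r0 pv] vBy ->; rewrite inE; case: (boolP (ch v \in By)); rewrite ?orbT // orbF.
  by move=> chBy; rewrite [_ \in heads]in_set v_r0 pv vBy chBy.
by move: le1 le2; clear; lia.
Qed.

Definition children x := [set y | (y != r0) && (par y == x)].

Lemma sum_children (Q : {set 'I_n}) : \sum_(x in Q) #|children x| <= n.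
Proof.
rewrite -[X in _ <= X]card_ord -sum1_card.
under eq_bigr => x _ do rewrite -sum1_card big_mkcond.
rewrite exchange_big; apply: leq_sum => y _; rewrite -big_mkcondr /=.
rewrite sum1dep_card -[X in _ <= X](cards1 (par y)).
apply: subset_leq_card; apply/subsetP => x; rewrite !inE => /andP [xQ].
by move=> /andP [_ /eqP ->].
Qed.

Variables (d rho N : nat).

(** The heads that are cheap to test: a small ball to read, and few candidates for [v], because
    without bypassed children all unit neighbours of [x] are its parent and its children. *)
Definition good_heads := [set x in heads |
  [&& [disjoint children x & By], #|children x| < d & #|cball w x (par x) rho| <= N]].

Lemma good_head_deg x : x \in good_heads -> #|[set z | w x z == 1]| <= d.
Proof.
rewrite [_ \in good_heads]in_set => /and4P [/headsP [x_r0 xBy pxBy] chBy ch_d _].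
have [_ _ _ hA] := unbypassed_head x_r0 xBy pxBy.
apply: leq_trans (_ : #|par x |: children x| <= _); last first.
  by apply: leq_trans (leq_card_setU _ _) _; rewrite cards1.
apply: subset_leq_card; apply/subsetP => z; rewrite !inE => xz.
case: (boolP (anc z x)) => [zx|zx]; last by have [|||_ ->] := hA x z; rewrite ?inE ?anc_refl ?eqxx.
have [w0 _ _ _] := wM.
have z_x : z != x by apply: contraTneq xz => ->; rewrite w0.
have [c [c_r0 pc zc]] := anc_child zx z_x; apply/orP; right.
case: (eqVneq z c) => [->|z_c]; first by rewrite c_r0 pc eqxx.
have dpc := dep_par tr c; rewrite pc in dpc.
have dc0 : 0 < dep c by rewrite lt0n; apply: contra_neqN c_r0 => /eqP /(dep_eq0 tr).
case/pred0P/(_ c)/negP: chBy => /=; rewrite inE c_r0 pc eqxx /=; apply/bypassedP.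
split=> //; exists z, x; rewrite /bypass zc wS (eqP xz) /=; apply/andP; split.
  by apply/negP => /(anc_dep tr); rewrite dpc; move: dc0; clear; lia.
rewrite ltnS subn_gt0 ltn_neqAle (anc_dep tr zc) andbT; apply: contraNneq z_c => eq_d.
by rewrite (anc_anti tr zc) // eq_d.
Qed.

(** Markov bounds, cleared of denominators: at most n/d vertices have [d] children, and since
    [head_count] puts each vertex into at most [rho.+1] balls, at most n(rho+1)/(N+1) heads have a
    large ball. *)
Lemma good_heads_card : 0 < d ->
  N.+1 * d * #|nonleaf| <=
  N.+1 * d * (#|good_heads| + 3 * #|By|) + N.+1 * n + d * n * rho.+1.
Proof.
move=> d0; have le0 := nonleaf_heads.
pose H1 := [set x in heads | ~~ [disjoint children x & By]].
pose H2 := [set x in heads | d <= #|children x|].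
pose H3 := [set x in heads | N < #|cball w x (par x) rho|].
have sub : heads \subset good_heads :|: H1 :|: H2 :|: H3.
  apply/subsetP => x xH; rewrite !in_setU ![_ \in [set _ in heads | _]]inE xH /=.
  by case: [disjoint _ & _]; case: (ltnP #|children x| d); case: (leqP #|cball w x (par x) rho| N).
have le1 : #|heads| <= #|good_heads| + #|H1| + #|H2| + #|H3|.
  apply: leq_trans (subset_leq_card sub) _; apply: leq_trans (leq_card_setU _ _) _.
  rewrite leq_add2r; apply: leq_trans (leq_card_setU _ _) _.
  by rewrite leq_add2r leq_card_setU.
have leH1 : #|H1| <= #|By|.
  apply: leq_trans (leq_imset_card par By); apply: subset_leq_card; apply/subsetP => x.
  rewrite inE => /andP [_ /pred0Pn [y] /=]; rewrite inE => /andP [/andP [_ /eqP <-] yBy].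
  exact: imset_f.
have leH2 : #|H2| * d <= n.
  apply: leq_trans (sum_children H2); rewrite -sum_nat_const; apply: leq_sum => x.
  by rewrite inE => /andP [].
have leH3 : #|H3| * N.+1 <= n * rho.+1.
  apply: (@leq_trans (\sum_(x in H3) #|cball w x (par x) rho|)).
    by rewrite -sum_nat_const; apply: leq_sum => x; rewrite inE => /andP [].
  under eq_bigr => x _ do rewrite -sum1_card big_mkcond.
  rewrite exchange_big -[X in X * _]card_ord -sum_nat_const /=; apply: leq_sum => a _.
  rewrite -big_mkcondr /= sum1dep_card.
  apply: (@head_count _ w r0 wM adj_conn (fun x => [set a | anc a x]) par _ a) => x.
  rewrite inE => /andP [xH3 ax]; split=> //.
  have /headsP [x_r0 xBy pxBy] : x \in heads by move: xH3; rewrite inE => /andP [].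
  exact: unbypassed_head.
move: (#|nonleaf|) (#|heads|) (#|good_heads|) (#|H1|) (#|H2|) (#|H3|) (#|By|) le0 le1 leH1 leH2 leH3.
clear; move=> a b c h1 h2 h3 y le0 le1 leH1 leH2 leH3.
have le4 : a <= c + 3 * y + h2 + h3 by lia.
apply: leq_trans (leq_mul (leqnn (N.+1 * d)) le4) _; rewrite !mulnDr.
rewrite leq_add //; first rewrite leq_add //.
- by rewrite -mulnA (mulnC d) leq_mul2l leH2 orbT.
- by rewrite mulnAC mulnC (mulnC N.+1) -mulnA leq_mul2l leH3 orbT.
Qed.

End NormalSide.

(** * Random greedy independent sets *)

Section SumLists.
Variables (n N : nat).
Hypothesis le_nN : n <= N.

(* Sums over draws from N slots, n of which hold the vertices and the others None. *)
Definition S1 (F : option 'I_n -> nat) := \sum_v F (Some v) + (N - n) * F None.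

Fixpoint SL q (F : seq (option 'I_n) -> nat) :=
  if q is q'.+1 then S1 (fun o => SL q' (fun l => F (o :: l))) else F [::].

Lemma S1_le F F' : (forall o, F o <= F' o) -> S1 F <= S1 F'.
Proof. by move=> le_F; rewrite leq_add ?leq_mul //; apply: leq_sum => v _. Qed.

Lemma eq_S1 F F' : F =1 F' -> S1 F = S1 F'.
Proof. by move=> eq_F; congr (_ + _ * _); first apply: eq_bigr => v _. Qed.

Lemma S1D F F' : S1 (fun o => F o + F' o) = S1 F + S1 F'.
Proof. by rewrite /S1 big_split /= mulnDr addnACA. Qed.

Lemma S1M c F : S1 (fun o => c * F o) = c * S1 F.
Proof. by rewrite /S1 -big_distrr /= mulnCA -mulnDr. Qed.

Lemma S1_const c : S1 (fun=> c) = N * c.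
Proof. by rewrite /S1 sum_nat_const card_ord -mulnDl subnKC. Qed.

Lemma SL_le q F F' : (forall l, size l = q -> F l <= F' l) -> SL q F <= SL q F'.
Proof.
elim: q F F' => [|q IH] F F' le_F /=; first exact: le_F.
by apply: S1_le => o; apply: IH => l sl; apply: le_F; rewrite /= sl.
Qed.

Lemma eq_SL q F F' : (forall l, F l = F' l) -> SL q F = SL q F'.
Proof. by move=> eq_F; apply/eqP; rewrite eqn_leq !SL_le // => l _; rewrite eq_F. Qed.

Lemma SLD q F F' : SL q (fun l => F l + F' l) = SL q F + SL q F'.
Proof.
elim: q F F' => [|q IH] F F' //=; rewrite -S1D; apply: eq_S1 => o; exact: IH.
Qed.

Lemma SLM q c F : SL q (fun l => c * F l) = c * SL q F.
Proof. by elim: q F => [|q IH] F //=; rewrite -S1M; apply: eq_S1 => o; apply: IH. Qed.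

Lemma SL_const q c : SL q (fun=> c) = N ^ q * c.
Proof.
elim: q => [|q IH] /=; first by rewrite mul1n.
by under eq_S1 => o do rewrite IH; rewrite S1_const expnS mulnA.
Qed.

Lemma SL_sum (I : finType) q (F : I -> seq (option 'I_n) -> nat) :
  SL q (fun l => \sum_i F i l) = \sum_i SL q (F i).
Proof.
elim: q F => [|q IH] F //=; rewrite [RHS]big_split /= -big_distrr /=.
rewrite /S1 IH; congr (_ + _).
by rewrite [RHS]exchange_big /=; apply: eq_bigr => v _; rewrite IH.
Qed.

Lemma S1_SL q (F : option 'I_n -> seq (option 'I_n) -> nat) :
  S1 (fun o => SL q (F o)) = SL q (fun l => S1 (fun o => F o l)).
Proof. by rewrite /S1 SLD SLM SL_sum. Qed.

Lemma SL_cat p q F : SL (p + q) F = SL p (fun l => SL q (fun l' => F (l ++ l'))).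
Proof. by elim: p F => [|p IH] F //=; apply: eq_S1 => o; rewrite IH. Qed.

Lemma SL_avoid q (B : {set 'I_n}) :
  SL q (fun l => all (fun o => if o is Some v then v \notin B else true) l : nat) =
  (N - #|B|) ^ q.
Proof.
set ok := fun o : option 'I_n => _; elim: q => [|q IH] //=.
rewrite (eq_S1 (F' := fun o => (N - #|B|) ^ q * ok o)) => [|o]; last first.
  rewrite -IH; case: (ok o); first by rewrite muln1; apply: eq_SL => l.
  by rewrite /= SL_const !muln0.
rewrite S1M expnSr; congr (_ * _); rewrite /S1 /= muln1.
rewrite (eq_bigr (fun u => if u \in ~: B then 1 else 0)) => [|u _]; last first.
  by rewrite inE; case: (u \in B).
have -> : \sum_u (if u \in ~: B then 1 else 0) = #|~: B| by rewrite -big_mkcond sum1_card.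
move: (cardsC B); rewrite card_ord; move: #|B| #|~: B| le_nN => a b; clear; lia.
Qed.

End SumLists.

Section Greedy.
Variables (n N : nat) (adj : rel 'I_n).
Hypotheses (le_nN : n <= N) (adj_sym : symmetric adj) (adj_irr : irreflexive adj).
Local Notation S1 := (S1 N).
Local Notation SL := (SL N).
Implicit Types (Z : {set 'I_n}) (o : option 'I_n) (l : seq (option 'I_n)).

Definition nb u := [set v | adj u v].

(* Greedy maximal independent set: a drawn vertex outside Z joins, and it leaves the
   graph together with its neighbours. *)
Definition gstep Z o :=
  if o is Some u then if u \in Z then Z else Z :|: (u |: nb u) else Z.
Definition grun Z l := foldl gstep Z l.

Definition joins Z o : {set 'I_n} :=
  if o is Some u then if u \in Z then set0 else [set u] else set0.

Fixpoint joined Z l : {set 'I_n} :=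
  if l is o :: l' then joins Z o :|: joined (gstep Z o) l' else set0.

Lemma gstep_sub Z o : Z \subset gstep Z o.
Proof. by case: o => [u|] //=; case: ifP => // _; apply: subsetUl. Qed.

Lemma grun_sub Z l : Z \subset grun Z l.
Proof.
by elim: l Z => [|o l IH] Z //=; apply: subset_trans (gstep_sub Z o) (IH _).
Qed.

Lemma joined_cat Z l l' : joined Z (l ++ l') = joined Z l :|: joined (grun Z l) l'.
Proof.
elim: l Z => [|o l IH] Z /=; first by rewrite set0U.
by rewrite IH setUA.
Qed.

Lemma joined_out Z l u : u \in joined Z l -> u \notin Z /\ Some u \in l.
Proof.
elim: l Z => [|o l IH] Z /=; first by rewrite inE.
rewrite inE => /orP [|/IH [uZ ul]]; last first.
  by rewrite inE ul orbT; split=> //; apply: contra uZ; apply: (subsetP (gstep_sub _ _)).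
case: o => [v|]; last by rewrite inE.
rewrite /joins; by case: ifP => vZ; rewrite inE // => /eqP ->; rewrite vZ inE eqxx.
Qed.

Lemma joined_indep Z l u v : u \in joined Z l -> v \in joined Z l -> ~~ adj u v.
Proof.
elim: l Z => [|o l IH] Z /=; first by rewrite inE.
have aux a b : a \in joins Z o ->
    b \in joined (gstep Z o) l -> ~~ adj a b.
  rewrite /joins; case: o => [c|]; last by rewrite inE.
  case: ifP => cZ; rewrite inE // => /eqP -> /joined_out [bZ _].
  by apply: contra bZ => cb; rewrite /= cZ !inE cb !orbT.
rewrite !inE => /orP [u1|u2] /orP [v1|v2].
- rewrite /joins in u1 v1; case: o u1 v1 {aux} => [c|]; last by rewrite inE.
  by case: ifP => cZ; rewrite !inE // => /eqP -> /eqP ->; rewrite adj_irr.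
- exact: aux.
- by rewrite adj_sym; apply: aux.
- exact: IH u2 v2.
Qed.

Definition adeg Z u := #|[set v | (v \notin Z) && adj u v]|.
Definition aedges Z := \sum_(u | u \notin Z) adeg Z u.

Lemma aedges_sub Z Z' : Z \subset Z' -> aedges Z' <= aedges Z.
Proof.
move=> sub; have subC u : u \notin Z' -> u \notin Z.
  by apply: contra; apply: (subsetP sub).
rewrite /aedges big_mkcond [X in _ <= X]big_mkcond; apply: leq_sum => u _.
case: ifP => // /subC ->; apply: subset_leq_card; apply/subsetP => v.
by rewrite !inE => /andP [/subC -> ->].
Qed.

Lemma gstep_card Z u : u \notin Z -> #|~: gstep Z (Some u)| + (1 + adeg Z u) = #|~: Z|.
Proof.
move=> uZ; rewrite /= (negPf uZ) -(cardsID (u |: nb u) (~: Z)) addnC; congr (_ + _).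
  have -> : ~: Z :&: (u |: nb u) = u |: [set v | (v \notin Z) && adj u v].
    by apply/setP => v; rewrite !inE; case: eqVneq => [->|]; rewrite ?uZ //= orbC.
  by rewrite cardsU1 !inE adj_irr andbF.
by apply: eq_card => v; rewrite !inE negb_or andbC.
Qed.

Let ord_mulE c : n * c = \sum_(v < n) c.
Proof. by rewrite sum_nat_const card_ord. Qed.

Let card_ifE b (A : {set 'I_n}) : (if b then #|A| else 0) = \sum_v (b && (v \in A) : nat).
Proof.
case: b; last by rewrite big1.
by rewrite -sum1_card big_mkcond; apply: eq_bigr => v _; case: (v \in A).
Qed.

Lemma gstep_avg Z : S1 (fun o => #|~: gstep Z o|) + aedges Z <= N * #|~: Z|.
Proof.
rewrite -{2}(subnKC le_nN) mulnDl addnAC leq_add2r ord_mulE.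
rewrite /aedges [X in _ + X]big_mkcond -big_split; apply: leq_sum => u _ /=.
case: (boolP (u \in Z)) => uZ /=; first by rewrite addn0.
by rewrite -(gstep_card uZ) /= (negPf uZ) leq_add2l.
Qed.

(** A draw removes on average at least [aedges / N] live vertices, and [aedges] only decreases, so
    [t] times its final average is paid by the vertices lost. *)
Lemma edges_avg t Z : t * SL t (fun l => aedges (grun Z l)) +
  N * SL t (fun l => #|~: grun Z l|) <= N ^ t.+1 * #|~: Z|.
Proof.
elim: t Z => [|t IH] Z /=; first by rewrite mul0n expn1.
have IHS := S1_le N (fun o => IH (gstep Z o)); rewrite S1D !S1M in IHS.
have avg : N ^ t.+1 * S1 (fun o => #|~: gstep Z o|) + N ^ t.+1 * aedges Z <= N ^ t.+2 * #|~: Z|.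
  by rewrite -mulnDr (expnSr _ t.+1) -mulnA leq_mul ?gstep_avg.
suff: S1 (fun o => SL t (fun l => aedges (grun (gstep Z o) l))) <= N ^ t.+1 * aedges Z.
  move=> le_a; rewrite mulSn -addnA; apply: leq_trans (leq_add le_a IHS) _.
  by rewrite addnC.
rewrite expnS -mulnA -(S1_const le_nN) -(SL_const le_nN) S1_le // => o; apply: SL_le => l _.
by apply: aedges_sub; apply: subset_trans (gstep_sub _ _) (grun_sub _ _).
Qed.

(** * Removals outside a vertex cover *)

Section Kills.
Variable C : {set 'I_n}.
Hypothesis C_cover : forall u v, u \notin C -> v \notin C -> ~~ adj u v.

Let killed Z l := (grun Z l :\: Z) :\: joined Z l.

(** A live edge with [u] in [C] and [v] outside is symmetric: drawing [u] kills [v], drawing [v]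
    removes [u] from [C], equally often. Nothing outside [C] is killed otherwise, because [C] covers
    all edges. *)
Let kill_step Z : S1 (fun o => #|killed Z [:: o] :\: C| + #|C :\: gstep Z o|) <= N * #|C :\: Z|.
Proof.
rewrite S1D /S1 -{3}(subnKC le_nN) mulnDl.
have -> : #|killed Z [:: None] :\: C| = 0.
  by apply/eqP; rewrite cards_eq0; apply/eqP/setP => v; rewrite !inE; case: (v \in Z); rewrite ?andbF.
rewrite muln0 addn0 addnA leq_add2r ord_mulE -big_split /=.
pose L u := [set v | [&& v \notin Z, v \notin C & adj u v]].
pose K u := [set v | [&& v \in C, v \notin Z & adj u v]].
apply: (@leq_trans (\sum_u ((if u \in C :\: Z then #|L u| else 0) + #|C :\: gstep Z (Some u)|))).
  apply: leq_sum => u _; rewrite leq_add2r.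
  case: (boolP (u \in Z)) => uZ; last case: (boolP (u \in C)) => uC.
  - apply: leq_trans (leq0n _); rewrite leqn0 cards_eq0; apply/eqP/setP => v.
    by rewrite !inE /= uZ; case: (v \in Z); rewrite ?andbF.
  - rewrite inE uZ uC /=; apply: subset_leq_card; apply/subsetP => v.
    rewrite /killed /= /joins (negPf uZ) !inE.
    by case: (v \in Z); case: (v == u); rewrite //= ?andbF // => /andP [-> ->].
  - apply: leq_trans (leq0n _); rewrite leqn0 cards_eq0; apply/eqP/setP => v.
    rewrite /killed /= /joins (negPf uZ) !inE; case: (boolP (v \in C)) => //= vC.
    by rewrite (negPf (C_cover uC vC)) orbF; case: (v \in Z); case: (v == u).
rewrite big_split /=.
have -> : \sum_u (if u \in C :\: Z then #|L u| else 0) =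
    \sum_u (if u \notin C :|: Z then #|K u| else 0).
  rewrite (eq_bigr _ (fun u _ => card_ifE _ _)) [RHS](eq_bigr _ (fun u _ => card_ifE _ _)).
  rewrite exchange_big; apply: eq_bigr => v _; apply: eq_bigr => u _; rewrite !inE adj_sym.
  by case: (v \in C); case: (v \in Z); case: (u \in C); case: (u \in Z); case: (adj v u).
rewrite -big_split; apply: leq_sum => u _ /=; case: ifP => [|_]; last first.
  by apply: subset_leq_card; apply: setDS (gstep_sub Z (Some u)).
rewrite inE negb_or => /andP [uC uZ]; rewrite (negPf uZ) addnC -cardsUI.
have -> : (C :\: (Z :|: (u |: nb u))) :&: K u = set0.
  by apply/setP => v; rewrite !inE; case: (adj u v); rewrite ?orbT //= !andbF.
rewrite cards0 addn0; apply: subset_leq_card; apply/subsetP => v; rewrite !inE.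
by case: (v \in Z); case: (v \in C); rewrite //= ?andbF.
Qed.

Lemma kills_avg t Z :
  SL t (fun l => #|((grun Z l :\: Z) :\: joined Z l) :\: C|) <= N ^ t * #|C :\: Z|.
Proof.
elim: t Z => [|t IH] Z /=.
  rewrite mul1n (_ : _ :\: C = set0) ?cards0 //.
  by apply/setP => v; rewrite !inE; case: (v \in Z); rewrite ?andbF.
rewrite expnSr -mulnA; apply: leq_trans (leq_mul (leqnn _) (kill_step Z)).
rewrite -S1M; apply: S1_le => o; rewrite mulnDr -(SL_const le_nN).
apply: leq_trans (leq_add (leqnn _) (IH _)); rewrite -SLD; apply: SL_le => l _.
apply: leq_trans (leq_card_setU _ _); apply: subset_leq_card; apply/subsetP => v.
rewrite /killed /= !inE !negb_or.
move=> /and4P [vC /andP [v1 v2] vZ v3]; rewrite vC vZ v1 v2 v3 /= andbT.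
by case: (v \in gstep Z o).
Qed.

End Kills.

(** * Cost of evaluating the greedy process locally *)

Section Local.
Variable P0 : {set 'I_n}.

Definition active (r : seq (option 'I_n)) u := (u \notin P0) && (Some u \notin r).

(* [alP r v]: v survives the greedy process on the draws r, latest draw first; [cst r v] is
   the number of further vertices whose neighbourhoods the recursive evaluation reads. *)
Fixpoint alP r v := if r is o :: r' then
    alP r' v && ~~ (if o is Some u then [&& active r' u, adj v u & alP r' u] else false)
  else true.

Fixpoint cst r v := if r is o :: r' then
    cst r' v + (if o is Some u then
      if [&& alP r' v, active r' u & adj v u] then (cst r' u).+1 else 0 else 0)
  else 0.

Fixpoint vis r v : seq 'I_n := if r is o :: r' then
    vis r' v ++ (if o is Some u then
      if [&& alP r' v, active r' u & adj v u] then vis r' u else [::] else [::])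
  else [:: v].

Lemma size_vis r v : size (vis r v) = (cst r v).+1.
Proof.
elim: r v => [|[u|] r IH] v //=; rewrite size_cat IH ?addn0 //.
by case: ifP => _; rewrite ?IH ?addSn ?addn0.
Qed.

Lemma drawn_grun Z l u : Some u \in l -> u \in grun Z l.
Proof.
elim: l Z => [|o l IH] Z //=; rewrite inE => /orP [/eqP <-|/IH //].
by apply: (subsetP (grun_sub _ _)) => /=; case: ifP => //; rewrite !inE eqxx orbT.
Qed.

Lemma alP_grun l v : v \notin P0 -> Some v \notin l -> alP (rev l) v = (v \notin grun P0 l).
Proof.
elim/last_ind: l v => [|l o IH] v vP; first by rewrite /= vP.
rewrite mem_rcons inE negb_or rev_rcons /= /grun foldl_rcons -/(grun P0 l) => /andP [vo vl].
rewrite (IH v vP vl); case: o vo => [u|] vu /=; last by rewrite andbT.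
have -> : [&& active (rev l) u, adj v u & alP (rev l) u] = (u \notin grun P0 l) && adj v u.
  rewrite /active mem_rev; case: (boolP (u \in P0)) => [uP|uP] /=.
    by rewrite (subsetP (grun_sub P0 l) u uP).
  case: (boolP (Some u \in l)) => ul /=; first by rewrite (drawn_grun P0 ul).
  by rewrite (IH u uP ul) andbC.
have v_u : (v == u) = false by apply: contraNF vu => /eqP->.
by case: ifP => uZ; rewrite /= ?andbT // !inE v_u /= negb_or adj_sym.
Qed.

(* Expected-cost potential: drawing an active u adds its cost to every surviving
   neighbour, and this is paid by the edges that u removes. *)
Definition dg r z := #|[set v | [&& active r v, alP r v & adj z v]]|.
Definition pot r := \sum_(z | active r z) (cst r z).+1 * (dg r z).+1.
Definition gain r o := if o is Some u then if active r u then (cst r u).+1 else 0 else 0.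

Let active_cons r u v : active (Some u :: r) v = (v != u) && active r v.
Proof. by rewrite /active inE negb_or (inj_eq (@Some_inj _)) andbCA. Qed.

Let Al r := [set v | active r v && alP r v].

(** Drawing a surviving [u] takes from the surviving neighbours of [z] both [u] itself, if adjacent,
    and all common neighbours of [u] and [z]. *)
Let dg_step r u z : active r u -> u != z ->
  dg (Some u :: r) z + (if u \in Al r then adj u z + #|[set v in Al r | adj v z && adj v u]| else 0)
    <= dg r z.
Proof.
move=> au uz; rewrite inE au /=; case: ifP => aPu; last first.
  rewrite addn0; apply: subset_leq_card; apply/subsetP => v.
  by rewrite !inE /= active_cons => /and3P [/andP [_ ->] /andP [-> _] ->].
have -> : adj u z + #|[set v in Al r | adj v z && adj v u]| =
    #|(if adj u z then [set u] else set0) :|: [set v in Al r | adj v z && adj v u]|.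
  rewrite cardsU (_ : _ :&: _ = set0) ?cards0 ?subn0.
    by congr (_ + _); case: ifP; rewrite ?cards1 ?cards0.
  apply/setP => v; rewrite !inE; case: ifP => _; rewrite !inE //.
  by case: eqP => [->|] //; rewrite adj_irr !andbF.
rewrite -cardsUI (_ : _ :&: _ = set0) ?cards0 ?addn0; last first.
  apply/setP => v; rewrite !inE /= active_cons au aPu andbT /=.
  case: (eqVneq v u) => [->|vu] /=; first by [].
  case: ifP => _; rewrite !inE ?(negPf vu) /=; case: (adj v u); rewrite ?andbF //=.
apply: subset_leq_card; apply/subsetP => v; rewrite !inE /= active_cons au aPu andbT /=.
case/orP => [/and3P [/andP [_ ->] /andP [-> _] ->]//|/orP[|]].
  by case: ifP => [uz'|]; rewrite !inE // => /eqP->; rewrite au aPu adj_sym.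
by case/andP=> /andP [-> ->] /andP [vz _]; rewrite adj_sym.
Qed.

Let e r u z := if u \in Al r then adj u z + #|[set v in Al r | adj v z && adj v u]| else 0.

(** The left side counts surviving neighbours [u] of [z] and walks from [z] over [u] to a survivor
    [v]. Grouping the walks by [v] turns them into the common neighbours credited by [dg_step]. *)
Let second_sum r z : active r z ->
  \sum_(u | [&& active r u, u != z & alP r u && adj u z]) (dg (Some z :: r) u).+1 <=
  \sum_(u | active r u && (u != z)) e r u z.
Proof.
move=> az; pose B := Al r :\ z.
apply: (@leq_trans (\sum_(u in B) (adj u z + \sum_v (adj u z && ((v \in B) && adj u v) : nat)))).
  rewrite big_mkcond [X in _ <= X]big_mkcond; apply: leq_sum => u _.
  rewrite !inE; case: (active r u); rewrite ?andbF //=; case: (u != z) => //=.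
  case: (alP r u) => //=; case: (adj u z) => //=; rewrite add1n ltnS.
  rewrite /dg -sum1dep_card big_mkcond; apply: leq_sum => v _.
  rewrite /= active_cons !inE; case: (v != z) => //=; case: (active r v) => //=.
  by case: (alP r v) => //=; case: (adj u v) => //; case: (~~ _).
rewrite big_split /=.
have -> : \sum_(u in B) \sum_v (adj u z && ((v \in B) && adj u v) : nat) =
    \sum_(u in B) #|[set v in Al r | adj v z && adj v u]|.
  have cE u : #|[set v in Al r | adj v z && adj v u]| =
      \sum_v ([&& v \in B, adj v z & adj v u] : nat).
    rewrite -sum1dep_card big_mkcond; apply: eq_bigr => v _; rewrite !inE.
    case: (eqVneq v z) => [->|_] /=; last by case: ifP.
    by rewrite adj_irr /= andbF.
  rewrite [LHS]big_mkcond [RHS]big_mkcond.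
  rewrite (eq_bigr (fun u => \sum_v ([&& u \in B, v \in B, adj u z & adj u v] : nat))); last first.
    move=> u _; case: (u \in B); last by rewrite big1.
    by apply: eq_bigr => v _; rewrite /= andbCA.
  rewrite exchange_big; apply: eq_bigr => v _; rewrite cE; case: ifP => vB; last first.
    by rewrite big1 // => u _; rewrite andbF.
  by apply: eq_bigr => u _.
rewrite -big_split big_mkcond [X in _ <= X]big_mkcond; apply: leq_sum => u _.
by rewrite /e !inE; case: (active r u); rewrite ?andbF //=; case: (u != z); case: (alP r u).
Qed.

(** The coefficient of [(cst r z).+1] in gain plus new potential, summed over active draws: 1 as
    gain when [z] is drawn, its own term after any other draw, and what its surviving neighbours
    inherit when [z] is drawn. *)
Let pot_vertex r z : active r z ->
  1 + \sum_(u | active r u && (u != z)) (dg (Some u :: r) z).+1 +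
  \sum_(u | [&& active r u, u != z & alP r u && adj u z]) (dg (Some z :: r) u).+1 <=
  \sum_(u | active r u) (dg r z).+1.
Proof.
move=> az; rewrite [X in _ <= X](bigD1 z) //= -addnA leq_add //.
apply: leq_trans (leq_add (leqnn _) (second_sum az)) _; rewrite -big_split /=.
by apply: leq_sum => u /andP [au uz]; rewrite addSn ltnS dg_step.
Qed.

Let pot_inactive r o : (if o is Some u then ~~ active r u else true) -> pot (o :: r) = pot r.
Proof.
move=> no; have aE v : active (o :: r) v = active r v.
  case: o no => [u|] no; last by rewrite /active inE.
  by rewrite active_cons; case: eqP => [->|//]; rewrite (negPf no).
have lE v : alP (o :: r) v = alP r v.
  by case: o no {aE} => [u /= /negPf-> |]; rewrite /= andbT.
have cE v : cst (o :: r) v = cst r v.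
  by case: o no {aE lE} => [u /= /negPf-> |]; rewrite /= ?andbF addn0.
rewrite /pot; apply: eq_big => // z _; rewrite cE; congr (_ * _.+1).
by apply: eq_card => v; rewrite !inE aE lE.
Qed.

(** The supermartingale inequality. A draw of [u] raises the cost of each surviving neighbour by
    [Q u]; regrouping the terms by the vertex whose old cost they carry reduces it to
    [pot_vertex]. *)
Lemma pot_step r : S1 (fun o => gain r o + pot (o :: r)) <= N * pot r.
Proof.
rewrite /S1 -{2}(subnKC le_nN) mulnDl (@pot_inactive r None) // add0n leq_add2r ord_mulE.
rewrite (bigID (active r)) /= [X in _ <= X](bigID (active r)) /= leq_add //; last first.
  by apply: leq_sum => u au; rewrite (negPf au) pot_inactive.
pose Q z := (cst r z).+1.
apply: (@leq_trans (\sum_(u | active r u) (Q u +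
  (\sum_(z | active r z && (z != u)) Q z * (dg (Some u :: r) z).+1 +
   \sum_(z | [&& active r z, z != u & alP r z && adj z u]) Q u * (dg (Some u :: r) z).+1)))).
  apply: leq_sum => u au; rewrite au leq_add2l /pot.
  rewrite [X in _ <= X + _]big_mkcond [X in _ <= _ + X]big_mkcond -big_split big_mkcond.
  apply: leq_sum => z _; rewrite active_cons /= au /= /Q.
  case: (z != u); rewrite ?andbF //=; case: (active r z) => //=.
  by case: (alP r z && adj z u); rewrite ?addn0 //= -addSn mulnDl.
rewrite !big_split /=.
rewrite (exchange_big_dep (active r)) /= => [|u z au /andP []//].
rewrite addnA -!big_split /= exchange_big /=; apply: leq_sum => z az.
rewrite -big_distrr /= -[X in _ + X]big_distrr /= -{1}[Q z]muln1 -!mulnDr -big_distrr leq_mul //.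
apply: leq_trans (pot_vertex az).
by apply: eq_leq; congr (1 + _ + _); apply: eq_bigl => u; rewrite az eq_sym.
Qed.

Fixpoint tot r l := if l is o :: l' then gain r o + tot (o :: r) l' else 0.

Lemma tot_avg q r : SL q (tot r) <= N ^ q * pot r.
Proof.
elim: q r => [|q IH] r //=; rewrite expnSr -mulnA.
apply: leq_trans (leq_mul (leqnn _) (pot_step r)); rewrite -S1M.
by apply: S1_le => o; rewrite SLD SL_const // mulnDr leq_add.
Qed.

Lemma pot0 : pot [::] = #|~: P0| + aedges P0.
Proof.
rewrite -sum1_card /aedges; have aE z : active [::] z = (z \in ~: P0) by rewrite inE /active andbT.
rewrite [X in _ + X](eq_bigl (fun z => z \in ~: P0)) => [|z]; last by rewrite inE.
rewrite -big_split /pot (eq_bigl _ _ aE); apply: eq_bigr => z _ /=; rewrite mul1n -add1n; congr (_ + _).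
by apply: eq_card => v; rewrite !inE /active andbT.
Qed.

Lemma tot_sum r l :
  \sum_(v | active r v && (Some v \in l)) (cst (catrev (take (index (Some v) l) l) r) v).+1
    <= tot r l.
Proof.
elim: l r => [|o l IH] r /=; first by rewrite big_pred0 // => v; rewrite andbF.
apply: leq_trans (leq_add (leqnn _) (IH (o :: r))).
have gE : gain r o = \sum_(v | active r v && (o == Some v)) (cst r v).+1.
  case: o => [u|] /=; last by rewrite big_pred0 // => v; rewrite andbF.
  case: ifP => au; first by rewrite (big_pred1 u) // => v; rewrite /= (inj_eq (@Some_inj _)) eq_sym;
    case: eqP => [->|]; rewrite ?au ?andbF.
  by rewrite big_pred0 // => v; rewrite (inj_eq (@Some_inj _)); case: eqP => [<-|]; rewrite ?au ?andbF.
rewrite gE (bigID (fun v => o == Some v)) /= leq_add //.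
  rewrite big_mkcond [X in _ <= X]big_mkcond; apply: leq_sum => v _.
  case: eqP => [->|_]; last by rewrite !andbF.
  by rewrite inE eqxx /= !andbT.
rewrite big_mkcond [X in _ <= X]big_mkcond; apply: leq_sum => v _.
rewrite inE [Some v == o]eq_sym; case: eqP => [_|ov] /=; first by rewrite !andbF.
by rewrite andbT /active inE negb_or eq_sym; case: eqP ov => //= _ _; case: ifP.
Qed.

End Local.
End Greedy.

(** The first two terms of the binomial expansion of [(a.-1 + 1) ^ a]. *)
Lemma pow_half a : 0 < a -> 2 * a.-1 ^ a <= a ^ a.
Proof.
case: a => // a _ /=; rewrite -[X in _ <= X ^ _]addn1.
rewrite expnDn big_ord_recl big_ord_recl /= !exp1n !muln1 bin0 mul1n subn0 bin1 subSS subn0.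
by rewrite mul2n -addnn addnA (leq_trans _ (leq_addr _ _)) // leq_add2l expnS leq_mul.
Qed.

Lemma pow_half_mul a c : 0 < a -> 2 ^ c * a.-1 ^ (a * c) <= a ^ (a * c).
Proof.
move=> a0; case: c => [|c]; first by rewrite muln0.
by rewrite !expnM -expnMn leq_exp2r // pow_half.
Qed.

Section TourBounds.
Variables (n : nat) (w : dist n).
Hypotheses (wM : pos_int_metric w) (n_gt1 : 1 < n).

Let tour_step (s : {perm 'I_n}) i : 0 < w (s i) (s (ordS i)).
Proof.
have [_ wpos _ _] := wM; apply: wpos; rewrite (inj_eq perm_inj) -val_eqE /=.
have := ltn_ord i; case: (ltnP i.+1 n) => [lt_i _|le_n lt_i].
  by rewrite modn_small // neq_ltn ltnSn.
have -> : i.+1 = n by apply/eqP; rewrite eqn_leq lt_i.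
by rewrite modnn; move: le_n n_gt1; clear; lia.
Qed.

Lemma TSP_ge_n : n <= TSP w.
Proof.
rewrite /TSP /tour_cost -{1}(card_ord n) -sum1_card; apply: leq_sum => i _; exact: tour_step.
Qed.

(** Each tour pair weighs at least the number of its ends in [I], and every point is an end
    twice. *)
Lemma TSP_indep (I : {set 'I_n}) :
  (forall u v, u \in I -> v \in I -> w u v != 1) -> 2 * #|I| <= TSP w.
Proof.
move=> indI; rewrite /TSP; set s := arg_min _ _ _; rewrite /tour_cost.
have cI : #|I| = \sum_(i < n) (s i \in I).
  rewrite -sum1_card big_mkcond (reindex_inj (@perm_inj _ s)); apply: eq_bigr => i _.
  by case: (s i \in I).
have cI' : #|I| = \sum_(i < n) (s (ordS i) \in I).
  by rewrite cI (reindex_inj (@ordS_inj n)).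
rewrite mul2n -addnn {1}cI cI' -big_split; apply: leq_sum => i _ /=.
have := tour_step s i; case: (boolP (s i \in I)) => si; case: (boolP (s (ordS i) \in I)) => si' //=.
by have := indI _ _ si si'; case: (w _ _) => [|[|]].
Qed.

End TourBounds.

(** * Fate of one vertex: global draws first, then local recursion *)

Section Simulation.
Variables (n : nat) (adj : rel 'I_n).
Implicit Types (pre post : seq (option 'I_n)) (v : 'I_n).

(** At its first draw [v] joins unless it has been removed before, so only these draws decide its
    fate. *)
Definition prefix_of v post := take (index (Some v) post) post.

Definition sim_need v pre post :=
  pmap id pre ++ (let Z := grun adj set0 pre in
    if (v \notin Z) && (Some v \in post) then vis adj Z (rev (prefix_of v post)) v else [::]).

(* Whether v leaves the graph without joining, on the draws pre ++ post. *)
Definition sim_out v pre post := let Z := grun adj set0 pre in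
  if v \in Z then v \notin joined adj set0 pre
  else (Some v \in post) && ~~ alP adj Z (rev (prefix_of v post)) v.

Hypotheses (adj_sym : symmetric adj) (adj_irr : irreflexive adj).

Lemma joined_grun Z l v : v \in joined adj Z l -> v \in grun adj Z l.
Proof. by case/joined_out=> _; apply: drawn_grun. Qed.

Let sim_alP v pre post : v \notin grun adj set0 pre -> Some v \in post ->
  let Z' := grun adj (grun adj set0 pre) (prefix_of v post) in
  alP adj (grun adj set0 pre) (rev (prefix_of v post)) v = (v \notin Z') /\
  (v \in joined adj (grun adj set0 pre) post) = (v \notin Z').
Proof.
move=> vZ vpost Z'; have vp : Some v \notin prefix_of v post.
  by rewrite /prefix_of in_take // ltnn.
split; first exact: alP_grun.
rewrite -{1}(cat_take_drop (index (Some v) post) post) -/(prefix_of v post) drop_index //.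
rewrite joined_cat /= !inE; have -> /= : v \in joined adj (grun adj set0 pre) (prefix_of v post) = false.
  by apply: contraNF vp => /joined_out [].
rewrite /joins -/Z'; case: ifP => vZ'; rewrite !inE ?eqxx //=.
by apply/negP => /joined_out []; rewrite vZ'.
Qed.

Lemma sim_out_killed v pre post : sim_out v pre post ->
  v \in grun adj set0 (pre ++ post) :\: joined adj set0 (pre ++ post).
Proof.
rewrite /sim_out joined_cat /grun foldl_cat -/(grun adj set0 pre) !inE negb_or.
set Z := grun adj set0 pre; rewrite -/(grun adj Z post); case: ifP => vZ.
  move=> ->; rewrite (subsetP (grun_sub adj Z post)) // andbT /=.
  by apply/negP => /joined_out []; rewrite vZ.
case/andP=> vpost; have [-> ->] := sim_alP (negbT vZ) vpost; rewrite negbK => vZ'.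
rewrite vZ' (drawn_grun adj Z vpost) !andbT.
by apply/negP => /joined_grun; rewrite -/Z vZ.
Qed.

Lemma sim_out_joined v pre post :
  [|| sim_out v pre post, v \in joined adj set0 (pre ++ post) | Some v \notin post].
Proof.
rewrite /sim_out joined_cat !inE; case: ifP => vZ.
  by case: (v \in joined adj set0 pre); rewrite ?orbT.
case: (boolP (Some v \in post)) => [vpost|_]; last by rewrite !orbT.
by have [-> ->] := sim_alP (negbT vZ) vpost; case: (v \in grun _ _ _); rewrite ?orbT.
Qed.

Section Average.
Variables (N : nat).
Hypothesis le_nN : n <= N.
Local Notation S1 := (S1 N).
Local Notation SL := (SL N).

Lemma sim_out_avg_le t M (C : {set 'I_n}) :
  (forall u v, u \notin C -> v \notin C -> ~~ adj u v) ->
  SL (t + M) (fun l => #|[set v | sim_out v (take t l) (drop t l)]|) <= N ^ (t + M) * (2 * #|C|).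
Proof.
move=> covC; have := kills_avg le_nN adj_sym covC (t + M) set0; rewrite setD0 => kills.
rewrite mul2n -addnn mulnDr; apply: leq_trans (leq_add (leqnn _) kills).
rewrite -(SL_const le_nN) -SLD; apply: SL_le => l _.
apply: leq_trans (leq_card_setU _ _); apply: subset_leq_card; apply/subsetP => v.
rewrite inE => /sim_out_killed; rewrite cat_take_drop !inE => /andP [-> ->].
by rewrite !andbT orbN.
Qed.

(** Markov's inequality: by [edges_avg] the first [s] draws leave on average [aedges] at most Nn/s
    <= sn, so the potential starts at most at (s+1)n on average and bounds the total cost. *)
Lemma sim_need_avg s M : 0 < s -> N <= s * s ->
  64 * SL (s + M) (fun l => #|[set v | s + 64 * s.+1 < size (sim_need v (take s l) (drop s l))]|)
    <= N ^ (s + M) * n.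
Proof.
move=> s0 le_Ns; pose Z pre := grun adj set0 pre.
have trunc pre post : size pre = s ->
    64 * s.+1 * #|[set v | s + 64 * s.+1 < size (sim_need v pre post)]| <= tot adj (Z pre) [::] post.
  move=> spre; apply: leq_trans (tot_sum _ _ _ _).
  rewrite mulnC -sum_nat_cond_const /= big_mkcond [X in _ <= X]big_mkcond.
  apply: leq_sum => v _; rewrite /sim_need /active /= andbT -/(Z pre) -/(rev _).
  rewrite size_cat; have : size (pmap id pre) <= s by rewrite size_pmap -spre count_size.
  move: (size (pmap id pre)) => k; case: ((v \notin Z pre) && _); last first.
    by rewrite /= addn0; clear; case: ifP => //; lia.
  rewrite size_vis -/(prefix_of v post).
  by move: (cst _ _ _ _) => c; clear; case: ifP => //; lia.
have edges : SL s (fun pre => aedges adj (Z pre)) <= N ^ s * (s * n).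
  rewrite -(leq_pmul2l s0); apply: leq_trans (_ : N ^ s.+1 * n <= _); last first.
    by rewrite expnSr mulnCA -mulnA leq_mul // mulnA leq_mul.
  have := edges_avg le_nN adj_irr s set0; rewrite setC0 cardsT card_ord.
  by apply: leq_trans; apply: leq_addr.
rewrite -(leq_pmul2l (ltn0Sn s)) mulnA -SLM SL_cat.
apply: (@leq_trans (SL s (fun pre => N ^ M * (n + aedges adj (Z pre))))).
  apply: SL_le => pre spre; apply: leq_trans (_ : SL M (tot adj (Z pre) [::]) <= _).
    apply: SL_le => post _; rewrite take_size_cat // drop_size_cat // [s.+1 * 64]mulnC.
    exact: trunc.
  apply: leq_trans (tot_avg le_nN adj_sym adj_irr _ _ _) _; rewrite leq_mul // pot0 leq_add2r.
  by have := max_card (mem (~: Z pre)); rewrite card_ord.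
rewrite SLM SLD (SL_const le_nN) expnD [N ^ s * N ^ M]mulnC -mulnA [X in _ <= X]mulnCA leq_mul //.
by rewrite mulSn leq_add2l mulnCA.
Qed.

(** On average at most T/2 vertices join, a fraction 2^-8 stays undrawn in [N * 8] draws, and 1/64
    exceeds the row budget; times 256 this is 128T + n + 4n. *)
Lemma sim_out_avg_ge s T : 0 < s -> N <= s * s -> 0 < N ->
  (forall I : {set 'I_n}, (forall u v, u \in I -> v \in I -> ~~ adj u v) -> 2 * #|I| <= T) ->
  N ^ (s + N * 8) * (256 * n) <= 256 * SL (s + N * 8) (fun l =>
      #|[set v | sim_out v (take s l) (drop s l) &
                 size (sim_need v (take s l) (drop s l)) <= s + 64 * s.+1]|) +
    N ^ (s + N * 8) * (128 * T + 5 * n).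
Proof.
move=> s0 le_Ns N0 indT; set Q := s + _.
pose good l := #|[set v | sim_out v (take s l) (drop s l) &
  size (sim_need v (take s l) (drop s l)) <= s + 64 * s.+1]|.
pose trunc l := #|[set v | s + 64 * s.+1 < size (sim_need v (take s l) (drop s l))]|.
pose undrawn l := #|[set v : 'I_n | Some v \notin drop s l]|.
have pt l : 2 * n <= 2 * good l + (T + (2 * undrawn l + 2 * trunc l)).
  have jT : 2 * #|joined adj set0 l| <= T.
    by apply: indT => u v uj vj; apply: (joined_indep adj_sym adj_irr uj vj).
  apply: leq_trans (leq_add (leqnn _) (leq_add jT (leqnn _))); rewrite -!mulnDr leq_mul //.
  rewrite -{1}(card_ord n) -cardsT.
  apply: leq_trans (leq_trans (leq_card_setU _ _) (leq_add (leqnn _) (leq_trans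
    (leq_card_setU _ _) (leq_add (leqnn _) (leq_card_setU _ _))))).
  apply: subset_leq_card; apply/subsetP => v _; rewrite !inE ltnNge.
  have := sim_out_joined v (take s l) (drop s l); rewrite cat_take_drop.
  by case/or3P=> ->; rewrite ?orbT //= ?andbT; case: (_ <= _); rewrite ?orbT.
have und : 256 * SL Q undrawn <= N ^ Q * n.
  have -> : N ^ Q * n = N ^ s * (n * N ^ (N * 8)) by rewrite expnD -mulnA [n * _]mulnC.
  apply: leq_trans (_ : N ^ s * (n * (2 ^ 8 * N.-1 ^ (N * 8))) <= _); last first.
    by rewrite !leq_mul // pow_half_mul.
  rewrite [n * _]mulnCA mulnCA leq_mul // SL_cat -(SL_const le_nN); apply: SL_le => pre spre.
  rewrite (eq_SL _ _ (F' := fun l => \sum_v (Some v \notin l : nat))) => [|l]; last first.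
    rewrite /undrawn drop_size_cat // -sum1dep_card big_mkcond.
    by apply: eq_bigr => v _; case: (_ \notin _).
  rewrite SL_sum -(card_ord n) -sum_nat_const card_ord; apply: leq_sum => v _.
  have := SL_avoid le_nN (N * 8) [set v]; rewrite cards1 subn1 => <-; apply: SL_le => l _.
  rewrite leq_eqVlt; apply/orP; left; apply/eqP; congr (nat_of_bool _).
  elim: l => //= o l IH; rewrite inE negb_or IH; congr (_ && _).
  by case: o => [u|] //; rewrite inE (inj_eq (@Some_inj _)) eq_sym.
have tr := sim_need_avg (N * 8) s0 le_Ns; rewrite -/Q -/trunc in tr.
have := SL_le N (q := Q) (fun l _ => pt l).
rewrite (SL_const le_nN) SLD SLM SLD (SL_const le_nN) SLD !SLM -/good.
move: (SL Q good) (SL Q undrawn) (SL Q trunc) (N ^ Q) und tr => a b c d; clear; nia.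
Qed.

End Average.
End Simulation.

(** * Query programs *)

Section Programs.
Variables (n : nat) (w : dist n).

Definition prog T := (T -> qalg n) -> qalg n.

Definition runs T (p : prog T) (x : T) c := forall k,
  (forall P, success_prob w P (p k) = success_prob w P (k x)) /\
  num_queries w (p k) <= c + num_queries w (k x).

Definition retq T (x : T) : prog T := fun k => k x.
Definition bindq T U (p : prog T) (f : T -> prog U) : prog U := fun k => p (fun x => f x k).
Fixpoint seqq T (ps : seq (prog T)) : prog (seq T) :=
  if ps is p :: ps' then bindq p (fun x => bindq (seqq ps') (fun xs => retq (x :: xs)))
  else retq [::].
Definition hasq (ps : seq (prog bool)) : prog bool := bindq (seqq ps) (fun bs => retq (has id bs)).

Lemma runs_ret T (x : T) c : runs (retq x) x c.
Proof. by move=> k; split=> //; apply: leq_addl. Qed.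

Lemma runs_bind T U (p : prog T) (f : T -> prog U) x y c d :
  runs p x c -> runs (f x) y d -> runs (bindq p f) y (c + d).
Proof.
move=> px fy k; have [p1 p2] := px (fun x => f x k); have [f1 f2] := fy k.
split=> [P|]; first by rewrite p1 f1.
by apply: leq_trans p2 _; rewrite -addnA leq_add2l.
Qed.

Lemma runs_seq T (A : eqType) (f : A -> prog T) (g : A -> T) c l :
  (forall a, a \in l -> runs (f a) (g a) c) -> runs (seqq (map f l)) (map g l) (size l * c).
Proof.
elim: l => [|a l IH] fg; first exact: runs_ret.
rewrite /= mulSn; apply: runs_bind (fg a (mem_head _ _)) _.
rewrite -[X in runs _ _ X]addn0.
have fl : runs (seqq (map f l)) (map g l) (size l * c).
  by apply: IH => b bl; apply: fg; rewrite inE bl orbT.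
exact: runs_bind fl (runs_ret (g a :: map g l) 0).
Qed.

Lemma runs_has (A : eqType) (f : A -> prog bool) (g : pred A) c l :
  (forall a, a \in l -> runs (f a) (g a) c) -> runs (hasq (map f l)) (has g l) (size l * c).
Proof.
move=> fg; rewrite -[X in runs _ _ X]addn0 (_ : has g l = has id (map g l)); last by rewrite has_map.
exact: runs_bind (runs_seq fg) (runs_ret (has id (map g l)) 0).
Qed.

Fixpoint askq (l : seq ('I_n * 'I_n)) : prog (seq nat) :=
  if l is (u, v) :: l' then fun k => Ask u v (fun x => askq l' (fun xs => k (x :: xs)))
  else retq [::].

Lemma runs_ask l : runs (askq l) [seq w uv.1 uv.2 | uv <- l] (size l).
Proof.
by elim: l => [|[u v] l IH] k //=.
Qed.

(** The default 0 is not a unit weight, so unread pairs never look like edges and the visible unit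
    graph is a subgraph of the true one. *)
Definition known (K : {set 'I_n}) : 'M[nat]_n :=
  \matrix_(u, v) (if (u \in K) || (v \in K) then w u v else 0).

Lemma knownE (K : {set 'I_n}) u v : (u \in K) || (v \in K) -> known K u v = w u v.
Proof. by rewrite mxE => ->. Qed.

Lemma known1 K u v : known K u v = 1 -> w u v = 1.
Proof. by rewrite mxE; case: ifP. Qed.

Definition missing (K : {set 'I_n}) l := ohead [seq z <- l | z \notin K].

Lemma missing_cat K l l' :
  missing K (l ++ l') = if missing K l is Some u then Some u else missing K l'.
Proof. by rewrite /missing filter_cat; case: [seq _ <- l | _]. Qed.

Lemma missing_None K l : missing K l = None -> {subset l <= K}.
Proof.
rewrite /missing => miss u ul; apply: contraT => uK.
have : u \in [seq z <- l | z \notin K] by rewrite mem_filter uK.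
by case: [seq _ <- l | _] miss.
Qed.

Lemma missing_Some K l u : missing K l = Some u -> u \notin K /\ u \in l.
Proof.
rewrite /missing => miss; have : u \in [seq z <- l | z \notin K].
  by case: [seq _ <- l | _] miss => //= a l' [->]; rewrite inE eqxx.
by rewrite mem_filter => /andP.
Qed.

Section Loop.
Variables (need : dist n -> seq 'I_n) (out : {set 'I_n} -> dist n -> bool).

(* Read whole rows until every vertex of [need] is known, then evaluate [out]; the answer
   is [false] when more than [fuel] rows are needed. *)
Fixpoint loopq fuel (K : {set 'I_n}) (M : 'M[nat]_n) : prog bool :=
  if missing K (need M) is Some u then
    if fuel is f.+1 then
      bindq (askq [seq (u, v) | v <- enum 'I_n]) (fun xs =>
        loopq f (u |: K) (\matrix_(a, b)
          (if a == u then nth 0 xs b else if b == u then nth 0 xs a else M a b)))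
    else retq false
  else retq (out K M).

Fixpoint ploop fuel K :=
  if missing K (need (known K)) is Some u then
    if fuel is f.+1 then ploop f (u |: K) else false
  else out K (known K).

Hypothesis wS : forall u v, w u v = w v u.

Lemma runs_loop fuel K : runs (loopq fuel K (known K)) (ploop fuel K) (n * fuel).
Proof.
elim: fuel K => [|f IH] K /=; case: (missing K _) => [u|]; try exact: runs_ret.
rewrite mulnS; apply: runs_bind (_ : runs _ [seq w uv.1 uv.2 | uv <- [seq (u, v) | v <- enum 'I_n]] n) _.
  by have := runs_ask [seq (u, v) | v <- enum 'I_n]; rewrite size_map size_enum_ord.
set M := matrix_of_fun _ _; rewrite (_ : M = known (u |: K)) {}/M //; apply/matrixP => a b.
rewrite -map_comp.
have nE (c : 'I_n) : nth 0 [seq ((fun uv => w uv.1 uv.2) \o pair u) v | v <- enum 'I_n] c = w u c.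
  by rewrite (nth_map c) ?size_enum_ord // nth_ord_enum.
rewrite !mxE !nE !inE; case: eqP => [->|_] //=; case: eqP => [->|_] /=; rewrite ?orbT //.
Qed.

Lemma ploop_sound fuel K : ploop fuel K ->
  exists2 K', missing K' (need (known K')) = None & out K' (known K').
Proof.
elim: fuel K => [|f IH] K /=; case miss: (missing K _) => [u|] //; try by exists K.
exact: IH.
Qed.

Lemma ploop_complete (W : seq 'I_n) fuel :
  (forall K u, missing K (need (known K)) = Some u -> u \in W) -> size W <= fuel ->
  exists2 K, missing K (need (known K)) = None & ploop fuel set0 = out K (known K).
Proof.
move=> missW sizeW.
suff main (K : {set 'I_n}) : #|[set u in W | u \notin K]| <= fuel ->
    exists2 K', missing K' (need (known K')) = None & ploop fuel K = out K' (known K').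
  apply: main; apply: leq_trans sizeW; apply: leq_trans (card_size W).
  by apply: subset_leq_card; apply/subsetP => u; rewrite !inE => /andP [].
elim: fuel K {sizeW} => [|f IH] K cW /=; case miss: (missing K _) => [u|]; try by exists K.
  have [uK _] := missing_Some miss; have uW := missW _ _ miss.
  by move: cW; rewrite leqn0 cards_eq0 => /eqP/setP/(_ u); rewrite !inE uW uK.
have [uK _] := missing_Some miss; have uW := missW _ _ miss.
apply: IH; rewrite -ltnS; apply: leq_trans cW; rewrite [X in _ < X](cardsD1 u) !inE uW uK ltnS.
by apply: subset_leq_card; apply/subsetP => v; rewrite !inE negb_or => /and3P [-> -> ->].
Qed.

End Loop.

Fixpoint unifq k : prog nat :=
  if k is k'.+1 then fun c => Flip (fun b => unifq k' (fun i => c (b + i.*2))) else retq 0.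

(** [insub] turns the slots from [n] on into [None], so no rejection sampling is needed. *)
Fixpoint drawq k q : prog (seq (option 'I_n)) :=
  if q is q'.+1 then bindq (unifq k) (fun i => bindq (drawq k q') (fun l => retq (insub i :: l)))
  else retq [::].

Lemma unifq_queries k c B : (forall i, num_queries w (c i) <= B) -> num_queries w (unifq k c) <= B.
Proof. by elim: k c => [|k IH] c cB /=; [apply: cB | rewrite geq_max !IH]. Qed.

Lemma drawq_queries k q c B :
  (forall l, size l = q -> num_queries w (c l) <= B) -> num_queries w (drawq k q c) <= B.
Proof.
elim: q c => [|q IH] c cB /=; first exact: cB.
by apply: unifq_queries => i; apply: IH => l sl; apply: cB; rewrite /= sl.
Qed.

Local Open Scope ring_scope.

Lemma unifq_success k P c :
  success_prob w P (unifq k c) = (\sum_(i < 2 ^ k) success_prob w P (c i)) / (2 ^ k)%:R.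
Proof.
elim: k c => [|k IH] c /=; first by rewrite big_ord1 divr1.
rewrite !IH -mulrDl expnS natrM invfM -mulrA [_^-1 * 2^-1]mulrC; congr (_ * _).
rewrite -!(big_mkord xpredT (fun i => success_prob w P (c i))) mul2n.
rewrite -(big_mkord xpredT (fun i => success_prob w P (c (1 + i.*2)%N))).
rewrite -(big_mkord xpredT (fun i => success_prob w P (c (0 + i.*2)%N))).
elim: (2 ^ k)%N => [|m IHm]; first by rewrite !big_geq ?addr0.
by rewrite doubleS !big_nat_recr //= -IHm; ring.
Qed.

Lemma drawq_success k q P c f : (n <= 2 ^ k)%N ->
  (forall l, size l = q -> success_prob w P (c l) = (f l)%:R) ->
  success_prob w P (drawq k q c) = (SL (2 ^ k) q f)%:R / ((2 ^ k) ^ q)%:R.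
Proof.
move=> le_n; elim: q c f => [|q IH] c f cf /=; first by rewrite divr1 cf.
rewrite /bindq unifq_success (eq_bigr (fun i : 'I__ =>
  (SL (2 ^ k) q (fun l => f (insub (val i) :: l)))%:R / ((2 ^ k) ^ q)%:R)); last first.
  by move=> i _; apply: IH => l sl; apply: cf; rewrite /= sl.
rewrite -mulr_suml expnSr natrM invfM [RHS]mulrA; congr (_ / _ / _).
rewrite -natr_sum; congr _%:R.
rewrite -(big_mkord xpredT (fun i => SL (2 ^ k) q (fun l => f (insub i :: l)))).
rewrite (big_cat_nat (leq0n n) le_n) /= big_mkord; congr (_ + _)%N.
  by apply: eq_bigr => v _; apply: eq_SL => l; rewrite valK.
rewrite -[RHS]sum_nat_const_nat; apply: eq_big_nat => i /andP [le_i _].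
by apply: eq_SL => l; rewrite insubN // -leqNgt.
Qed.

End Programs.

Section Agree.
Variables (n : nat) (adj adj' : rel 'I_n) (K : {set 'I_n}).
Hypothesis agree : forall u v, u \in K -> adj' u v = adj u v.

Let gstep_agree Z o : (if o is Some u then u \in K else true) -> gstep adj' Z o = gstep adj Z o.
Proof.
by case: o => [u uK|] //=; congr (if _ then _ else _ :|: (_ |: _)); apply/setP => v; rewrite !inE agree.
Qed.

Lemma grun_agree Z l : {subset pmap id l <= K} -> grun adj' Z l = grun adj Z l.
Proof.
elim: l Z => [|o l IH] Z //= sub; rewrite gstep_agree.
  by apply: IH => u ul; apply: sub; case: o => [a|] //=; rewrite inE ul orbT.
by case: o sub => [a|] //= sub; apply: sub; rewrite inE eqxx.
Qed.

Lemma joined_agree Z l : {subset pmap id l <= K} -> joined adj' Z l = joined adj Z l.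
Proof.
elim: l Z => [|o l IH] Z //= sub; rewrite gstep_agree.
  by rewrite IH // => u ul; apply: sub; case: o => [a|] //=; rewrite inE ul orbT.
by case: o sub => [a|] //= sub; apply: sub; rewrite inE eqxx.
Qed.

Lemma vis_self (e : rel 'I_n) P0 r v : v \in vis e P0 r v.
Proof. by elim: r => [|o r IH] /=; rewrite ?inE // mem_cat IH. Qed.

(** The recursion on partial data runs exactly as the true one until it meets its first unread row;
    that row is therefore in the true list too, which bounds the number of rows ever requested. *)
Lemma vis_agree P0 r v :
  (missing K (vis adj' P0 r v) = None -> alP adj' P0 r v = alP adj P0 r v) /\
  (forall u, missing K (vis adj' P0 r v) = Some u -> u \in vis adj P0 r v).
Proof.
elim: r v => [|o r IH] v /=; first by split=> // u /missing_Some [_].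
have [al_v miss_v] := IH v; rewrite missing_cat; case miss: (missing K _) => [u|]; split=> //.
- by move=> _ [<-]; rewrite mem_cat miss_v.
- have vK : v \in K by apply: (missing_None miss); apply: vis_self.
  rewrite al_v //; case: o => [a|] //=; rewrite agree //.
  case: (alP adj P0 r v) => //=; case: (active P0 r a) => //=; case: (adj v a) => //= missa.
  by have [-> //] := IH a.
- have vK : v \in K by apply: (missing_None miss); apply: vis_self.
  rewrite al_v //; case: o => [a|] //=; rewrite agree // => u; rewrite mem_cat.
  by case: ifP => // _ /(proj2 (IH a)) ->; rewrite orbT.
Qed.

Lemma sim_out_agree v pre post : missing K (sim_need adj' v pre post) = None ->
  sim_out adj' v pre post = sim_out adj v pre post.
Proof.
rewrite /sim_need missing_cat; case miss: (missing K _) => [//|].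
have sub := missing_None miss; rewrite /sim_out grun_agree // joined_agree //.
case: (v \in grun adj set0 pre) => //=; case: (Some v \in post) => //= missv.
by rewrite (proj1 (vis_agree _ _ _)).
Qed.

Lemma sim_need_agree v pre post u : missing K (sim_need adj' v pre post) = Some u ->
  u \in sim_need adj v pre post.
Proof.
rewrite /sim_need missing_cat mem_cat; case miss: (missing K _) => [a|].
  by case=> <-; have [_ ->] := missing_Some miss.
rewrite grun_agree; last exact: missing_None miss.
by case: ifP => // _ /(proj2 (vis_agree _ _ _)) ->; rewrite orbT.
Qed.

End Agree.

Lemma ball_mono (T : finType) (e e' : rel T) x i : subrel e e' -> ball e x i \subset ball e' x i.
Proof.
move=> sub; elim: i => [|i IH]; first by apply/subsetP => y; rewrite !ball0.
apply/subsetP => y /ballSP [/(subsetP IH)|[u /(subsetP IH) u1 /sub uy]].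
  by apply: (subsetP (ball_sub _ _ (leqnSn i))).
exact: ball_step u1 uy.
Qed.

(** * The greedy test as a query program *)

Section TestB.
Variables (n : nat) (w : dist n).
Hypothesis wM : pos_int_metric w.
Definition unit_rel (m : dist n) : rel 'I_n := fun u v => m u v == 1.

Variables (s : nat).

Definition simB v (l : seq (option 'I_n)) (m : dist n) := sim_need (unit_rel m) v (take s l) (drop s l).
Definition outB v (l : seq (option 'I_n)) (K : {set 'I_n}) (m : dist n) :=
  sim_out (unit_rel m) v (take s l) (drop s l).

Definition testB (l : seq (option 'I_n)) :=
  if l is Some v :: l' then ploop w (simB v l') (outB v l') (s + 64 * s.+1) set0 else false.

Definition testBq (l : seq (option 'I_n)) : prog n bool :=
  if l is Some v :: l' then loopq (simB v l') (outB v l') (s + 64 * s.+1) set0 (\matrix_(u, v) 0)%R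
  else retq false.

Let known_agree (K : {set 'I_n}) u v : u \in K -> unit_rel (known w K) u v = unit_rel w u v.
Proof. by move=> uK; rewrite /unit_rel knownE ?uK. Qed.

Lemma known0 : known w set0 = (\matrix_(u, v) 0)%R.
Proof. by apply/matrixP => u v; rewrite !mxE !inE. Qed.

Lemma runs_testB l : runs w (testBq l) (testB l) (n * (s + 64 * s.+1)).
Proof.
case: l => [|[v|] l] /=; try exact: runs_ret.
by rewrite -known0; apply: runs_loop; case: wM.
Qed.

Lemma testB_out v l : testB (Some v :: l) -> sim_out (unit_rel w) v (take s l) (drop s l).
Proof.
case/ploop_sound=> K miss; rewrite /outB (sim_out_agree (adj := unit_rel w) (K := K)) //.
exact: known_agree.
Qed.

Lemma out_testB v l : size (simB v l w) <= s + 64 * s.+1 ->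
  sim_out (unit_rel w) v (take s l) (drop s l) -> testB (Some v :: l).
Proof.
move=> le_size out_v.
have [|K miss] := ploop_complete (w := w) (need := simB v l) (outB v l) (W := simB v l w) _ le_size.
  by move=> K u; apply: sim_need_agree; apply: known_agree.
rewrite /= => ->; rewrite /outB (sim_out_agree (adj := unit_rel w) (K := K)) //.
exact: known_agree.
Qed.

Variable N : nat.
Hypothesis le_nN : n <= N.

Let uS : symmetric (unit_rel w). Proof. by move=> u v; rewrite /unit_rel; have [_ _ ->] := wM. Qed.
Let uI : irreflexive (unit_rel w). Proof. by move=> u; rewrite /unit_rel; have [->] := wM. Qed.

Let testB_sum q : SL N q.+1 (fun l => testB l : nat) =
  SL N q (fun l => #|[set v | testB (Some v :: l)]|).
Proof.
rewrite /= S1_SL; apply: eq_SL => l; rewrite /S1 /= muln0 addn0 -sum1dep_card [RHS]big_mkcond.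
by apply: eq_bigr => v _; case: ploop.
Qed.

Lemma testB_rare M (C : {set 'I_n}) :
  (forall u v, u \notin C -> v \notin C -> ~~ unit_rel w u v) ->
  SL N (s + M).+1 (fun l => testB l : nat) <= N ^ (s + M) * (2 * #|C|).
Proof.
move=> covC; apply: leq_trans (sim_out_avg_le uS le_nN s M covC).
rewrite testB_sum; apply: SL_le => l _; apply: subset_leq_card; apply/subsetP => v.
by rewrite !inE => /testB_out.
Qed.

Lemma testB_often : 1 < n -> 0 < s -> N <= s * s ->
  N ^ (s + N * 8) * (256 * n) <= 256 * SL N (s + N * 8).+1 (fun l => testB l : nat) +
    N ^ (s + N * 8) * (128 * TSP w + 5 * n).
Proof.
move=> n1 s0 le_Ns; have N0 : 0 < N by apply: leq_trans le_nN; apply: ltnW.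
apply: leq_trans (sim_out_avg_ge uS uI le_nN s0 le_Ns N0 (T := TSP w) _) _.
  by move=> I indI; apply: TSP_indep => // u v uI' vI'; apply: indI.
rewrite leq_add2r leq_mul // testB_sum; apply: SL_le => l _; apply: subset_leq_card.
apply/subsetP => v; rewrite !inE => /andP [out_v le_v]; exact: out_testB.
Qed.

End TestB.

(** * The bridge test as a query program *)

Section TestA.
Variables (n : nat) (w : dist n) (r0 : 'I_n).
Hypothesis wM : pos_int_metric w.
Hypothesis conn : forall u v, connect (fun u v => w u v == 1) u v.
Variables (s D fuel : nat).
Hypothesis s0 : 0 < s.
Implicit Types (m : dist n) (K R : {set 'I_n}) (l : seq (option 'I_n)).

Definition nbr m x j : option 'I_n := nth None [seq Some z | z <- enum [set z | m x z == 1]] j.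

(** The row of [x] precedes the ball, so the ball is requested only once the [j]-th neighbour is the
    true one. *)
Definition needA R x j m :=
  enum R ++ x :: (if nbr m x j is Some v then enum (cball m x v (10 * s)) else [::]).
Definition outA R x j K m :=
  if nbr m x j is Some v then ~~ connect (allowed m K R s x v) x r0 else false.

Definition drawn l : {set 'I_n} := r0 |: [set v | Some v \in l].

Definition testA l := if l is Some x :: l' then
    has (fun j => ploop w (needA (drawn l') x j) (outA (drawn l') x j) fuel set0) (iota 0 D)
  else false.

Definition testAq l : prog n bool := if l is Some x :: l' then
    hasq [seq loopq (needA (drawn l') x j) (outA (drawn l') x j) fuel set0 (\matrix_(u, v) 0)%R
         | j <- iota 0 D]
  else retq false.

Lemma runs_testA l : runs w (testAq l) (testA l) (D * (n * fuel)).
Proof.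
case: l => [|[x|] l] /=; try exact: runs_ret.
rewrite -{3}(size_iota 0 D); apply: runs_has => j _.
by rewrite -(known0 w); apply: runs_loop; case: wM.
Qed.

Lemma adj_nbr m x v : m x v = 1 -> exists2 j, j < #|[set z | m x z == 1]| & nbr m x j = Some v.
Proof.
move=> xv; have vN : v \in enum [set z | m x z == 1] by rewrite mem_enum inE xv.
exists (index v (enum [set z | m x z == 1])); first by rewrite cardE index_mem.
by rewrite /nbr (nth_map v) ?index_mem // nth_index.
Qed.

Section Known.
Variables (K R : {set 'I_n}) (x v : 'I_n).
Local Notation m := (known w K).

Let cut_known a b : (a \in K) || (b \in K) -> cut m x v a b = cut w x v a b.
Proof. by move=> ab; rewrite /cut knownE. Qed.

Let cut_sub : subrel (cut m x v) (cut w x v).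
Proof. by move=> a b /and3P [/eqP/known1 ab c d]; rewrite /cut ab c d. Qed.

Lemma cball_known_sub i : cball m x v i \subset cball w x v i.
Proof. exact: ball_mono. Qed.

Lemma cball_known i : cball m x v i \subset K -> forall j, j <= i -> cball m x v j = cball w x v j.
Proof.
move=> sub j; elim: j => [|j IH] lt_j; first by apply/setP => y; rewrite !ball0.
have {}IH := IH (ltnW lt_j); apply/eqP; rewrite eqEsubset cball_known_sub /=.
apply/subsetP => y /ballSP; rewrite -/(cball w x v j) -IH => [[yj|[u uj uy]]].
  exact: (subsetP (ball_sub _ _ (leqnSn j))).
apply: ball_step (uj) _; rewrite cut_known // (subsetP sub) //.
by apply: (subsetP (ball_sub _ _ (ltnW lt_j))).
Qed.

Hypotheses (RK : R \subset K) (BK : cball m x v (10 * s) \subset K).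

Lemma hop_known j : hop m R s x j = hop w R s x j.
Proof.
elim: j => [|j IH].
  apply/setP => r; rewrite !inE; case: (boolP (r \in R)) => //= rR.
  by rewrite knownE ?(subsetP RK r rR) ?orbT.
rewrite /hop !iterS -/(hop m R s x j) -/(hop w R s x j) IH; congr (_ :|: _).
apply/setP => r; rewrite !inE; case: (boolP (r \in R)) => //= rR.
by apply: eq_existsb => t; rewrite knownE ?(subsetP RK r rR) ?orbT.
Qed.

Lemma allowed_known : allowed m K R s x v =2 allowed w K R s x v.
Proof.
move=> a b; rewrite /allowed; case: (boolP ((a \in K) || (b \in K))) => // ab.
rewrite !andTb cut_known // knownE // hop_known.
by case: (leqP _ (10 * s)) => // le_w; rewrite (cball_known BK).
Qed.

End Known.

Lemma missA_None K R x j : missing K (needA R x j (known w K)) = None ->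
  [/\ R \subset K, nbr (known w K) x j = nbr w x j,
      outA R x j K (known w K) = outA R x j K w &
      forall v, nbr w x j = Some v -> cball w x v (10 * s) \subset K].
Proof.
move=> /missing_None miss.
have RK : R \subset K by apply/subsetP => u uR; apply: miss; rewrite mem_cat mem_enum uR.
have xK : x \in K by apply: miss; rewrite mem_cat inE eqxx orbT.
have nE : nbr (known w K) x j = nbr w x j.
  rewrite /nbr (_ : [set z | _] = [set z | w x z == 1]) //.
  by apply/setP => z; rewrite !inE knownE ?xK.
have BK v : nbr w x j = Some v -> cball (known w K) x v (10 * s) \subset K.
  move=> nv; apply/subsetP => u uB; apply: miss; rewrite /needA nE nv mem_cat inE.
  by rewrite [u \in enum (cball _ _ _ _)]mem_enum uB !orbT.
split=> // [|v nv]; last by rewrite -(cball_known (BK v nv)) ?BK.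
rewrite /outA nE; case nv: (nbr w x j) => [v|] //; congr (~~ _).
exact: eq_connect (allowed_known RK (BK v nv)) _ _.
Qed.

Lemma missA_Some K R x j u : missing K (needA R x j (known w K)) = Some u -> u \in needA R x j w.
Proof.
rewrite /needA -cat_rcons missing_cat; case miss: (missing K (rcons _ _)) => [a|].
  by case=> <-; have [_ aR] := missing_Some miss; rewrite -cat_rcons mem_cat aR.
have xK : x \in K by apply: (missing_None miss); rewrite mem_rcons inE eqxx.
have nE : nbr (known w K) x j = nbr w x j.
  rewrite /nbr (_ : [set z | _] = [set z | w x z == 1]) //.
  by apply/setP => z; rewrite !inE knownE ?xK.
rewrite nE; case: (nbr w x j) => [v|] // /missing_Some [_]; rewrite mem_enum => uB.
by rewrite -cat_rcons mem_cat mem_enum (subsetP (cball_known_sub _ _ _ _) u uB) orbT.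
Qed.

Definition hitsb R := [forall x, forall v, forall p, (s < #|ball (cut w x v) p s|) ==>
  [exists r in R, r \in ball (cut w x v) p s]].

Lemma hitsbP R : hitsb R -> hits_balls w s R.
Proof.
move=> /forallP h x v p big_p; have /forallP /(_ v) /forallP /(_ p) /implyP /(_ big_p) := h x.
by case/exists_inP=> r; exists r.
Qed.

Lemma testA_few l : 2 < n -> hitsb (drawn l) ->
  #|[set x | testA (Some x :: l)]| + 152 * n <= 152 * TSP w.
Proof.
move=> n2 /hitsbP hit; set R := drawn l; set Q := [set x | _].
have r0R : r0 \in R by rewrite !inE eqxx.
(* A passing run only provides some neighbour and some set of rows; one such neighbour is fixed for
   each [x]. *)
pose ev x v (K : {set 'I_n}) := [&& R \subset K, cball w x v (10 * s) \subset K &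
  ~~ connect (allowed w K R s x v) x r0].
pose v x := odflt x [pick v | [exists K, ev x v K]].
have vP x : x \in Q -> exists K, ev x (v x) K.
  rewrite inE => /hasP [j _ /ploop_sound [K miss]].
  have [RK nE -> BK] := missA_None miss; rewrite /outA.
  case nv: (nbr w x j) => [a|] // bad; rewrite /v; case: pickP => [b /existsP //|/(_ a)].
  by case/existsP; exists K; rewrite /ev RK BK.
apply: (bad_card wM conn s0 (R := R) (v := v)) n2.
- move=> x /vP [K /and3P [RK BK bad]].
  exact: (bad_head wM conn s0 r0R hit RK BK bad).
- move=> x /vP [K /and3P [RK BK bad]] a b.
  exact: (bad_crossing wM conn s0 r0R hit RK BK bad).
- move=> x /vP [K /and3P [RK BK bad]] a b.
  exact: (bad_crossing_far wM conn s0 r0R hit RK BK bad).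
Qed.

Lemma card_drawn l : #|drawn l| <= (size l).+1.
Proof.
rewrite /drawn cardsU1 -add1n; apply: leq_add; first by case: (_ \notin _).
apply: leq_trans (_ : #|pmap id l| <= _).
  apply: subset_leq_card; apply/subsetP => v; rewrite inE => vl.
  by rewrite mem_pmap map_id.
by apply: leq_trans (card_size _) _; rewrite size_pmap count_size.
Qed.

Lemma testA_good par dep Nn l x :
  rtree (fun u v => w u v == 1) r0 par dep -> dfs_like (fun u v => w u v == 1) par ->
  (size l).+2 + Nn <= fuel -> hitsb (drawn l) ->
  x \in good_heads w r0 par dep D (10 * s) Nn -> testA (Some x :: l).
Proof.
move=> tr norm le_fuel /hitsbP hit xg; have deg_x := good_head_deg wM tr norm xg.
move: xg; rewrite [_ \in good_heads _ _ _ _ _ _ _]in_set => /and4P [/headsP [x_r0 xBy pxBy] _ _ small].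
have r0R : r0 \in drawn l by rewrite !inE eqxx.
have xp : w x (par x) = 1 by have [_ _ /(_ x x_r0) [/eqP]] := tr.
have [j lt_j nj] := adj_nbr xp; apply/hasP; exists j; first by rewrite mem_iota (leq_trans lt_j).
have le_W : size (needA (drawn l) x j w) <= fuel.
  apply: leq_trans le_fuel; rewrite /needA nj size_cat /= -!cardE addnS addSn ltnS.
  by rewrite leq_add // card_drawn.
have [|K miss ->] := ploop_complete (w := w) (need := needA (drawn l) x j) (outA (drawn l) x j)
  (W := needA (drawn l) x j w) _ le_W; first by move=> K u; apply: missA_Some.
 have [_ _ -> _] := missA_None miss; rewrite /outA nj.
exact: (unbypassed_bad wM tr norm x_r0 xBy pxBy K s0 (hits_cover wM conn r0R hit)).
Qed.

Variable N : nat.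
Hypothesis le_nN : n <= N.

(** Union bound over the triples of a cut pair and a centre. *)
Lemma hits_avg q : SL N q (fun l => ~~ hitsb (drawn l) : nat) <= n ^ 3 * (N - s) ^ q.
Proof.
pose B (t : 'I_n * 'I_n * 'I_n) := ball (cut w t.1.1 t.1.2) t.2 s.
pose av t (l : seq (option 'I_n)) :=
  all (fun o => if o is Some v then v \notin B t else true) l.
apply: (@leq_trans (SL N q (fun l => \sum_t ((s < #|B t|) && av t l : nat)))).
  apply: SL_le => l _; case: (boolP (hitsb _)) => //=.
  case/forallPn=> x /forallPn [v /forallPn [p]]; rewrite negb_imply => /andP [big_p nohit].
  rewrite (bigD1 (x, v, p)) //= (_ : av _ _ = true) ?big_p //; apply/allP => [[a|]] // al.
  by apply: contra nohit => aB; apply/exists_inP; exists a; rewrite // !inE al orbT.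
rewrite SL_sum; apply: leq_trans (_ : \sum_(t : 'I_n * 'I_n * 'I_n) (N - s) ^ q <= _).
  apply: leq_sum => t _; case: (ltnP s #|B t|) => [big_t|_]; last first.
    by rewrite (eq_SL _ _ (F' := fun=> 0)) // SL_const // muln0.
  rewrite SL_avoid //; case: q => [//|q].
  by rewrite leq_exp2r // leq_sub2l // ltnW.
by rewrite sum_nat_const !card_prod card_ord !expnSr mul1n.
Qed.

Let testA_sum q : SL N q.+1 (fun l => testA l : nat) =
  SL N q (fun l => #|[set x | testA (Some x :: l)]|).
Proof.
rewrite /= S1_SL; apply: eq_SL => l; rewrite /S1 /= muln0 addn0 -sum1dep_card [RHS]big_mkcond.
by apply: eq_bigr => v _; case: has.
Qed.

Lemma testA_rare q : 2 < n -> SL N q.+1 (fun l => testA l : nat) + N ^ q * (152 * n) <=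
  n * SL N q (fun l => ~~ hitsb (drawn l) : nat) + N ^ q * (152 * TSP w).
Proof.
move=> n2; rewrite testA_sum -!(SL_const le_nN) -SLM -!SLD; apply: SL_le => l _.
case: (boolP (hitsb (drawn l))) => [hit|_]; first by rewrite muln0; apply: testA_few.
rewrite muln1 leq_add // ?leq_mul ?TSP_ge_n //; last exact: ltnW.
by have := max_card (mem [set x | testA (Some x :: l)]); rewrite card_ord.
Qed.

Lemma testA_often par dep Nn q :
  rtree (fun u v => w u v == 1) r0 par dep -> dfs_like (fun u v => w u v == 1) par ->
  q.+2 + Nn <= fuel ->
  N ^ q * #|good_heads w r0 par dep D (10 * s) Nn| <=
  SL N q.+1 (fun l => testA l : nat) + n * SL N q (fun l => ~~ hitsb (drawn l) : nat).
Proof.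
move=> tr norm le_fuel; rewrite testA_sum -(SL_const le_nN) -SLM -SLD; apply: SL_le => l sl.
case: (boolP (hitsb (drawn l))) => [hit|_].
  rewrite muln0 addn0; apply: subset_leq_card; apply/subsetP => x xg; rewrite inE.
  by apply: testA_good xg; rewrite ?sl.
rewrite muln1; apply: leq_trans (leq_addl _ _).
by have := max_card (mem (good_heads w r0 par dep D (10 * s) Nn)); rewrite card_ord.
Qed.

End TestA.

(** * Amplification *)

Section Blocks.
Variables (n N : nat).
Hypothesis le_nN : n <= N.
Local Notation L := (seq (option 'I_n)).
Local Notation SL := (SL N).

Fixpoint blk k q (l : L) := if k is k'.+1 then take q l :: blk k' q (drop q l) else [::].

Lemma size_blk k q l : size (blk k q l) = k.
Proof. by elim: k l => //= k IH l; rewrite IH. Qed.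

Lemma eq_SL_size q (F F' : L -> nat) : (forall l, size l = q -> F l = F' l) -> SL q F = SL q F'.
Proof. by move=> eF; apply/eqP; rewrite eqn_leq !SL_le // => l sl; rewrite eF. Qed.

Lemma SL_blk k q (f : L -> nat) : SL (k * q) (fun l => \prod_(b <- blk k q l) f b) = SL q f ^ k.
Proof.
elim: k => [|k IH] /=; first by rewrite big_nil.
rewrite SL_cat expnS mulnC -SLM -IH; apply: eq_SL_size => l sl; rewrite mulnC -SLM.
by apply: eq_SL => l'; rewrite big_cons take_size_cat // drop_size_cat.
Qed.

Lemma SL_neg q (T : pred L) : SL q (fun l => ~~ T l : nat) + SL q (fun l => T l : nat) = N ^ q.
Proof.
by rewrite -SLD -[RHS]muln1 -(SL_const le_nN); apply: eq_SL => l; case: (T l).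
Qed.

Lemma SL_none k q (T : pred L) :
  SL (k * q) (fun l => ~~ has T (blk k q l) : nat) = SL q (fun l => ~~ T l : nat) ^ k.
Proof.
rewrite -SL_blk; apply: eq_SL => l; elim: (blk k q l) => [|b bs IH]; first by rewrite big_nil.
by rewrite big_cons /= negb_or -IH; case: (T b) => //=; rewrite mul1n.
Qed.

Lemma SL_some k q (T : pred L) :
  SL (k * q) (fun l => has T (blk k q l) : nat) * N ^ q <= k * SL q (fun l => T l : nat) * N ^ (k * q).
Proof.
elim: k => [|k IH] /=; first by rewrite !mul0n.
have step : SL (k.+1 * q) (fun l => has T (blk k.+1 q l) : nat) <=
    N ^ (k * q) * SL q (fun l => T l : nat) + N ^ q * SL (k * q) (fun l => has T (blk k q l) : nat).
  rewrite mulSn SL_cat -SLM -(SL_const le_nN) -SLD; apply: SL_le => l sl.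
  rewrite -(SL_const le_nN) -SLD; apply: SL_le => l' _.
  by rewrite /= take_size_cat // drop_size_cat //; case: (T l); case: (has _ _).
apply: leq_trans (leq_mul step (leqnn _)) _; rewrite mulSn expnD.
move: (SL q _) (SL (k * q) _) (N ^ q) (N ^ (k * q)) IH => p h a b; clear; nia.
Qed.

(** Exponential moment: if [T] holds in at least half of the blocks, then 4^k <= 16^count, while
    16^T averages at most 1 + 15/16 <= 2 per block. *)
Lemma SL_majority k q (T : pred L) : 16 * SL q (fun l => T l : nat) <= N ^ q ->
  2 ^ k * SL (k * q) (fun l => (k <= 2 * count T (blk k q l)) : nat) <= N ^ (k * q).
Proof.
move=> small; rewrite -(leq_pmul2l (expn_gt0 2 k : 0 < 2 ^ k)) mulnA -expnMn -SLM.
apply: leq_trans (_ : SL (k * q) (fun l => \prod_(b <- blk k q l) 16 ^ T b) <= _).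
  apply: SL_le => l _; rewrite -expn_sum.
  have -> : \sum_(b <- blk k q l) T b = count T (blk k q l).
    by elim: (blk k q l) => [|b s IH]; rewrite ?big_nil // big_cons IH.
  case: (leqP k) => [le_k|_]; last by rewrite muln0.
  by rewrite muln1 (_ : 16 = 4 ^ 2) // -expnM leq_exp2l.
rewrite SL_blk [k * q]mulnC expnM -expnMn; case: k => // k; rewrite leq_exp2r //.
rewrite (eq_SL _ _ (F' := fun l => 1 + 15 * (T l : nat))) => [|l]; last by case: (T l).
rewrite SLD SLM (SL_const le_nN); move: small; move: (SL q _) (N ^ q) => a b; clear; lia.
Qed.

Section Accept.
Variables (TA TB : pred L) (mA qA mB qB : nat).

(** Acceptance claims a cheap tour: no run of the bridge test succeeds and some run of the greedy
    test does. *)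
Definition accept l :=
  ~~ has TA (blk mA qA (take (mA * qA) l)) && has TB (blk mB qB (drop (mA * qA) l)).

Let split_sum (P P' : pred L) :
  SL (mA * qA + mB * qB) (fun l => P (take (mA * qA) l) + P' (drop (mA * qA) l)) =
  SL (mA * qA) (fun l => P l : nat) * N ^ (mB * qB) +
  N ^ (mA * qA) * SL (mB * qB) (fun l => P' l : nat).
Proof.
rewrite SL_cat [SL _ (fun l => P l : nat) * _]mulnC -SLM -(SL_const le_nN) -SLD; apply: eq_SL_size => l sl.
rewrite -(SL_const le_nN) -SLD; apply: eq_SL => l'.
by rewrite take_size_cat // drop_size_cat.
Qed.

Lemma accept_yes : 0 < N ->
  32 * mA * SL qA (fun l => TA l : nat) <= N ^ qA ->
  32 * SL qB (fun l => ~~ TB l : nat) ^ mB <= N ^ (mB * qB) ->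
  16 * SL (mA * qA + mB * qB) (fun l => ~~ accept l : nat) <= N ^ (mA * qA + mB * qB).
Proof.
move=> N0 hA hB; have := SL_some mA qA TA; rewrite -SL_none in hB.
have N1 : 0 < N ^ qA by rewrite expn_gt0 N0.
have := split_sum (fun l => has TA (blk mA qA l)) (fun l => ~~ has TB (blk mB qB l)).
have : SL (mA * qA + mB * qB) (fun l => ~~ accept l : nat) <=
    SL (mA * qA + mB * qB) (fun l => has TA (blk mA qA (take (mA * qA) l)) +
      ~~ has TB (blk mB qB (drop (mA * qA) l))).
  by apply: SL_le => l _; rewrite /accept; case: (has TA _); case: (has TB _).
move=> le_acc eq_sum; rewrite eq_sum in le_acc => hasA.
suff hasA' : 32 * SL (mA * qA) (fun l => has TA (blk mA qA l) : nat) <= N ^ (mA * qA).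
  move: le_acc hasA' hB; rewrite expnD.
  move: (SL (mA * qA + _) _) (SL (mA * qA) _) (SL (mB * qB) _) => x y z.
  by move: (N ^ (mA * qA)) (N ^ (mB * qB)) => a b; clear; nia.
rewrite -(leq_pmul2r N1) -mulnA; apply: leq_trans (leq_mul (leqnn 32) hasA) _.
by rewrite !mulnA [X in _ <= X]mulnC leq_mul.
Qed.

Lemma accept_noA : 16 * SL qA (fun l => ~~ TA l : nat) ^ mA <= N ^ (mA * qA) ->
  16 * SL (mA * qA + mB * qB) (fun l => accept l : nat) <= N ^ (mA * qA + mB * qB).
Proof.
rewrite -SL_none => hA; have := split_sum (fun l => ~~ has TA (blk mA qA l)) xpred0.
rewrite (SL_const le_nN) /= !muln0 addn0 => eq_sum; rewrite expnD.
apply: leq_trans (leq_mul hA (leqnn _)); rewrite -mulnA -eq_sum leq_mul //; apply: SL_le => l _.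
by rewrite /accept; case: (has TA _); case: (has TB _).
Qed.

Lemma accept_noB : 0 < N -> 16 * mB * SL qB (fun l => TB l : nat) <= N ^ qB ->
  16 * SL (mA * qA + mB * qB) (fun l => accept l : nat) <= N ^ (mA * qA + mB * qB).
Proof.
move=> N0 hB; have N1 : 0 < N ^ qB by rewrite expn_gt0 N0.
have := split_sum xpred0 (fun l => has TB (blk mB qB l)).
rewrite (SL_const le_nN) /= muln0 mul0n add0n => eq_sum; rewrite expnD.
apply: leq_trans (_ : N ^ (mA * qA) * (16 * SL (mB * qB) (fun l => has TB (blk mB qB l) : nat)) <= _).
  rewrite mulnCA -eq_sum leq_mul //; apply: SL_le => l _.
  by rewrite /accept; case: (has TA _); case: (has TB _).
rewrite leq_mul // -(leq_pmul2r N1) -mulnA.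
apply: leq_trans (leq_mul (leqnn 16) (SL_some mB qB TB)) _.
by rewrite !mulnA [X in _ <= X]mulnC leq_mul.
Qed.

End Accept.
End Blocks.

(** From N <= s^2 follows 1 - s/N <= 1 - 1/s. *)
Lemma pow_sub_half N s : 0 < s -> N <= s * s -> 2 * (N - s) ^ s <= N ^ s.
Proof.
move=> s0 le_N; have s1 : 0 < s ^ s by rewrite expn_gt0 s0.
rewrite -(leq_pmul2r s1) -mulnA -expnMn.
apply: leq_trans (_ : 2 * (N * s.-1) ^ s <= _).
  by rewrite leq_mul // leq_exp2r //; move: s0 le_N; clear; nia.
by rewrite expnMn mulnCA leq_mul // pow_half.
Qed.

Lemma pow_amplify a e x y : 0 < a -> a * x <= a.-1 * y -> 2 ^ e * x ^ (a * e) <= y ^ (a * e).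
Proof.
move=> a0 le_xy; have a1 : 0 < a ^ (a * e) by rewrite expn_gt0 a0.
rewrite -(leq_pmul2l a1) mulnCA -expnMn.
case: e {a1} => [|e]; first by rewrite muln0.
apply: leq_trans (_ : 2 ^ e.+1 * (a.-1 * y) ^ (a * e.+1) <= _).
  by rewrite leq_mul // leq_exp2r // muln_gt0 a0.
by rewrite expnMn mulnA leq_mul // pow_half_mul.
Qed.

(** * One block of tests and its constants *)

Section Block.
Variables (H c k s n : nat) (w : dist n) (r0 : 'I_n).
Local Notation N := (2 ^ k).

(* 1/H is the threshold density of inner vertices; each test has constant success
   probability, and mA, mB repetitions bring the error of a block below 1/16. *)
Definition nslots := s * (k * (3 + c)).
(** Chosen so that the Markov loss n(10s+1)/(nearmax+1) equals n/(4H). *)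
Definition nearmax := (4 * H * (10 * s).+1).-1.
Definition rowsA := nslots.+2 + nearmax.
Definition TA := testA w r0 s (4 * H) rowsA.
Definition TB := testB w s.
Definition qA := nslots.+1.
Definition qB := (s + N * 8).+1.
Definition mA := 64 * H.
Definition mB := 8 * 5.

Hypotheses (wM : pos_int_metric w) (conn : forall u v, connect (fun u v => w u v == 1) u v).
Hypotheses (n2 : 2 < n) (le_nN : n <= N) (le_N2n : N <= 2 * n) (s0 : 0 < s) (le_Ns : N <= s * s).
Hypotheses (H_big : 16 * (2 * mB) <= H) (c_big : 64 * mA <= N ^ c).

Let N0 : 0 < N. Proof. exact: leq_trans (ltnW (ltnW n2)) le_nN. Qed.

Let miss := SL N nslots (fun l => ~~ hitsb w s (drawn r0 l) : nat).

(** Each of at most N^3 balls is missed with probability at most 2^-(k(3+c)) = N^-(3+c). *)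
Let miss_small : N ^ c * miss <= N ^ nslots.
Proof.
apply: leq_trans (_ : N ^ (3 + c) * (N - s) ^ nslots <= _).
  rewrite expnD -mulnA mulnCA leq_mul // (leq_trans (hits_avg w r0 s le_nN nslots)) //.
  by rewrite leq_mul // leq_exp2r.
rewrite /nslots -expnM [(N - s) ^ _]expnM [N ^ (s * _)]expnM -expnMn.
case: (k * (3 + c)) => // e; rewrite leq_exp2r //; exact: pow_sub_half.
Qed.

(** The premise says 152(TSP - n) <= n/(64 mA); with the chance of a missed ball, test A succeeds
    with probability at most 1/(32 mA). Test B succeeds with probability at least (256 - 129 -
    5)/512 > 1/8, as N <= 2n, so [mB] = 8 * 5 runs all fail with probability at most 1/32. *)
Lemma block_yes : 64 * 152 * mA * TSP w <= (64 * 152 * mA).+1 * n ->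
  16 * SL N (mA * qA + mB * qB) (fun l => ~~ accept TA TB mA qA mB qB l : nat)
    <= N ^ (mA * qA + mB * qB).
Proof.
move=> yes; apply: accept_yes => //.
  have := testA_rare r0 wM conn (4 * H) rowsA s0 le_nN nslots n2.
  rewrite -/TA -/qA -/miss /qA expnS; move: yes miss_small c_big le_nN; rewrite /qA.
  move: (SL N nslots.+1 _) miss (TSP w) mA (N ^ c) (N ^ nslots) => a b t m nc z yes hm cb le_n h.
  rewrite -(leq_pmul2l (ltn0Sn 1)) !mulnA /=.
  have h1 : 64 * m * (n * b) <= n * z by nia.
  have h2 : 64 * m * (z * (152 * t)) <= 64 * m * (z * (152 * n)) + n * z by nia.
  have h3 : n * z <= N * z by rewrite leq_mul.
  have : 64 * m * (a + z * (152 * n)) <= 64 * m * (n * b + z * (152 * t)) by rewrite leq_mul.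
  by rewrite !mulnDr; lia.
have often := testB_often wM le_nN (ltnW n2) s0 le_Ns.
have neg := SL_neg le_nN qB TB.
have TBn : 8 * SL N qB (fun l => ~~ TB l : nat) <= 7 * N ^ qB.
  suff : N ^ qB <= 8 * SL N qB (fun l => TB l : nat).
    by move: neg; move: (SL N qB _) (SL N qB _) => a b; lia.
  move: often; rewrite -/TB -/qB /qB expnS.
  have : 128 * TSP w <= 129 * n.
    have mA1 : 1 <= mA by rewrite /mA; move: H_big; rewrite /mB; clear; lia.
    by move: yes mA1; move: mA (TSP w) => m t; clear; nia.
  move: (SL N _ _) (TSP w) (N ^ (s + N * 8)) => a t z ht.
  have := leq_mul le_N2n (leqnn z); nia.
by rewrite [mB * qB]mulnC expnM (pow_amplify 5 (a := 8)).
Qed.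

(** The factor 96 makes [#|bypassed|] at most n/(12H). If more than n/H vertices are inner, three
    times this and the two Markov losses cost n/(4H) each, leaving n/(4H) good heads; with N <= 2n
    and rare misses, test A succeeds with probability at least 1/(16H). *)
Lemma block_no : 2 * (96 * H) * n < 96 * H * TSP w + n ->
  16 * SL N (mA * qA + mB * qB) (fun l => accept TA TB mA qA mB qB l : nat)
    <= N ^ (mA * qA + mB * qB).
Proof.
move=> no; have adjS : symmetric (fun u v : 'I_n => w u v == 1).
  by move=> u v; have [_ _ -> _] := wM.
have [par [dep [tr norm]]] := normal_tree adjS (conn r0).
have H0 : 0 < H by move: H_big; rewrite /mB; clear; lia.
case: (leqP (H * #|nonleaf r0 par|) n) => [few|many].
  apply: accept_noB => //.
  have := testB_rare wM s le_nN (N * 8) (C := nonleaf r0 par) _.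
  move/(_ (fun u v uC vC => leaf_indep wM tr norm uC vC)); rewrite -/TB -/qB /qB expnS.
  move: #|nonleaf r0 par| (SL N _ _) (N ^ (s + N * 8)) few H_big => C x z few hb hx.
  have h1 : 16 * mB * x <= 16 * mB * (z * (2 * C)) by rewrite leq_mul.
  apply: leq_trans h1 _; apply: leq_trans (_ : H * (z * C) <= _).
    have -> : 16 * mB * (z * (2 * C)) = 16 * (2 * mB) * (z * C) by clear; lia.
    by rewrite leq_mul.
  by rewrite mulnCA mulnC leq_mul // (leq_trans few).
have By := bypassed_card wM tr.
have H4 : 0 < 4 * H by rewrite muln_gt0 H0.
have heads := good_heads_card wM conn tr norm (10 * s) nearmax H4.
have G_big : n <= 4 * H * #|good_heads w r0 par dep (4 * H) (10 * s) nearmax|.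
  move: By heads many no n2; have -> : nearmax.+1 = 4 * H * (10 * s).+1.
    by rewrite /nearmax prednK // !muln_gt0 H0.
  move: #|good_heads _ _ _ _ _ _ _| #|bypassed _ _ _ _| #|nonleaf _ _| (TSP w) (10 * s).+1 (ltn0Sn (10 * s)).
  move=> G B C t S S0 hB hG hC no n3.
  have hB' : 96 * H * B <= 8 * n by nia.
  have : 4 * H * S * (4 * H) * C <= 4 * H * S * (4 * H * (G + 3 * B) + 2 * n) by nia.
  rewrite -[_ * S * (4 * H) * C]mulnA leq_pmul2l; last by rewrite muln_gt0 H4.
  by nia.
have often := testA_often wM conn (4 * H) s0 le_nN tr norm (leqnn rowsA).
apply: (accept_noA le_nN); rewrite [mA * qA]mulnC expnM.
have -> : mA = 16 * H * 4 by rewrite /mA; clear; lia.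
apply: (pow_amplify 4); first by rewrite muln_gt0 H0.
have neg := SL_neg le_nN qA TA.
suff : N ^ qA <= 16 * H * SL N qA (fun l => TA l : nat).
  move: neg; move: (SL N qA _) (SL N qA _) (N ^ qA) => a b z; nia.
move: often; rewrite -/TA -/miss /qA expnS; move: miss_small c_big G_big le_N2n.
rewrite /mA; move: N miss (SL N nslots.+1 _) #|good_heads _ _ _ _ _ _ _| (N ^ c) (N ^ nslots).
move=> M b a G nc z hm cb hG le_M h.
have h1 : 8 * H * (n * b) <= n * z by nia.
have h2 : 2 * (n * z) <= 8 * H * (z * G) by nia.
have h3 : 8 * H * (z * G) <= 8 * H * (a + n * b) by rewrite leq_mul.
have h4 : M * z <= 2 * (n * z) by rewrite mulnA leq_mul.
move: h3; rewrite mulnDr; lia.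
Qed.

End Block.

Lemma upper_ratio (e t m : rat) : (0 < e -> e * t + m <= 2 * e * m -> t <= (2 - e^-1) * m)%R.
Proof.
move=> e0 le_t; rewrite (_ : (2 - e^-1) * m = (2 * e * m - m) / e)%R; last first.
  by field; rewrite gt_eqF.
by rewrite ler_pdivlMr // mulrC; lra.
Qed.

(** (2 - 1/f)(1 + 1/f) >= 2 for f >= 1. *)
Lemma lower_ratio (f t m : rat) :
  (0 <= m -> 1 <= f -> (f + 1) * m < f * t -> 2 * m <= (2 - f^-1) * t)%R.
Proof.
move=> m0 f1 lt_t; have f0 : (0 < f)%R by apply: lt_le_trans f1.
rewrite (_ : (2 - f^-1) * t = (2 * f - 1) * (f * t) / (f * f))%R; last by field; rewrite gt_eqF.
rewrite ler_pdivlMr ?mulr_gt0 //; apply: le_trans (_ : (2 * f - 1) * ((f + 1) * m) <= _)%R.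
  nra.
by rewrite ler_pM2l ?ltW //; lra.
Qed.

(** * The complete algorithm *)

Section Algorithm.
Variables (H c n : nat) (r0 : 'I_n).

Definition loglen := (trunc_log 2 n).+1.
(** A power of two whose square lies between N = 2^[loglen] and 4n. *)
Definition scale := 2 ^ uphalf loglen.
Definition bsize := mA H * qA c loglen scale + mB * qB loglen scale.

Definition acceptq (l : seq (option 'I_n)) : prog n bool :=
  bindq (hasq [seq testAq r0 scale (4 * H) (rowsA H c loglen scale) b
              | b <- blk (mA H) (qA c loglen scale) (take (mA H * qA c loglen scale) l)]) (fun a =>
  bindq (hasq [seq testBq scale b
              | b <- blk mB (qB loglen scale) (drop (mA H * qA c loglen scale) l)]) (fun b =>
  retq (~~ a && b))).

Definition decideq (l : seq (option 'I_n)) : prog n bool :=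
  bindq (seqq [seq acceptq b | b <- blk loglen bsize l])
    (fun bs => retq (loglen < 2 * count id bs)).

Definition valq (b : bool) : rat :=
  ((if b then 2 - (96 * H)%:R^-1 else 2) * n%:R)%R.

Definition tspq : qalg n :=
  drawq loglen (loglen * bsize) (fun l => decideq l (fun b => Ret n (valq b))).

Variable w : dist n.
Hypotheses (wM : pos_int_metric w) (conn : forall u v, connect (fun u v => w u v == 1) u v).
Hypothesis n2 : 2 < n.

Local Notation k := loglen.
Local Notation s := scale.
Local Notation N := (2 ^ k).
Local Notation acc := (accept (TA H c k s w r0) (TB s w) (mA H) (qA c k s) mB (qB k s)).

Let lt_nN : n < N. Proof. exact: trunc_log_ltn. Qed.
Let le_N2n : N <= 2 * n.
Proof. by rewrite expnS leq_mul // trunc_logP //; apply: ltnW (ltnW n2). Qed.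
Let s0 : 0 < s. Proof. by rewrite expn_gt0. Qed.
Let ss : s * s = 2 ^ (uphalf k).*2. Proof. by rewrite -addnn expnD. Qed.
Let le_Ns : N <= s * s.
Proof. by rewrite ss leq_exp2l // uphalf_half doubleD -{1}(odd_double_half k) leq_add2r; case: odd. Qed.
Let le_s4n : s * s <= 4 * n.
Proof.
rewrite (_ : 4 * n = 2 * (2 * n)); last by rewrite mulnA.
apply: leq_trans (leq_mul (leqnn 2) le_N2n).
rewrite ss -expnS leq_exp2l // -[X in _ <= X](odd_double_half k.+1); exact: leq_addl.
Qed.

Definition rowcost := mA H * (4 * H * (n * rowsA H c k s)) + (mB * (n * (s + 64 * s.+1)) + 0).

Lemma runs_accept l : runs w (acceptq l) (acc l) rowcost.
Proof.
have hA := runs_has (l := blk (mA H) (qA c k s) (take (mA H * qA c k s) l))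
  (fun b _ => runs_testA r0 wM s (4 * H) (rowsA H c k s) b).
have hB := runs_has (l := blk mB (qB k s) (drop (mA H * qA c k s) l))
  (fun b _ => runs_testB wM s b).
rewrite !size_blk in hA hB; apply: runs_bind hA _; apply: runs_bind hB _; exact: runs_ret.
Qed.

Lemma runs_decide l :
  runs w (decideq l) (k < 2 * count acc (blk k bsize l)) (k * rowcost).
Proof.
have h := runs_seq (l := blk k bsize l) (fun b _ => runs_accept b); rewrite size_blk in h.
rewrite -[X in runs _ _ _ X]addn0; apply: runs_bind h _.
by rewrite (_ : count acc _ = count id [seq acc b | b <- blk k bsize l]) ?count_map //; apply: runs_ret.
Qed.

(** Squaring avoids the exponent 1.5. One logarithm comes from the number of blocks and one from the
    number of random rows, hence [k ^ 4]. *)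
Lemma tspq_queries : num_queries w tspq ^ 2 <=
  4 * (mA H * (4 * H) * (5 + c + 44 * H) + mB * 129) ^ 2 * n ^ 3 * k ^ 4.
Proof.
have k0 : 0 < k by [].
have le_rows : rowsA H c k s <= s * k * (5 + c + 44 * H).
  rewrite /rowsA /nslots /nearmax; have : 0 < s * k by rewrite muln_gt0 s0.
  have : s <= s * k by rewrite leq_pmulr.
  have : (10 * s).+1 <= 11 * s by move: s0; clear; lia.
  move: (s * k) (mulnA s k (3 + c)) => sk ->; move: (10 * s).+1 => x; move: s => y; clear; nia.
have le_B : s + 64 * s.+1 <= s * k * 129.
  apply: leq_trans (_ : s * 129 <= _); first by move: s0; clear; lia.
  by rewrite leq_mul // leq_pmulr.
have le_cost : rowcost <= n * (s * k) * (mA H * (4 * H) * (5 + c + 44 * H) + mB * 129).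
  rewrite /rowcost addn0 [X in _ <= X]mulnDr leq_add //.
    apply: leq_trans (_ : mA H * (4 * H * (n * (s * k * (5 + c + 44 * H)))) <= _).
      by rewrite !leq_mul.
    by apply: eq_leq; ring.
  apply: leq_trans (_ : mB * (n * (s * k * 129)) <= _); first by rewrite !leq_mul.
  by apply: eq_leq; ring.
have le_q : num_queries w tspq <= k * rowcost.
  apply: drawq_queries => l _; have [_] := runs_decide l (fun b => Ret n (valq b)).
  by rewrite /= addn0.
set C1 := _ + mB * 129 in le_cost *.
apply: leq_trans (_ : (k * (n * (s * k) * C1)) ^ 2 <= _).
  by rewrite leq_exp2r // (leq_trans le_q) // leq_mul.
apply: leq_trans (_ : C1 ^ 2 * n ^ 2 * k ^ 4 * (s * s) <= _); first by apply: eq_leq; ring.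
apply: leq_trans (leq_mul (leqnn _) le_s4n) _; apply: eq_leq; ring.
Qed.

Hypotheses (H_big : 16 * (2 * mB) <= H) (c_big : 64 * mA H <= 4 ^ c).

Local Notation E := (96 * H).
Local Notation F := (64 * 152 * mA H).
Local Notation yes := (F * TSP w <= F.+1 * n).
Local Notation no := (2 * E * n < E * TSP w + n).

Definition good_value (X : rat) :=
  (((TSP w)%:R <= X) && (X <= (2 - F%:R^-1) * (TSP w)%:R))%R.

Let H0 : 0 < H. Proof. exact: leq_trans H_big. Qed.
Let E0 : (0 < E%:R :> rat)%R. Proof. by rewrite ltr0n muln_gt0 H0. Qed.
Let F0 : (0 < F%:R :> rat)%R. Proof. by rewrite ltr0n !muln_gt0 H0. Qed.
Let le_EF : (E%:R <= F%:R :> rat)%R.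
Proof. by rewrite ler_nat /mA; move: H; clear; lia. Qed.
Let le_nT : n <= TSP w. Proof. by apply: TSP_ge_n => //; apply: ltnW. Qed.
Let le_T2n : TSP w <= 2 * n.
Proof.
have adjS : symmetric (fun u v : 'I_n => w u v == 1) by move=> u v; have [_ _ -> _] := wM.
have [par [dep [tr _]]] := normal_tree adjS (conn r0).
by have := bypassed_card wM tr; move: (TSP w) #|_| => t b; clear; lia.
Qed.

Let good_true : ~~ no -> good_value (valq true).
Proof.
rewrite -leqNgt -(ler_nat rat) natrD !natrM -[(96%:R * H%:R)%R]natrM => le_no.
have le_nT' : (n%:R <= (TSP w)%:R :> rat)%R by rewrite ler_nat.
have E1 : (1 <= E%:R :> rat)%R by rewrite ler1n muln_gt0 H0.
have E1' : (E%:R^-1 <= 1 :> rat)%R by rewrite invf_le1.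
rewrite /good_value /valq (upper_ratio E0 le_no) /=.
have le_inv : (F%:R^-1 <= E%:R^-1 :> rat)%R by rewrite lef_pV2.
by apply: ler_pM => //; [lra | lra].
Qed.

Let good_false : ~~ yes -> good_value (valq false).
Proof.
rewrite -ltnNge => lt_yes.
have {}lt_yes : ((F%:R + 1) * n%:R < F%:R * (TSP w)%:R :> rat)%R.
  by move: lt_yes; move: F => f; rewrite -(ltr_nat rat) !natrM -addn1 natrD.
rewrite /good_value /valq -natrM ler_nat le_T2n /= natrM.
apply: lower_ratio lt_yes => //; rewrite ?ler0n // (le_trans _ le_EF) // ler1n muln_gt0 H0 //.
Qed.

Let yes_not_no : yes -> ~~ no.
Proof.
rewrite -leqNgt; have : 96 * H <= F by rewrite -(ler_nat rat).
have : 2 <= 96 * H by move: H0; clear; lia.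
by move: F (96 * H) (TSP w) => f e t; clear; nia.
Qed.

Lemma tspq_success : (1 - n%:R^-1 <= success_prob w good_value tspq)%R.
Proof.
have le_nN := ltnW lt_nN.
pose dec l := k < 2 * count acc (blk k bsize l).
pose f l : nat := good_value (valq (dec l)).
rewrite /tspq (drawq_success (f := f)) //; last first.
  move=> l _; have [-> _] := runs_decide l (fun b => Ret n (valq b)).
  by rewrite /= -/(dec l) /f; case: (good_value _).
have c_big' : 64 * mA H <= N ^ c.
  have N4 : 4 <= N by apply: leq_trans lt_nN.
  apply: leq_trans c_big _; move: N4; move: N => M M4.
  by elim: (c) => // e IH; rewrite !expnS leq_mul.
suff [wrong [le_W le_f]] : exists wrong : seq (option 'I_n) -> bool,
    2 ^ k * SL N (k * bsize) (fun l => wrong l : nat) <= N ^ (k * bsize) /\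
    forall l, 1 <= f l + wrong l.
  have n0 : (0 < n%:R :> rat)%R by rewrite ltr0n; apply: ltnW (ltnW n2).
  have Z0 : (0 < (N ^ (k * bsize))%:R :> rat)%R by rewrite ltr0n expn_gt0 expn_gt0.
  have : n * N ^ (k * bsize) <= n * SL N (k * bsize) f + N ^ (k * bsize).
    have := SL_le N (q := k * bsize) (fun l _ => le_f l).
    rewrite (SL_const le_nN) muln1 SLD => le_Z.
    apply: leq_trans (leq_mul (leqnn n) le_Z) _; rewrite mulnDr leq_add2l.
    by apply: leq_trans le_W; rewrite leq_mul.
  rewrite -(ler_nat rat) natrD !natrM ler_pdivlMr //.
  move: (N ^ _)%:R%R (SL _ _ _)%:R%R n%:R%R n0 => z x m m0 le_z.
  rewrite -(ler_pM2l m0) (_ : m * ((1 - m^-1) * z) = m * z - z)%R; last by field; rewrite gt_eqF.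
  by lra.
have cC l : count acc (blk k bsize l) + count (predC acc) (blk k bsize l) = k.
  by rewrite count_predC size_blk.
(* A wrong majority has probability at most 2^-k < 1/n; between the two thresholds both outputs are
   good. *)
case: (boolP yes) => [y|ny]; last case: (boolP no) => [no_|nn].
- exists (fun l => k <= 2 * count (predC acc) (blk k bsize l)); split.
    by apply: SL_majority => //; apply: block_yes.
  move=> l; rewrite /f /dec; have := cC l.
  case: (leqP k _) => [|lt1 eqk]; first by rewrite addn1.
  have -> : k < 2 * count acc (blk k bsize l) by move: lt1 eqk; clear; lia.
  by rewrite good_true // yes_not_no.
- exists (fun l => k <= 2 * count acc (blk k bsize l)); split.
    by apply: SL_majority => //; apply: block_no.
  move=> l; rewrite /f /dec; case: (leqP k _) => [|lt1]; first by rewrite addn1.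
  have -> : (k < 2 * count acc (blk k bsize l)) = false by rewrite ltnNge ltnW.
  by rewrite good_false.
- exists (fun=> false); split; first by rewrite (SL_const le_nN) !muln0.
  by move=> l; rewrite /f; case: (dec l); rewrite ?good_true ?good_false.
Qed.

End Algorithm.

Local Open Scope ring_scope.

Lemma unit_mst_connect n (w : dist n) : pos_int_metric w -> mst_all_ones w ->
  forall u v, connect (fun u v => w u v == 1%N) u v.
Proof.
move=> [_ _ wS _] [T [[/and3P [_ _ /forallP conn] _] T1]] u v.
have /forallP /(_ v) := conn u; apply: connect_sub => a b.
by case/orP=> /T1 /= ab; apply: connect1; [rewrite ab | rewrite wS ab].
Qed.

Definition tsp_alg (H c n : nat) : qalg n :=
  match n with
  | m.+3 => tspq H c (@ord0 m.+2)
  | m => Ret m m%:R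
  end.

Theorem theorem1p7 :
  exists eps0 : rat, 0 < eps0 /\
  exists (A : forall n : nat, qalg n) (C k : nat),
  forall (n : nat) (w : dist n),
    pos_int_metric w -> mst_all_ones w ->
    (* O~(n^1.5) queries:  q^2 <= C * n^3 * (log n + 1)^k *)
    (num_queries w (A n) ^ 2 <= C * n ^ 3 * (trunc_log 2 n).+1 ^ k)%N /\
    (* with high probability (>= 1 - 1/n) the output X satisfies
       TSP(w) <= X <= (2 - eps0) TSP(w) *)
    ((1 <= n)%N ->
     1 - (n%:R)^-1 <=
       success_prob w
         (fun X : rat => ((TSP w)%:R <= X) && (X <= (2 - eps0) * (TSP w)%:R))
         (A n)).
Proof.
have [H H_big] : exists H, (16 * (2 * mB) <= H)%N by eexists; apply: leqnn.
have [c c_big] : exists c, (64 * mA H <= 4 ^ c)%N.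
  by exists (64 * mA H)%N; apply: ltnW; apply: ltn_expl.
exists (64 * 152 * mA H)%N%:R^-1; split.
  by rewrite invr_gt0 ltr0n !muln_gt0 (leq_trans _ H_big).
exists (tsp_alg H c), (4 * (mA H * (4 * H) * (5 + c + 44 * H) + mB * 129) ^ 2)%N, 4.
(* Up to two points the output is [n] without queries. The probability bound is 0 for one point, and
   TSP = 2 for two points. *)
case=> [|[|[|m]]] w wM /(unit_mst_connect wM) conn; split=> //.
- by move=> _; rewrite invr1 subrr /=; case: ifP.
- move=> _; have TSP2 : TSP w = 2%N.
    have adjS : symmetric (fun u v : 'I_2 => w u v == 1%N) by move=> u v; have [_ _ -> _] := wM.
    have [par [dep [tr _]]] := normal_tree adjS (conn ord0).
    have := bypassed_card wM tr; have := TSP_ge_n wM isT.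
    by move: (TSP w) #|_| => t b; clear; lia.
  rewrite /= TSP2 lexx /= ifT; first by lra.
  have F1 : (1 : rat) <= (64 * 152 * mA H)%N%:R.
    by rewrite ler1n !muln_gt0 (leq_trans _ H_big).
  have : (64 * 152 * mA H)%N%:R^-1 <= 1 :> rat by rewrite invf_le1 // (lt_le_trans _ F1).
  by lra.
- exact: tspq_queries.
- by move=> _; apply: tspq_success.
Qed.
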